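(* Let $\mathfrak{v}$ be a finite dimensional real vector space and let $G\subseteq \mathrm{GL}(\mathfrak{v})$ be a compact linear group. Then $G$ satisfies property (SP) if and only if $G$ is polar and its Weyl group is a Coxeter group.
   Context: Fix an inner product $\langle\cdot,\cdot\rangle$ on $\mathfrak{v}$ such that $G\subseteq \mathrm{O}(\mathfrak{v})$. The group $G$ is not assumed connected and may be finite. $O_v=Gv$ is the $G$-orbit of $v\in\mathfrak{v}$; $\widehat{X}$ is the convex hull of $X\subseteq\mathfrak{v}$; $A+B=\{a+b: a\in A,\ b\in B\}$ is the Minkowski sum. Property (SP): the family $\{\widehat{O}_v\}_{v\in\mathfrak{v}}$ of convex hulls of orbits is a semigroup with respect to Minkowski addition, i.e. for all $u,v\in\mathfrak{v}$ there is $w\in\mathfrak{v}$ with $\widehat{O}_u+\widehat{O}_v=\widehat{O}_w$. $G$ is polar if there is a linear subspace $\mathfrak{a}\subseteq\mathfrak{v}$ (a Cartan subspace) such that (A) each orbit $O_v$, $v\in\mathfrak{v}$, meets $\mathfrak{a}$; (B) for each $u\in\mathfrak{a}$ the tangent space $T_uO_u$ is orthogonal to $\mathfrak{a}$. The Weyl group of a polar group $G$ with Cartan subspace $\mathfrak{a}$ is $W=\{g\in G: g\mathfrak{a}=\mathfrak{a}\}\big|_{\mathfrak{a}}$, the group of restrictions to $\mathfrak{a}$ (a finite linear group on $\mathfrak{a}$; any two Cartan subspaces are related by an element of $G$, so the choice of $\mathfrak{a}$ is immaterial). A Coxeter group here means a finite linear group (acting orthogonally) generated by reflections in hyperplanes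 (the trivial group is included). *)

(* Defs.v *)
From HB Require Import structures.
From mathcomp Require Import all_boot all_order all_algebra.
From mathcomp Require Import all_classical all_reals all_analysis.
Import Order.TTheory GRing.Theory Num.Theory.
Import numFieldNormedType.Exports.

Set Implicit Arguments.
Unset Strict Implicit.
Unset Printing Implicit Defensive.

Local Open Scope classical_set_scope.
Local Open Scope ring_scope.

(* The library puts no topology on an abstract [vectType]. Compactness and
   derivatives below are those of coordinates in the basis [vbasis fullv]; the
   resulting topology does not depend on the basis. *)

Section LinearGroups.
Variables (R : realType) (V : vectType R).
Implicit Types (G S : set 'End(V)) (f g : 'End(V)).

(* [f^-1] is the inverse of [f] as soon as [f] has trivial kernel. *)
Definition linear_group G : Prop :=
  [/\ G \1%VF,
      forall f g, G f -> G g -> G (f \o g)%VF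
    & forall f, G f -> lker f == 0%VS /\ G (f^-1)%VF].

Definition compact_endos G : Prop :=
  compact (passmx.mxof (vbasis fullv) (vbasis fullv) @` G
           : set 'M[R]_(\dim {: V}, \dim {: V})).

Definition orthogonal_endos (ip : V -> V -> R) G : Prop :=
  forall g, G g -> forall x y, ip (g x) (g y) = ip x y.

Definition reflection (ip : V -> V -> R) f : Prop :=
  exists2 r : V, r != 0 &
    forall x, f x = x - (2 * ip x r / ip r r) *: r.

Definition coxeter_group (ip : V -> V -> R) G : Prop :=
  [/\ finite_set G, orthogonal_endos ip G &
      exists2 S, S `<=` reflection ip & G = smallest linear_group S].

Definition orbit G (v : V) : set V := [set g v | g in G].

Definition convex_hull (X : set V) : set V := smallest (@convex_set R V) X.

Definition minkowski_sum (A B : set V) : set V :=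
  [set a + b | a in A & b in B].

Definition property_SP G : Prop :=
  forall u v, exists w,
    minkowski_sum (convex_hull (orbit G u)) (convex_hull (orbit G v)) =
    convex_hull (orbit G w).

(* Velocities at [u] of differentiable curves running in [X]; when [X] is an
   embedded submanifold, such as an orbit of a compact group, this is the usual
   tangent space to [X] at [u]. *)
Definition tangent_space (X : set V) (u : V) : set V :=
  [set w | exists c : R -> V,
    let x : R -> 'rV[R]_(\dim {: V}) := passmx.rVof (vbasis fullv) \o c in
    [/\ c 0 = u, forall t, X (c t), forall t, derivable x t 1
      & 'D_1 x 0 = passmx.rVof (vbasis fullv) w]].

Definition cartan_subspace (ip : V -> V -> R) G (a : {vspace V}) : Prop :=
  (forall v, exists2 x, orbit G v x & x \in a) /\
  (forall u, u \in a -> forall w, tangent_space (orbit G u) u w ->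
     forall x, x \in a -> ip w x = 0).

Definition weyl_group G (a : {vspace V}) : set 'End(subvs_of a) :=
  [set f | exists2 g, G g &
    (g @: a)%VS = a /\ forall x, vsval (f x) = g (vsval x)].

Definition restrict_ip (ip : V -> V -> R) (a : {vspace V})
    (x y : subvs_of a) : R :=
  ip (vsval x) (vsval y).

End LinearGroups.

Arguments weyl_group {R V} G a _.
Arguments restrict_ip {R V} ip a x y.

(* Main.v *)
(* Write h_u(x) = max_g <g u, x> for the support function of the hull of the
   orbit of u, and call u, x aligned when <u, x> = h_u(x). Property (SP) says
   that the functions h_u form a semigroup under addition.

   If (SP) holds, then h_(x + y) = h_x + h_y for aligned x, y, so the vectors
   aligned with x + y are those aligned with both. A maximal linearly independent
   family of pairwise aligned vectors therefore spans a subspace [a] in which the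
   vectors aligned with the sum [z] of the family form a closed convex cone C
   with interior, meeting each orbit in exactly one point. Pushing a point b of
   the boundary of C that has a single unit normal r slightly outside and
   bringing it back to C by elements of G yields in the limit an element of G
   that fixes b and acts on [a] as the reflection along r. These reflections move
   every point of [a] into C; hence [a] is a Cartan subspace, and its Weyl group
   is finite and generated by reflections.

   Conversely, let [a] be a Cartan subspace. Limits of difference quotients
   (g_k - 1) / e_k with g_k -> 1 in G generate one-parameter subgroups of G, so
   by (B) they map [a] into its orthogonal complement. At a point z of [a] with
   smallest normal space, an infinitesimal isometry killing z kills the whole
   normal space; comparing z with nearby normal vectors moved into [a] then shows
   that the normal space is [a] itself. Such regular points are dense in [a], and
   between them <g u, x> is maximal at an element g preserving [a]. If the Weyl
   group is a Coxeter group, it follows that any two vectors of a closed chamber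
   are aligned, so h_(u + v) = h_u + h_v on the chamber, and the hulls add up. *)

(* The group is only a compact set of endomorphisms, possibly finite, so every infinitesimal
   statement has to come from limits of its elements.

   From (SP) this costs little: a velocity at a maximum of a linear function is orthogonal to its
   gradient, so (B) follows from alignment. The additivity of [h] on aligned vectors is an equality
   case: (SP) gives [w] with h_x + h_y = h_w, and evaluating at x + y and at [w] forces these two
   vectors to have the same norm and then the same orbit.

   In the converse, (B) speaks of curves in orbits, so generators must first be integrated. The hard
   point is that the normal space at a suitable point of [a] is no larger than [a]: (A) brings
   nearby normal vectors into [a] by elements that may move the normal space, and these are
   corrected by elements fixing it pointwise. For a finite group every normal space is the whole
   space, and the conclusion reads: [a] is everything.

   Support functions determine the hulls of orbits because these hulls are closed; this is where
   Caratheodory's theorem enters. *)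
From HB Require Import structures.
From mathcomp Require Import all_boot all_order all_algebra.
From mathcomp Require Import all_classical all_reals all_analysis.
From mathcomp Require Import ring lra.
Require Import Defs.
Import Order.TTheory GRing.Theory Num.Theory.
Import numFieldNormedType.Exports.
Local Open Scope classical_set_scope.
Local Open Scope ring_scope.

Set Implicit Arguments.
Unset Strict Implicit.
Unset Printing Implicit Defensive.

(** * Limits along an ultrafilter *)

(* Limits are taken along a fixed free ultrafilter on [nat]: every bounded
   sequence has one, so no subsequences have to be extracted. *)
Definition uf : set_system nat := sval (cid (@ultraFilterLemma nat \oo _)).

#[global] Instance uf_ultra : UltraFilter uf.
Proof. by rewrite /uf; case: cid => /= ? []. Qed.

Lemma uf_oo : \oo `<=` uf.
Proof. by rewrite /uf; case: cid => /= ? []. Qed.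

Lemma uf_geq (A : set nat) n : uf A -> exists2 k, (n <= k)%N & A k.
Proof.
move=> ufA; have ufn : uf [set k | (n <= k)%N].
  by apply: uf_oo; exists n.
by have [k [Ak nk]] := filter_ex (filterI ufA ufn); exists k.
Qed.

Lemma fmap_ultra (T U : Type) (f : T -> U) (F : set_system T) :
  UltraFilter F -> UltraFilter (f @ F).
Proof.
move=> FU; split; first exact: fmap_proper_filter.
move=> H HF sub; apply/seteqP; split; last exact: sub.
move=> A HA; have [//|nA] := in_ultra_setVsetC (f @^-1` A) FU.
have /filter_ex[x []//] : H (A `&` ~` A).
by apply: filterI HA _; apply: sub; rewrite /= /fmap /= preimage_setC.
Qed.

Lemma cvg_sum (R : realType) (U : normedModType R) (T : Type) (F : set_system T)
    {FF : Filter F} (I : Type) (s : seq I) (P : pred I) (f : I -> T -> U) (l : I -> U) :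
  (forall i, P i -> f i @ F --> l i) ->
  (fun t => \sum_(i <- s | P i) f i t) @ F --> \sum_(i <- s | P i) l i.
Proof.
move=> fl; elim: s => [|i s IH].
  rewrite big_nil; under eq_fun do rewrite big_nil; exact: cvg_cst.
rewrite big_cons; under eq_fun do rewrite big_cons.
by case: ifPn => [Pi|_]; [apply: cvgD; [exact: fl|exact: IH]|exact: IH].
Qed.

Section UltraLimits.
Variable R : realType.
Implicit Types (a b : nat -> R) (l m : R).

Definition ulim a l : Prop := a @ uf --> l.

Lemma ulim_cst l : ulim (fun=> l) l.
Proof. exact: cvg_cst. Qed.
Arguments ulim_cst l : clear implicits.

Lemma ulim_eq a b l : uf [set k | a k = b k] -> ulim a l -> ulim b l.
Proof.
move=> ab; apply: cvg_trans; apply: near_eq_cvg.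
by apply: filterS ab => k /= ->.
Qed.

Lemma ulim_ext a b l : a =1 b -> ulim a l -> ulim b l.
Proof. by move=> ab; apply: ulim_eq; apply: nearW. Qed.

Lemma ulimD a b l m : ulim a l -> ulim b m -> ulim (fun k => a k + b k) (l + m).
Proof. exact: (@cvgD R R^o). Qed.

Lemma ulimN a l : ulim a l -> ulim (fun k => - a k) (- l).
Proof. exact: (@cvgN R R^o). Qed.

Lemma ulimB a b l m : ulim a l -> ulim b m -> ulim (fun k => a k - b k) (l - m).
Proof. exact: (@cvgB R R^o). Qed.

Lemma ulimM a b l m : ulim a l -> ulim b m -> ulim (fun k => a k * b k) (l * m).
Proof. exact: cvgM. Qed.

Lemma ulimX a l n : ulim a l -> ulim (fun k => a k ^+ n) (l ^+ n).
Proof.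
move=> al; elim: n => [|n IH]; first exact: ulim_cst.
by rewrite exprS; apply: ulim_ext (ulimM al IH) => k; rewrite exprS.
Qed.

Lemma ulimV a l : l != 0 -> ulim a l -> ulim (fun k => (a k)^-1) l^-1.
Proof. exact: cvgV. Qed.

Lemma ulim_le a b l m : ulim a l -> ulim b m -> uf [set k | a k <= b k] -> l <= m.
Proof. exact: ler_cvg_to. Qed.

Lemma ulim_ge0 a l : ulim a l -> (forall k, 0 <= a k) -> 0 <= l.
Proof. by move=> al a0; apply: (ulim_le (ulim_cst 0) al); apply: nearW. Qed.

Lemma ulim_lew a b l m : ulim a l -> ulim b m -> (forall k, a k <= b k) -> l <= m.
Proof. by move=> al bm ab; apply: (ulim_le al bm); apply: nearW. Qed.

Lemma ulim_unique a l m : ulim a l -> ulim a m -> l = m.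
Proof.
by move=> al am; apply/le_anti; rewrite (ulim_lew al am)// (ulim_lew am al).
Qed.

Lemma ulim_squeeze a b c l : uf [set k | a k <= b k <= c k] ->
  ulim a l -> ulim c l -> ulim b l.
Proof. by move=> abc al cl; apply: squeeze_cvgr al cl. Qed.

Lemma ulim_norm0 a b : uf [set k | `|a k| <= b k] -> ulim b 0 -> ulim a 0.
Proof.
move=> ab b0; apply: (@ulim_squeeze (fun k => - b k) a b) => //.
  by apply: filterS ab => k /=; rewrite ler_norml.
by rewrite -oppr0; exact: ulimN.
Qed.

Lemma ulim_bounded a M : (forall k, `|a k| <= M) -> exists l, ulim a l.
Proof.
move=> aM.
have : compact `[- M, M] by exact: segment_compact.
move=> /(_ (a @ uf) _)[].
  by apply: nearW => k; rewrite /= in_itv/= -ler_norml.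
move=> l [_ cl]; exists l.
have UF : UltraFilter (a @ uf) := fmap_ultra a uf_ultra.
by rewrite ultra_cvg_clusterE in cl.
Qed.

Lemma ulim_lt_near a l m : ulim a l -> l < m -> uf [set k | a k < m].
Proof. by move=> al lm; exact: (cvgr_lt l). Qed.

Lemma ulim_gt_near a l m : ulim a l -> m < l -> uf [set k | m < a k].
Proof. by move=> al lm; exact: (cvgr_gt l). Qed.

Lemma ulim_sum (I : Type) (s : seq I) (P : pred I) (F : I -> nat -> R) (L : I -> R) :
  (forall i, P i -> ulim (F i) (L i)) ->
  ulim (fun k => \sum_(i <- s | P i) F i k) (\sum_(i <- s | P i) L i).
Proof. exact: (@cvg_sum R R^o). Qed.

Lemma ulim_harmonic : ulim (fun k => k.+1%:R^-1) 0.
Proof. by move=> A /cvg_harmonic; apply: uf_oo. Qed.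

Lemma ulim_sqrt a l : ulim a l -> ulim (fun k => Num.sqrt (a k)) (Num.sqrt l).
Proof. by move=> al; apply: continuous_cvg al; exact: sqrt_continuous. Qed.

(* No semicontinuity of [f] on all of [S] is assumed, only what compactness of
   [S] would give along the ultrafilter. *)
Lemma ulim_attain (T : Type) (S : T -> Prop) (f : T -> R) :
  (exists s, S s) ->
  (forall s_ : nat -> T, (forall k, S (s_ k)) ->
     exists s, S s /\ ulim (fun k => f (s_ k)) (f s)) ->
  exists s, S s /\ forall t, S t -> f t <= f s.
Proof.
move=> [s0 Ss0] cpt.
have bnd : has_ubound [set f s | s in S].
  apply: contrapT => nb.
  have h k : exists s, S s /\ k%:R < f s.
    apply: contrapT => /forallNP h; apply: nb; exists k%:R => _ [s Ss <-].
    by rewrite leNgt; apply/negP => ks; apply: (h s).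
  have [s_ hs] := choice h.
  have [s [Ss fs]] := cpt s_ (fun k => (hs k).1).
  have s1 : f s < f s + 1 by rewrite ltrDl.
  have lt1 := ulim_lt_near fs s1.
  have [k nk /= fk] := uf_geq (Num.bound `|f s + 1|) lt1.
  have := lt_trans (hs k).2 fk; rewrite ltNge.
  have -> // : f s + 1 <= k%:R.
  apply: le_trans (ler_norm _) _; apply: ltW.
  by apply: lt_le_trans (archi_boundP (normr_ge0 _)) _; rewrite ler_nat.
have hsup : has_sup [set f s | s in S] by split => //; exists (f s0); exists s0.
have h k : exists s, S s /\ sup [set f s | s in S] - k.+1%:R^-1 < f s.
  have k0 : 0 < k.+1%:R^-1 :> R by rewrite invr_gt0.
  by have [_ [s Ss <-] hs] := sup_adherent k0 hsup; exists s.
have [s_ hs] := choice h.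
have [s [Ss fs]] := cpt s_ (fun k => (hs k).1).
exists s; split => // t St.
apply: (@le_trans _ _ (sup [set f s | s in S])).
  by apply: (ub_le_sup bnd); exists t.
have := ulimB (ulim_cst (sup [set f s | s in S])) ulim_harmonic.
rewrite subr0 => h2; apply: (ulim_lew h2 fs) => k; exact: ltW (hs k).2.
Qed.

End UltraLimits.
Arguments ulim_cst {R} l.
Arguments ulim_harmonic {R}.

(** * Euclidean spaces *)

Section SubspaceOf.
Variables (R : realType) (V : vectType R).

(** A subspace of largest dimension inside [P] exhausts [P]: any further vector would allow a line
    to be added. *)
Lemma subspace_of (P : V -> Prop) : P 0 ->
  (forall a x y, P x -> P y -> P (a *: x + y)) ->
  exists U : {vspace V}, forall x, x \in U <-> P x.
Proof.
move=> P0 PD.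
pose Q (n : nat) := `[< exists U : {vspace V}, \dim U = n /\ forall x, x \in U -> P x >].
have Q0 : exists n, Q n.
  exists 0%N; apply/asboolP; exists 0%VS; rewrite dimv0; split => // x.
  by rewrite memv0 => /eqP ->.
have Qb n : Q n -> (n <= \dim {: V})%N.
  by move/asboolP => [U [<- _]]; apply: dimvS; apply: subvf.
case: (ex_maxnP Q0 Qb) => n /asboolP [U [dU UP]] nmax.
exists U => x; split; first exact: UP.
move=> Px; apply: contrapT => /negP xU.
have : Q (\dim (U + <[x]>)%VS).
  apply/asboolP; exists (U + <[x]>)%VS; split => // _ /memv_addP[u uU [_ /vlineP[a ->] ->]].
  by rewrite addrC; apply: PD => //; apply: UP.
move/nmax; rewrite -dU => h.
have /eqP E : (U == U + <[x]>)%VS by rewrite -(geq_leqif (dimv_leqif_eq (addvSl _ _))).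
by move: xU; rewrite E memvE addvSr.
Qed.

End SubspaceOf.

(** A bare predicate, so that it applies both to the form on [V] and to its restriction to
    [subvs_of a]. *)
Definition inner (R : realType) (V : vectType R) (ip : V -> V -> R) : Prop :=
  [/\ forall a x y z, ip (a *: x + y) z = a * ip x z + ip y z,
      forall x y, ip x y = ip y x
    & forall x, x != 0 -> 0 < ip x x].

Section Euclid.
Variables (R : realType) (V : vectType R) (ip : V -> V -> R).
Hypothesis hip : inner ip.

Lemma ipC x y : ip x y = ip y x.
Proof. by case: hip. Qed.

Lemma ipDl x y z : ip (x + y) z = ip x z + ip y z.
Proof. by case: hip => h _ _; rewrite -{1}(scale1r x) h mul1r. Qed.

Lemma ip0l z : ip 0 z = 0.
Proof. by apply: (addrI (ip 0 z)); rewrite -ipDl !addr0. Qed.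

Lemma ipZl a x z : ip (a *: x) z = a * ip x z.
Proof. by case: hip => h _ _; rewrite -(addr0 (a *: x)) h ip0l addr0. Qed.

Lemma ipDr x y z : ip z (x + y) = ip z x + ip z y.
Proof. by rewrite ipC ipDl !(ipC _ z). Qed.

Lemma ipZr a x z : ip z (a *: x) = a * ip z x.
Proof. by rewrite ipC ipZl ipC. Qed.

Lemma ip0r z : ip z 0 = 0.
Proof. by rewrite ipC ip0l. Qed.

Lemma ipNl x z : ip (- x) z = - ip x z.
Proof. by rewrite -scaleN1r ipZl mulN1r. Qed.

Lemma ipNr x z : ip z (- x) = - ip z x.
Proof. by rewrite ipC ipNl ipC. Qed.

Lemma ipBl x y z : ip (x - y) z = ip x z - ip y z.
Proof. by rewrite ipDl ipNl. Qed.

Lemma ipBr x y z : ip z (x - y) = ip z x - ip z y.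
Proof. by rewrite ipDr ipNr. Qed.

Definition ipE := (ipDl, ipDr, ipNl, ipNr, ipZl, ipZr, ip0l, ip0r).

Lemma ip_suml I (s : seq I) (P : pred I) (F : I -> V) z :
  ip (\sum_(i <- s | P i) F i) z = \sum_(i <- s | P i) ip (F i) z.
Proof.
by elim/big_rec2: _ => [|i y x _ <-]; [rewrite ip0l|rewrite ipDl].
Qed.

Lemma ip_sumr I (s : seq I) (P : pred I) (F : I -> V) z :
  ip z (\sum_(i <- s | P i) F i) = \sum_(i <- s | P i) ip z (F i).
Proof. by rewrite ipC ip_suml; apply: eq_bigr => i _; rewrite ipC. Qed.

Lemma ip_gt0 x : x != 0 -> 0 < ip x x.
Proof. by case: hip => _ _; apply. Qed.

Lemma ip_ge0 x : 0 <= ip x x.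
Proof. by have [->|/ip_gt0/ltW//] := eqVneq x 0; rewrite ip0l. Qed.

Lemma ip_eq0 x : (ip x x == 0) = (x == 0).
Proof.
by apply/idP/eqP => [|->]; [apply: contraTeq => /ip_gt0; rewrite lt0r => /andP[]|rewrite ip0l].
Qed.

Lemma ip_eq x y : (forall z, ip x z = ip y z) -> x = y.
Proof. by move=> h; apply/eqP; rewrite -subr_eq0 -ip_eq0 ipBl h subrr. Qed.

Definition nrm x := Num.sqrt (ip x x).

Lemma nrm_ge0 x : 0 <= nrm x. Proof. exact: sqrtr_ge0. Qed.

Lemma nrm_sq x : nrm x ^+ 2 = ip x x.
Proof. by rewrite sqr_sqrtr// ip_ge0. Qed.

Lemma nrm0 : nrm 0 = 0. Proof. by rewrite /nrm ip0l sqrtr0. Qed.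

Lemma nrm_eq0 x : (nrm x == 0) = (x == 0).
Proof. by rewrite -ip_eq0 -nrm_sq sqrf_eq0. Qed.

Lemma nrm_gt0 x : (0 < nrm x) = (x != 0).
Proof. by rewrite lt0r nrm_eq0 nrm_ge0 andbT. Qed.

Lemma nrmZ a x : nrm (a *: x) = `|a| * nrm x.
Proof. by rewrite /nrm ipZl ipZr mulrA sqrtrM ?sqr_ge0// -expr2 sqrtr_sqr. Qed.

Lemma nrmN x : nrm (- x) = nrm x.
Proof. by rewrite -scaleN1r nrmZ normrN1 mul1r. Qed.

Lemma cauchy_schwarz x y : ip x y <= nrm x * nrm y.
Proof.
have [->|x0] := eqVneq x 0; first by rewrite ip0l nrm0 mul0r.
have [->|y0] := eqVneq y 0; first by rewrite ip0r nrm0 mulr0.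
have := ip_ge0 (nrm y *: x - nrm x *: y).
rewrite !ipE (ipC y x) -!nrm_sq.
have := nrm_gt0 x; have := nrm_gt0 y; rewrite x0 y0; move: (nrm x) (nrm y) => a b b0 a0 h.
have ab : 0 < a * b by rewrite mulr_gt0.
rewrite -(ler_pM2l ab); nra.
Qed.

Lemma cauchy_schwarz_abs x y : `|ip x y| <= nrm x * nrm y.
Proof. by rewrite ler_norml cauchy_schwarz andbT lerNl -ipNl -(nrmN x) cauchy_schwarz. Qed.

Lemma cauchy_schwarz_eq x y : ip x x = ip y y -> ip x y = ip x x -> x = y.
Proof.
move=> xx xy; apply/eqP; rewrite -subr_eq0 -ip_eq0 !ipE (ipC y x) xy -xx; lra.
Qed.

Lemma nrmD x y : nrm (x + y) <= nrm x + nrm y.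
Proof.
rewrite -(@ler_pXn2r _ 2) ?nnegrE ?addr_ge0 ?nrm_ge0// nrm_sq !ipE (ipC y x).
have := cauchy_schwarz x y; rewrite sqrrD !nrm_sq; lra.
Qed.

Lemma nrmB x y : nrm (x - y) <= nrm x + nrm y.
Proof. by rewrite -(nrmN y) nrmD. Qed.

Lemma nrm_le x M : 0 <= M -> ip x x <= M ^+ 2 -> nrm x <= M.
Proof. by move=> M0 h; rewrite -(@ler_pXn2r _ 2) ?nnegrE ?nrm_ge0// nrm_sq. Qed.

Definition orthonormal_family n (e : 'I_n -> V) :=
  forall i j, ip (e i) (e j) = (i == j)%:R.

Lemma orthonormal_basis (a : {vspace V}) : exists n (e : 'I_n -> V),
  [/\ orthonormal_family e, forall i, e i \in a
    & forall x, x \in a -> x = \sum_i ip x (e i) *: e i].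
Proof.
have [m] := ubnP (\dim a); elim: m a => // m IH a am.
have [->|a0] := eqVneq a 0%VS.
  exists 0%N, (fun=> 0); split => [[]//|[]//|x]; rewrite memv0 => /eqP->.
  by rewrite big_ord0.
have [v va v0] : exists2 v, v \in a & v != 0.
  by exists (vpick a); rewrite ?memv_pick// vpick0.
pose u := (nrm v)^-1 *: v.
have ua : u \in a by rewrite rpredZ.
have uu : ip u u = 1.
  rewrite !ipE -nrm_sq; have : nrm v != 0 by rewrite nrm_eq0.
  by move: (nrm v) => t t0; field.
have [b hb] : exists b : {vspace V}, forall x, x \in b <-> (x \in a /\ ip x u = 0).
  apply: subspace_of; first by rewrite mem0v ip0l.
  move=> c x y [xa xu] [ya yu]; split; first by rewrite rpredD// rpredZ.
  by rewrite ipDl ipZl xu yu mulr0 addr0.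
have ba : (b <= a)%VS by apply/subvP => x /hb[].
have ltb : (\dim b < m)%N.
  rewrite -ltnS; apply: leq_trans am; rewrite ltnS ltn_neqAle dimvS// andbT.
  apply/negP => /eqP E; have /eqP Eab : (b == a)%VS.
    by rewrite -(geq_leqif (dimv_leqif_eq ba)) E.
  have /hb[_] : u \in b by rewrite Eab.
  by rewrite uu => /eqP; rewrite oner_eq0.
have [n [e [eo eb ex]]] := IH b ltb.
pose e' (i : 'I_n.+1) := if unlift ord0 i is Some j then e j else u.
exists n.+1, e'; split.
- move=> i j; rewrite /e'.
  case: (unliftP ord0 i) => [i' ->|->]; case: (unliftP ord0 j) => [j' ->|->].
  + by rewrite eo (inj_eq lift_inj).
  + by have /hb[_ ->] := eb i'; rewrite eq_sym (negbTE (neq_lift _ _)).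
  + by have /hb[_] := eb j'; rewrite ipC => ->; rewrite (negbTE (neq_lift _ _)).
  + by rewrite uu eqxx.
- by move=> i; rewrite /e'; case: unliftP => // j _; have /hb[] := eb j.
- move=> x xa; rewrite big_ord_recl /e' unlift_none.
  under eq_bigr do rewrite liftK.
  have /ex E : x - ip x u *: u \in b.
    by apply/hb; rewrite rpredB ?rpredZ// ipBl ipZl uu mulr1 subrr.
  rewrite -[LHS](subrK (ip x u *: u)) {1}E addrC; congr (_ + _).
  apply: eq_bigr => i _; congr (_ *: _).
  by rewrite ipBl ipZl; have /hb[_] := eb i; rewrite ipC => ->; rewrite mulr0 subr0.
Qed.

Lemma orth_proj (a : {vspace V}) x :
  exists2 p, p \in a & forall q, q \in a -> ip (x - p) q = 0.
Proof.
have [n [e [eo ea ex]]] := orthonormal_basis a.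
exists (\sum_i ip x (e i) *: e i).
  by apply: rpred_sum => i _; rewrite rpredZ.
move=> q qa; rewrite (ex q qa) ip_sumr big1// => i _.
rewrite ipZr ipBl ip_suml (bigD1 i)//= big1 ?addr0.
  by rewrite ipZl eo eqxx mulr1 subrr mulr0.
by move=> j ji; rewrite ipZl eo (negbTE ji) mulr0.
Qed.

Lemma mem_orthP (a : {vspace V}) x :
  (forall y, (forall q, q \in a -> ip y q = 0) -> ip x y = 0) -> x \in a.
Proof.
move=> h; have [p pa hp] := orth_proj a x.
have : ip (x - p) (x - p) = 0 by rewrite ipBr (hp p pa) subr0 ipC; exact: h.
by move/eqP; rewrite ip_eq0 subr_eq0 => /eqP ->.
Qed.

Lemma functional_bounded (f : V -> R) :
  (forall a x y, f (a *: x + y) = a * f x + f y) ->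
  exists2 M, 0 <= M & forall x, `|f x| <= M * nrm x.
Proof.
move=> fl; have f0 : f 0 = 0.
  have := fl 1 0 0; rewrite scaler0 addr0 mul1r => h; apply: (addrI (f 0)).
  by rewrite addr0 -h.
have [n [e [eo _ ex]]] := orthonormal_basis fullv.
have fD x y : f (x + y) = f x + f y by rewrite -{1}(scale1r x) fl mul1r.
have fZ c x : f (c *: x) = c * f x by rewrite -(addr0 (c *: x)) fl f0 addr0.
exists (\sum_i `|f (e i)|); first by apply: sumr_ge0.
move=> x; rewrite {1}(ex x (memvf x)) (big_morph f fD f0).
apply: le_trans (ler_norm_sum _ _ _) _; rewrite mulr_suml; apply: ler_sum => i _.
rewrite fZ normrM mulrC ler_wpM2l//.
have E : nrm (e i) = 1 by rewrite /nrm eo eqxx sqrtr1.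
by have := cauchy_schwarz_abs x (e i); rewrite E mulr1.
Qed.

(** Testing against one vector at a time reduces everything to scalar limits; in finite dimension
    this is norm convergence. *)
Definition vlim (v : nat -> V) (l : V) : Prop :=
  forall y, ulim (fun k => ip (v k) y) (ip l y).

Lemma vlim_cst l : vlim (fun=> l) l.
Proof. by move=> y; apply: ulim_cst. Qed.

Lemma vlim_ext v w l : v =1 w -> vlim v l -> vlim w l.
Proof. by move=> vw vl y; apply: ulim_ext (vl y) => k; rewrite vw. Qed.

Lemma vlim_unique v l m : vlim v l -> vlim v m -> l = m.
Proof. by move=> vl vm; apply: ip_eq => z; apply: ulim_unique (vl z) (vm z). Qed.

Lemma vlimD v w l m : vlim v l -> vlim w m -> vlim (fun k => v k + w k) (l + m).
Proof.
move=> vl wm y; rewrite ipDl; apply: ulim_ext (ulimD (vl y) (wm y)) => k.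
by rewrite ipDl.
Qed.

Lemma vlimZ a v c l : ulim a c -> vlim v l -> vlim (fun k => a k *: v k) (c *: l).
Proof.
move=> ac vl y; rewrite ipZl; apply: ulim_ext (ulimM ac (vl y)) => k.
by rewrite ipZl.
Qed.

Lemma vlimB v w l m : vlim v l -> vlim w m -> vlim (fun k => v k - w k) (l - m).
Proof.
move=> vl wm y; rewrite ipBl; apply: ulim_ext (ulimB (vl y) (wm y)) => k.
by rewrite ipBl.
Qed.

Lemma vlim_sum I (s : seq I) (P : pred I) (F : I -> nat -> V) (L : I -> V) :
  (forall i, P i -> vlim (F i) (L i)) ->
  vlim (fun k => \sum_(i <- s | P i) F i k) (\sum_(i <- s | P i) L i).
Proof.
move=> h y; rewrite ip_suml.
apply: (@ulim_ext _ (fun k => \sum_(i <- s | P i) ip (F i k) y)).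
  by move=> k; rewrite ip_suml.
by apply: ulim_sum => i Pi; apply: h.
Qed.

Lemma vlim_ip v w l m : vlim v l -> vlim w m -> ulim (fun k => ip (v k) (w k)) (ip l m).
Proof.
move=> vl wm; have [n [e [eo _ ex]]] := orthonormal_basis fullv.
have E x y : ip x y = \sum_i ip x (e i) * ip y (e i).
  rewrite {1}(ex x (memvf x)) ip_suml; apply: eq_bigr => i _.
  by rewrite ipZl [ip (e i) y]ipC.
rewrite E; apply: (@ulim_ext _ (fun k => \sum_i ip (v k) (e i) * ip (w k) (e i))).
  by move=> k; rewrite -E.
by apply: ulim_sum => i _; apply: ulimM.
Qed.

Lemma vlim_nrm v l : vlim v l -> ulim (fun k => nrm (v k)) (nrm l).
Proof. by move=> vl; apply: ulim_sqrt; apply: vlim_ip. Qed.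

Lemma vlim_bounded v M : (forall k, nrm (v k) <= M) -> exists l, vlim v l.
Proof.
move=> vM; have [n [e [eo _ ex]]] := orthonormal_basis fullv.
have h i : exists l, ulim (fun k => ip (v k) (e i)) l.
  apply: (@ulim_bounded _ _ M) => k.
  have E : nrm (e i) = 1 by rewrite /nrm eo eqxx sqrtr1.
  by have := cauchy_schwarz_abs (v k) (e i); rewrite E mulr1 => /le_trans; apply.
have [l hl] := choice h.
exists (\sum_i l i *: e i).
apply: (@vlim_ext (fun k => \sum_i ip (v k) (e i) *: e i)).
  by move=> k; rewrite -ex// memvf.
by apply: vlim_sum => i _; apply: vlimZ => //; apply: vlim_cst.
Qed.

Lemma vlim_mem v l (a : {vspace V}) : vlim v l -> uf [set k | v k \in a] -> l \in a.
Proof.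
move=> vl va; apply: mem_orthP => y hy.
apply: (ulim_unique (vl y)); apply: ulim_eq (ulim_cst 0).
by apply: filterS va => k /= vk; rewrite ipC hy.
Qed.

Lemma vlim_small_near v b : ulim b 0 -> uf [set k | nrm (v k) <= b k] -> vlim v 0.
Proof.
move=> b0 vb y; rewrite ip0l; apply: (@ulim_norm0 _ _ (fun k => b k * nrm y)).
  apply: filterS vb => k /= vk; apply: le_trans (cauchy_schwarz_abs _ _) _.
  by rewrite ler_wpM2r ?nrm_ge0.
by rewrite -(mul0r (nrm y)); apply: ulimM => //; apply: ulim_cst.
Qed.

Lemma vlim_small v b : ulim b 0 -> (forall k, nrm (v k) <= b k) -> vlim v 0.
Proof. by move=> b0 vb; apply: vlim_small_near b0 _; apply: nearW. Qed.

End Euclid.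
Arguments vlim_cst {R V} ip l.

(** * Compact groups of isometries *)

Definition isometry_group (R : realType) (V : vectType R) (ip : V -> V -> R)
    (G : set 'End(V)) : Prop :=
  [/\ inner ip, linear_group G, compact_endos G & orthogonal_endos ip G].

Section CompactGroup.
Variables (R : realType) (V : vectType R) (ip : V -> V -> R) (G : set 'End(V)).
Hypothesis H : isometry_group ip G.

Lemma iso_inner : inner ip. Proof. by case: H. Qed.
Lemma iso_linear : linear_group G. Proof. by case: H. Qed.
Lemma iso_compact : compact_endos G. Proof. by case: H. Qed.
Lemma iso_orth : orthogonal_endos ip G. Proof. by case: H. Qed.

Local Notation hip := iso_inner.
Local Notation hG := iso_linear.
Local Notation hc := iso_compact.
Local Notation hO := iso_orth.
#[local] Hint Resolve iso_inner iso_linear iso_compact iso_orth : core.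

Lemma iso_id : G \1%VF. Proof. by case: hG. Qed.

Lemma iso_comp f g : G f -> G g -> G (f \o g)%VF.
Proof. by case: hG => _ + _; apply. Qed.

Lemma iso_inv f : G f -> G (f^-1)%VF.
Proof. by case: hG => _ _ h /h[]. Qed.

Lemma iso_invK f x : G f -> (f^-1)%VF (f x) = x.
Proof. by case: hG => _ _ h /h[/eqP k _]; rewrite -comp_lfunE lker0_compVf ?k// id_lfunE. Qed.

Lemma iso_Kinv f x : G f -> f ((f^-1)%VF x) = x.
Proof. by case: hG => _ _ h /h[/eqP k _]; rewrite -comp_lfunE lker0_compfV ?k// id_lfunE. Qed.

Lemma iso_ip f x y : G f -> ip (f x) (f y) = ip x y.
Proof. by move=> Gf; apply: hO. Qed.

Lemma iso_adj f x y : G f -> ip (f x) y = ip x ((f^-1)%VF y).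
Proof. by move=> Gf; rewrite -[in LHS](iso_Kinv y Gf) iso_ip. Qed.

Lemma iso_nrm f x : G f -> nrm ip (f x) = nrm ip x.
Proof. by move=> Gf; rewrite /nrm iso_ip. Qed.

Definition glim (g_ : nat -> 'End(V)) (g : 'End(V)) : Prop :=
  forall x, vlim ip (fun k => g_ k x) (g x).

Lemma iso_ulim (g_ : nat -> 'End(V)) : (forall k, G (g_ k)) ->
  exists2 g, G g & glim g_ g.
Proof.
move=> Gg; move: hc; rewrite /compact_endos compact_ultra.
set mx := passmx.mxof _ _.
move=> /(_ ((fun k => mx (g_ k)) @ uf) (fmap_ultra _ uf_ultra))[].
  by apply: nearW => k; exists (g_ k).
move=> _ [[g Gg' <-] cv]; exists g => // x y.
pose e := vbasis (fullv : {vspace V}).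
have E (h : 'End(V)) : ip (h x) y = \sum_j (\sum_i passmx.rVof e x 0 i * mx h i j) * ip e`_j y.
  have fe : basis_of fullv e by exact: vbasisP.
  rewrite -{1}(passmx.rVofK fe (h x)) /passmx.vecof (ip_suml hip).
  apply: eq_bigr => j _; rewrite (ipZl hip); congr (_ * _).
  have -> : passmx.rVof e (h x) = passmx.rVof e x *m mx h.
    by rewrite passmx.mul_mxof passmx.rVofK.
  by rewrite mxE.
rewrite E; apply: (@ulim_ext _ (fun k => \sum_j (\sum_i passmx.rVof e x 0 i * mx (g_ k) i j) * ip e`_j y)).
  by move=> k; rewrite E.
apply: ulim_sum => j _; apply: ulimM; last exact: ulim_cst.
apply: ulim_sum => i _; apply: ulimM; first exact: ulim_cst.
have := @continuous_cvg _ _ _ _ _ _ _ _ (@coord_continuous R _ _ i j (mx g)) cv.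
exact.
Qed.

Lemma glim_app g_ g v l : (forall k, G (g_ k)) -> G g -> glim g_ g ->
  vlim ip v l -> vlim ip (fun k => g_ k (v k)) (g l).
Proof.
move=> Gg_ Gg gl vl y; rewrite iso_adj//.
apply: (@ulim_ext _ (fun k => ip (v k) ((g_ k)^-1%VF y))).
  by move=> k; rewrite iso_adj.
apply: vlim_ip => // z; rewrite (ipC hip) -iso_adj//.
apply: ulim_ext (gl z y) => k.
by rewrite [RHS](ipC hip) iso_adj.
Qed.

Lemma glimV g_ g : (forall k, G (g_ k)) -> G g -> glim g_ g ->
  glim (fun k => (g_ k)^-1%VF) (g^-1)%VF.
Proof.
move=> Gg_ Gg gl y z; rewrite (ipC hip) -iso_adj//.
apply: ulim_ext (gl z y) => k.
by rewrite [RHS](ipC hip) iso_adj.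
Qed.

Lemma iso_max (P : 'End(V) -> Prop) (f : 'End(V) -> R) :
  (exists2 g, G g & P g) ->
  (forall g_ g, (forall k, G (g_ k)) -> (forall k, P (g_ k)) -> G g -> glim g_ g ->
     P g /\ ulim (fun k => f (g_ k)) (f g)) ->
  exists g, [/\ G g, P g & forall h, G h -> P h -> f h <= f g].
Proof.
move=> [g0 Gg0 Pg0] h.
have [||g [[Gg Pg] gmax]] := @ulim_attain R _ (fun g => G g /\ P g) f; first by exists g0.
  move=> g_ Gg_; have [g Gg gl] := iso_ulim (fun k => (Gg_ k).1).
  have [Pg fg] := h _ _ (fun k => (Gg_ k).1) (fun k => (Gg_ k).2) Gg gl.
  by exists g.
by exists g; split => // k Gk Pk; apply: gmax.
Qed.

(* [ip x y] is the value at [y] of the support function of the hull of the orbit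
   of [x]. *)
Definition aligned x y := forall g, G g -> ip (g x) y <= ip x y.

Lemma orbit_max u x : exists2 g, G g & aligned (g u) x.
Proof.
have [||g [Gg _ gmax]] := @iso_max (fun=> True) (fun g => ip (g u) x).
- by exists \1%VF => //; exact: iso_id.
- by move=> g_ g _ _ Gg gl; split => //; apply: gl.
exists g => // h Gh; rewrite -comp_lfunE; apply: gmax => //; exact: iso_comp.
Qed.

Lemma alignedC x y : aligned x y -> aligned y x.
Proof.
move=> xy g Gg; rewrite iso_adj// (ipC hip) (ipC hip y); apply: xy; exact: iso_inv.
Qed.

Lemma aligned_refl x : aligned x x.
Proof. by move=> g Gg; apply: le_trans (cauchy_schwarz hip _ _) _; rewrite iso_nrm// -expr2 nrm_sq. Qed.

Lemma alignedDr x y z : aligned x y -> aligned x z -> aligned x (y + z).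
Proof. by move=> xy xz g Gg; rewrite !(ipDr hip) lerD// ?xy ?xz. Qed.

Lemma alignedZr x y c : 0 <= c -> aligned x y -> aligned x (c *: y).
Proof. by move=> c0 xy g Gg; rewrite !(ipZr hip) ler_wpM2l// xy. Qed.

Lemma aligned0r x : aligned x 0.
Proof. by move=> g Gg; rewrite !(ip0r hip). Qed.

Lemma aligned_lim x_ y_ x y : vlim ip x_ x -> vlim ip y_ y ->
  (forall k, aligned (x_ k) (y_ k)) -> aligned x y.
Proof.
move=> xl yl xy g Gg; apply: (ulim_lew _ (vlim_ip hip xl yl)) => [|k]; last exact: xy Gg.
apply: vlim_ip => //; apply: (glim_app (g_ := fun=> g)) => // z; exact: vlim_cst.
Qed.

(** Alignment tested on the inverse of [g] gives <g x, x> >= |x|^2, the equality case of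
    Cauchy-Schwarz. *)
Lemma aligned_orbit g x : G g -> aligned (g x) x -> g x = x.
Proof.
move=> Gg gx; have := gx _ (iso_inv Gg); rewrite iso_invK// => h.
apply: (cauchy_schwarz_eq hip); first by rewrite iso_ip.
by apply/le_anti; rewrite iso_ip// h andbT aligned_refl.
Qed.

End CompactGroup.

(** * Convex hulls and support functions of orbits *)

Section Hull.
Variables (R : realType) (V : vectType R).
Implicit Types (X : set V).

Lemma convex_setP (A : set V) : @convex_set R V A <->
  forall x y (t : R), 0 <= t -> t <= 1 -> A x -> A y -> A (t *: x + (1 - t) *: y).
Proof.
split=> [cA x y t t0 t1 Ax Ay|h x y l /set_mem Ax /set_mem Ay].
  have := cA x y (Itv01 t0 t1) (mem_set Ax) (mem_set Ay).
  by move/set_mem.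
apply: mem_set; apply: h => //.
Qed.

Lemma sub_hull X : X `<=` convex_hull X.
Proof. exact: sub_smallest. Qed.

Lemma hull_convex X x y (t : R) : 0 <= t -> t <= 1 ->
  convex_hull X x -> convex_hull X y -> convex_hull X (t *: x + (1 - t) *: y).
Proof.
move=> t0 t1 hx hy A [cA XA]; have /convex_setP := cA; apply => //.
  exact: hx.
exact: hy.
Qed.

Lemma hull_min X (A : set V) : @convex_set R V A -> X `<=` A -> convex_hull X `<=` A.
Proof. by move=> cA XA x; apply. Qed.

Lemma hull_le (ip : V -> V -> R) X x c : inner ip ->
  (forall p, X p -> ip p x <= c) -> forall p, convex_hull X p -> ip p x <= c.
Proof.
move=> hip Xc; apply: (@hull_min X [set p | ip p x <= c]) => //.
apply/convex_setP => u v t t0 t1 /= uc vc; rewrite !(ipE hip); nra.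
Qed.

End Hull.

Section Support.
Variables (R : realType) (V : vectType R) (ip : V -> V -> R) (G : set 'End(V)).
Hypothesis H : isometry_group ip G.
Let hip := iso_inner H.
Local Notation aligned := (aligned ip G).

Definition supp u x := ip (sval (cid2 (orbit_max H u x)) u) x.

Lemma suppP u x : exists g, [/\ G g, aligned (g u) x & supp u x = ip (g u) x].
Proof. by rewrite /supp; case: cid2 => g /= Gg al; exists g. Qed.

Lemma supp_ge g u x : G g -> ip (g u) x <= supp u x.
Proof.
move=> Gg; have [h [Gh al ->]] := suppP u x.
have := al _ (iso_comp H Gg (iso_inv H Gh)).
by rewrite comp_lfunE (iso_invK H).
Qed.

Lemma supp_eq u x c : (forall g, G g -> ip (g u) x <= c) ->
  (exists2 g, G g & ip (g u) x = c) -> supp u x = c.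
Proof.
move=> le [g Gg E]; apply/le_anti; rewrite -{2}E supp_ge// andbT.
by have [h [Gh _ ->]] := suppP u x; apply: le.
Qed.

Lemma supp_alignedP u x : aligned u x <-> supp u x = ip u x.
Proof.
split => [al|E g Gg]; last by rewrite -E supp_ge.
by apply: supp_eq => //; exists \1%VF; [exact: (iso_id H)|rewrite id_lfunE].
Qed.

Lemma supp_aligned u x : aligned u x -> supp u x = ip u x.
Proof. by move/supp_alignedP. Qed.

Lemma suppGl g u x : G g -> supp (g u) x = supp u x.
Proof.
move=> Gg; apply: supp_eq => [h Gh|].
  by rewrite -comp_lfunE supp_ge//; apply: (iso_comp H).
have [h [Gh _ ->]] := suppP u x; exists (h \o g^-1)%VF.
  by apply: (iso_comp H) => //; apply: (iso_inv H).
by rewrite comp_lfunE (iso_invK H).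
Qed.

Lemma suppGr g u x : G g -> supp u (g x) = supp u x.
Proof.
move=> Gg; apply: supp_eq => [h Gh|].
  rewrite (ipC hip) (iso_adj H)// (ipC hip) -comp_lfunE supp_ge//.
  by apply: (iso_comp H) => //; apply: (iso_inv H).
have [h [Gh _ ->]] := suppP u x; exists (g \o h)%VF; first exact: (iso_comp H).
by rewrite comp_lfunE (iso_ip H).
Qed.

End Support.

(** * Property (SP) and its chamber *)

Section Semigroup.
Variables (R : realType) (V : vectType R) (ip : V -> V -> R) (G : set 'End(V)).
Hypothesis H : isometry_group ip G.
Hypothesis hSP : property_SP G.
Let hip := iso_inner H.
Local Notation aligned := (aligned ip G).
Local Notation supp := (supp H).

Lemma SP_supp u v : exists w, forall x, supp u x + supp v x = supp w x.
Proof.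
have [w hw] := hSP u v; exists w => x; apply/le_anti/andP; split.
  have [g [Gg _ ->]] := suppP H u x.
  have [h [Gh _ ->]] := suppP H v x.
  rewrite -(ipDl hip).
  apply: (@hull_le _ _ ip (orbit G w)) => //.
    by move=> _ [k Gk <-]; apply: supp_ge.
  rewrite -hw; exists (g u); first by apply: sub_hull; exists g.
  by exists (h v) => //; apply: sub_hull; exists h.
have [g [Gg _ ->]] := suppP H w x.
have : convex_hull (orbit G w) (g w) by apply: sub_hull; exists g.
rewrite -hw => -[p hp [q hq <-]]; rewrite (ipDl hip) lerD//.
  by apply: (hull_le hip _ hp) => _ [k Gk <-]; apply: supp_ge.
by apply: (hull_le hip _ hq) => _ [k Gk <-]; apply: supp_ge.
Qed.

Lemma aligned_supp x y p : aligned x y -> supp (x + y) p = supp x p + supp y p.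
Proof.
move=> xy; have [w hw] := SP_supp x y; rewrite hw.
set s := x + y.
have xs : aligned x s by apply: alignedDr => //; exact: aligned_refl.
have ys : aligned y s.
  by apply: alignedDr => //; [exact: alignedC|exact: aligned_refl].
have ws : supp w s = ip s s by rewrite -hw !supp_aligned// -(ipDl hip).
have [g [Gg _ E]] := suppP H w s.
(* The support function of [w] takes the value |s|^2 at [s], so |s|^2 <= |w| |s|. *)
have s_le_w : nrm ip s <= nrm ip w.
  have [s0|s0] := ltP 0 (nrm ip s); last by apply: le_trans s0 (nrm_ge0 _ _).
  rewrite -(ler_pM2r s0) -expr2 nrm_sq// -ws E -(iso_nrm H w Gg); exact: cauchy_schwarz.
(* |w|^2 = h_w(w) has the form <h x + k y, w>, and alignment of [x] with [y] gives |h x + k y| <=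
   |s|. *)
have w_le_s : nrm ip w <= nrm ip s.
  have [w0|w0] := ltP 0 (nrm ip w); last by apply: le_trans w0 (nrm_ge0 _ _).
  rewrite -(ler_pM2r w0) -expr2 nrm_sq//.
  rewrite -(supp_aligned H (aligned_refl H w)) -hw.
  have [h [Gh _ ->]] := suppP H x w.
  have [k [Gk _ ->]] := suppP H y w.
  rewrite -(ipDl hip); apply: le_trans (cauchy_schwarz hip _ _) _.
  rewrite ler_wpM2r ?nrm_ge0//; apply: nrm_le; rewrite ?nrm_ge0// nrm_sq//.
  rewrite !(ipDl hip) !(ipDr hip) !(iso_ip H)//.
  have := xy _ (iso_comp H (iso_inv H Gk) Gh); rewrite comp_lfunE -[_ (h x)]/(_ (h x)).
  have -> : ip ((k^-1)%VF (h x)) y = ip (h x) (k y).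
    by rewrite (ipC hip) [RHS](ipC hip) (iso_adj H).
  rewrite (ipC hip (k y)) (ipC hip y x); lra.
have nws : nrm ip w = nrm ip s by apply/le_anti; rewrite w_le_s s_le_w.
have gws : g w = s.
  apply: (cauchy_schwarz_eq hip); last by rewrite -E ws -!nrm_sq// (iso_nrm H) ?nws.
  by rewrite -!nrm_sq// (iso_nrm H) ?nws.
by rewrite -gws suppGl.
Qed.

(** The inequalities <x, z> <= h_x(z) and <y, z> <= h_y(z) add up to an equality by [aligned_supp],
    so each is one. *)
Lemma aligned_split x y z : aligned x y -> aligned z (x + y) ->
  aligned z x /\ aligned z y.
Proof.
move=> xy /alignedC zs; have := supp_aligned H (zs H).
rewrite aligned_supp// (ipDl hip) => E.
have hx : ip x z <= supp x z by have := supp_ge H x z (iso_id H); rewrite id_lfunE.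
have hy : ip y z <= supp y z by have := supp_ge H y z (iso_id H); rewrite id_lfunE.
by split; apply: alignedC => //; apply/(supp_alignedP H); lra.
Qed.

Lemma alignedZP x y c : 0 < c -> aligned x (c *: y) -> aligned x y.
Proof.
move=> c0 h; have c'0 : 0 <= c^-1 by rewrite invr_ge0 ltW.
by have := alignedZr H c'0 h; rewrite scalerA mulVf ?gt_eqF// scale1r.
Qed.

Lemma aligned_sum y (xs : seq V) : (forall x, x \in xs -> aligned y x) ->
  aligned y (\sum_(x <- xs) x).
Proof.
elim: xs => [|x xs IH] h; first by rewrite big_nil; exact: aligned0r.
rewrite big_cons; apply: alignedDr => //; first by apply: h; rewrite mem_head.
by apply: IH => t txs; apply: h; rewrite inE txs orbT.
Qed.

Lemma aligned_sumP y (xs : seq V) :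
  (forall x x', x \in xs -> x' \in xs -> aligned x x') ->
  aligned y (\sum_(x <- xs) x) -> forall x, x \in xs -> aligned y x.
Proof.
elim: xs => [|x xs IH] hxs //; rewrite big_cons => h t.
have xr : aligned x (\sum_(x <- xs) x).
  by apply: aligned_sum => s sxs; apply: hxs; rewrite inE ?eqxx ?sxs ?orbT.
have [yx yr] := aligned_split xr h.
rewrite inE => /orP[/eqP->//|]; apply: IH => // s s' sx s'x.
by apply: hxs; rewrite inE ?sx ?s'x orbT.
Qed.

(* [z] is the sum of a free family of pairwise aligned vectors of maximal size; a
   vector aligned with [z] could be added to the family, hence lies in its span. *)
Lemma SP_chamber : exists (a : {vspace V}) z d, [/\ 0 < d,
  forall y, aligned z y -> y \in a,
  forall x y, aligned z x -> aligned z y -> aligned x y &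
  forall y, y \in a -> nrm ip y <= d -> aligned z (z + y)].
Proof.
pose P (xs : seq V) := free xs /\ (forall x x', x \in xs -> x' \in xs -> aligned x x').
pose Q n := `[< exists2 xs, size xs = n & P xs >].
have Q0 : exists n, Q n by exists 0%N; apply/asboolP; exists [::] => //; split => //; exact: nil_free.
have Qb n : Q n -> (n <= \dim {: V})%N.
  move/asboolP => [xs <- [/eqP <- _]]; apply: dimvS; exact: subvf.
case: (ex_maxnP Q0 Qb) => n /asboolP[xs sz [fxs hxs]] nmax.
pose z := \sum_(x <- xs) x.
have zx y : aligned z y -> forall x, x \in xs -> aligned x y.
  by move=> /(alignedC H) zy x xx; apply: alignedC => //; apply: aligned_sumP zy _ xx.
have za y : aligned z y -> y \in <<xs>>%VS.
  move=> zy; apply: contrapT => /negP yxs.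
  have : Q (n.+1).
    apply/asboolP; exists (y :: xs); first by rewrite /= sz.
    split; first by rewrite free_cons yxs.
    move=> s t; rewrite !inE => /predU1P[->|sx] /predU1P[->|tx].
    - exact: aligned_refl.
    - by apply: alignedC => //; exact: zx.
    - exact: zx.
    - exact: hxs.
  by move/nmax; rewrite ltnn.
pose X := in_tuple xs.
have hM i : exists M, 0 <= M /\ forall x, `|coord X i x| <= M * nrm ip x.
  have [|M M0 h] := @functional_bounded _ _ _ hip (coord X i); last by exists M.
  by move=> c x y; rewrite linearP.
have [M hM'] := choice hM.
(* With this [d], |y| <= d forces each coordinate of [y] in the family to be at least -1, so z + y
   has nonnegative coordinates. *)
pose d := (1 + \sum_i M i)^-1.
have S0 : 0 <= \sum_i M i by apply: sumr_ge0 => i _; have [] := hM' i.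
have d0 : 0 < d by rewrite invr_gt0; lra.
have Kz y : y \in <<xs>>%VS -> nrm ip y <= d ->
    forall t, (forall x, x \in xs -> aligned t x) -> aligned t (z + y).
  move=> ya yd t ht.
  have -> : z + y = \sum_i (1 + coord X i y) *: X`_i.
    under eq_bigr do rewrite scalerDl scale1r.
    rewrite big_split/= -(coord_span (X := X))//; congr (_ + _).
    by rewrite /z (big_nth 0) big_mkord.
  apply: (big_ind (fun s => aligned t s)); first exact: aligned0r.
    by move=> ? ?; exact: alignedDr.
  move=> i _; apply: alignedZr => //; last by apply: ht; apply: mem_nth.
  have [Mi0 Mi] := hM' i; have := Mi y; rewrite ler_norml => /andP[h _].
  have : M i * nrm ip y <= 1.
    apply: le_trans (_ : (1 + \sum_i M i) * d <= 1).
      apply: ler_pM => //; first exact: nrm_ge0.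
      rewrite (bigD1 i)//=; have : 0 <= \sum_(j | j != i) M j by apply: sumr_ge0 => j _; have [] := hM' j.
      lra.
    by rewrite mulfV// gt_eqF//; lra.
  lra.
have zxs x : x \in xs -> aligned z x.
  by move=> xx; apply: alignedC => //; apply: aligned_sum => t tx; exact: hxs.
exists <<xs>>%VS, z, d; split => //; last by move=> y ya yd; apply: Kz.
move=> x y zx' zy; have xa := za _ zx'.
(* For this [e] the vectors e x and z - e x are aligned with sum [z], so [aligned_split] passes the
   alignment of [y] with [z] on to e x. *)
pose e := d / (1 + nrm ip x).
have n1 : 0 < 1 + nrm ip x by have := nrm_ge0 ip x; lra.
have e0 : 0 < e by rewrite divr_gt0.
have xk : aligned x (z + - (e *: x)).
  apply: Kz.
  - by rewrite rpredN rpredZ.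
  - rewrite nrmN// nrmZ// gtr0_norm// /e -mulrA ger_pMr// mulrC ler_pdivrMr//; lra.
  - by move=> t tx; apply: alignedC => //; exact: zx.
have ek : aligned (e *: x) (z - e *: x).
  by apply: alignedC => //; apply: alignedZr => //; [exact: ltW|exact: alignedC].
have /(aligned_split ek)[h _] : aligned y (e *: x + (z - e *: x)).
  by rewrite addrC subrK; apply: alignedC.
by apply: alignedC => //; apply: alignedZP h.
Qed.

End Semigroup.

(** * Nearest points of closed convex sets *)

Section Nearest.
Variables (R : realType) (V : vectType R) (ip : V -> V -> R).
Hypothesis hip : inner ip.

Lemma segment_min_ip p w :
  (forall t, 0 <= t -> t <= 1 -> ip p p <= ip (p + t *: w) (p + t *: w)) ->
  0 <= ip p w.
Proof.
move=> h; rewrite leNgt; apply/negP => pos.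
pose c := - ip p w; pose n := ip w w.
have c0 : 0 < c by rewrite oppr_gt0.
have n0 : 0 <= n by exact: ip_ge0.
have cn : 0 < c + n by lra.
(* The increment -2 t c + t^2 n is negative for t n < 2 c; adding [c] to the denominator also keeps
   it positive and t <= 1. *)
pose t := c / (c + n).
have t0 : 0 < t by rewrite divr_gt0.
have t1 : t <= 1 by rewrite ler_pdivrMr// mul1r; lra.
have := h t (ltW t0) t1.
rewrite (ipDl hip) !(ipDr hip) (ipC hip _ p) !(ipZr hip) (ipZl hip) -/n => {}h.
have : t * (2 * c) <= t * (t * n) by rewrite /c; lra.
rewrite ler_pM2l// => h2.
have : 2 * c * (c + n) <= c * n.
  have -> : c * n = t * n * (c + n) by rewrite /t; field; rewrite gt_eqF.
  by rewrite ler_pM2r.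
nra.
Qed.

Lemma nearest_point (K : V -> Prop) y : (exists x, K x) ->
  (forall v l, (forall k, K (v k)) -> vlim ip v l -> K l) ->
  (forall u v t, 0 <= t -> t <= 1 -> K u -> K v -> K (t *: u + (1 - t) *: v)) ->
  exists q, K q /\ forall x, K x -> ip (y - q) (x - q) <= 0.
Proof.
move=> [x0 Kx0] Kcl Kcv.
pose S x := K x /\ nrm ip (x - y) <= nrm ip (x0 - y).
have [||q [[Kq _] qmax]] := @ulim_attain R _ S (fun x => - nrm ip (x - y)).
- by exists x0.
- move=> s_ hs; have [|l sl] := @vlim_bounded _ _ _ hip s_ (nrm ip (x0 - y) + nrm ip y).
    move=> k; rewrite -[s_ k](subrK y); apply: le_trans (nrmD hip _ _) _.
    by rewrite lerD2r; have [] := hs k.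
  have sly : ulim (fun k => nrm ip (s_ k - y)) (nrm ip (l - y)).
    by apply: vlim_nrm => //; apply: vlimB => //; apply: vlim_cst.
  exists l; split; last exact: ulimN.
  split; first by apply: Kcl sl => k; have [] := hs k.
  apply: (ulim_lew sly (ulim_cst _)) => k; have [] := hs k => //.
have {}qmax x : K x -> ip (q - y) (q - y) <= ip (x - y) (x - y).
  move=> Kx; rewrite -!nrm_sq// ler_pXn2r ?nnegrE ?nrm_ge0//.
  have [xS|xS] := leP (nrm ip (x - y)) (nrm ip (x0 - y)).
    by have := qmax x (conj Kx xS); rewrite lerN2.
  apply: le_trans (ltW xS); have := qmax x0 (conj Kx0 (lexx _)).
  by rewrite lerN2.
exists q; split => // x Kx; rewrite -opprB (ipNl hip) oppr_le0.
apply: segment_min_ip => t t0 t1.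
have := qmax _ (Kcv x q t t0 t1 Kx Kq).
have -> // : t *: x + (1 - t) *: q - y = (q - y) + t *: (x - q).
by rewrite scalerBl scale1r scalerBr addrCA addrAC.
Qed.

End Nearest.

(** These four properties are what the construction of the Cartan subspace retains from (SP). *)
Definition chamber (R : realType) (V : vectType R) (ip : V -> V -> R)
    (G : set 'End(V)) (a : {vspace V}) (z : V) (d : R) : Prop :=
  [/\ 0 < d,
      forall y, aligned ip G z y -> y \in a,
      forall x y, aligned ip G z x -> aligned ip G z y -> aligned ip G x y
    & forall y, y \in a -> nrm ip y <= d -> aligned ip G z (z + y)].

Section Chamber.
Variables (R : realType) (V : vectType R) (ip : V -> V -> R) (G : set 'End(V)).
Hypothesis H : isometry_group ip G.
Let hip := iso_inner H.
Local Notation aligned := (aligned ip G).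
Variables (a : {vspace V}) (z : V) (d : R).
Hypothesis Ch : chamber ip G a z d.

Let d0 : 0 < d. Proof. by case: Ch. Qed.

Lemma chamber_sub y : aligned z y -> y \in a. Proof. by case: Ch => _ + _ _; apply. Qed.

Lemma chamber_aligned x y : aligned z x -> aligned z y -> aligned x y.
Proof. by case: Ch => _ _ + _; apply. Qed.

Lemma chamber_interior y : y \in a -> nrm ip y <= d -> aligned z (z + y).
Proof. by case: Ch => _ _ _; apply. Qed.

Local Notation C := (aligned z).

Lemma chamber_center : C z. Proof. exact: aligned_refl. Qed.

Lemma chamber_center_mem : z \in a. Proof. by apply: chamber_sub; apply: chamber_center. Qed.

Lemma orbit_meets_chamber v : exists2 g, G g & C (g v).
Proof. by have [g Gg /(alignedC H) h] := orbit_max H v z; exists g. Qed.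

Lemma chamber_orbit_unique g x : G g -> C x -> C (g x) -> g x = x.
Proof. by move=> Gg Cx Cgx; apply: (aligned_orbit H) => //; apply: chamber_aligned. Qed.

Lemma chamber_lim v l : (forall k, C (v k)) -> vlim ip v l -> C l.
Proof. by move=> Cv vl; apply: (aligned_lim H _ vl Cv); apply: vlim_cst. Qed.

Lemma chamber_absorbs x : x \in a -> exists2 c, 0 < c & C (z + c *: x).
Proof.
move=> xa; have n1 : 0 < 1 + nrm ip x by have := nrm_ge0 ip x; lra.
exists (d / (1 + nrm ip x)); first by rewrite divr_gt0.
apply: chamber_interior; first by rewrite rpredZ.
rewrite nrmZ// gtr0_norm ?divr_gt0// -mulrA ger_pMr// mulrC ler_pdivrMr//; lra.
Qed.

(** The chamber has interior in [a]: each vector of [a] is, up to a positive factor, the difference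
    of a chamber point and [z]. *)
Lemma chamber_spans (f : V -> R) : (forall c x y, f (c *: x + y) = c * f x + f y) ->
  (forall x, C x -> f x = 0) -> forall x, x \in a -> f x = 0.
Proof.
move=> fl fC x xa; have [c c0 h] := chamber_absorbs xa.
have := fC _ h; rewrite addrC fl (fC z chamber_center) addr0 => /eqP.
by rewrite mulf_eq0 gt_eqF//= => /eqP.
Qed.

Definition dual_cone r := r \in a /\ forall x, C x -> 0 <= ip x r.

Lemma dual_cone_lim v l : (forall k, dual_cone (v k)) -> vlim ip v l -> dual_cone l.
Proof.
move=> dv vl; split; first by apply: (vlim_mem hip vl); apply: nearW => k; have [] := dv k.
move=> x Cx; apply: (ulim_ge0 (vlim_ip hip (vlim_cst ip x) vl)) => k.
by have [_] := dv k; apply.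
Qed.

Lemma dual_cone_scale r c : 0 <= c -> dual_cone r -> dual_cone (c *: r).
Proof.
move=> c0 [ra dr]; split => [|x Cx]; first by rewrite rpredZ.
by rewrite (ipZr hip) mulr_ge0// dr.
Qed.

(** The chamber contains the ball of radius [d] about [z] in [a], in particular its lowest point z -
    d r / |r| in the direction of [r]. *)
Lemma dual_cone_center r : dual_cone r -> d * nrm ip r <= ip z r.
Proof.
move=> [ra dr]; have [->|r0] := eqVneq r 0; first by rewrite nrm0// mulr0 (ip0r hip).
have n0 : 0 < nrm ip r by rewrite nrm_gt0.
have /dr : C (z + (- (d / nrm ip r)) *: r).
  apply: chamber_interior; first by rewrite rpredZ.
  by rewrite nrmZ// normrN gtr0_norm ?divr_gt0// divfK ?gt_eqF.
rewrite (ipDl hip) (ipZl hip) -nrm_sq// mulNr expr2 mulrA divfK ?gt_eqF//; lra.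
Qed.

Lemma chamber_separation y : y \in a -> ~ C y -> exists2 r, dual_cone r & ip y r < 0.
Proof.
move=> ya nCy; have [|||q [Cq hq]] := @nearest_point _ _ ip hip C y.
- by exists z; exact: chamber_center.
- exact: chamber_lim.
- move=> u v t t0 t1 Cu Cv; apply: alignedDr => //; apply: alignedZr => //; lra.
(* The cone contains 0 and 2 q; testing the nearest point against both gives the two
   inequalities. *)
have qq : ip q (q - y) = 0.
  have h2 := hq _ (alignedZr H (ler0n _ 2) Cq); have h0 := hq _ (aligned0r H z).
  move: h0 h2; rewrite sub0r scaler_nat mulr2n addrK (ipNr hip).
  rewrite (ipC hip q) -opprB (ipNl hip); lra.
exists (q - y); last first.
  have : 0 < ip (q - y) (q - y).
    by apply: (ip_gt0 hip); apply: contra_notN nCy; rewrite subr_eq0 => /eqP <-.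
  by rewrite {1}(ipBl hip) qq; lra.
split; first by rewrite rpredB// chamber_sub.
move=> x Cx; have := hq x Cx; rewrite (ipBr hip) -(opprB q y) !(ipNl hip) (ipC hip _ q) qq (ipC hip x); lra.
Qed.

Lemma chamber_bipolar y : y \in a -> (forall r, dual_cone r -> 0 <= ip y r) -> C y.
Proof.
move=> ya h; apply: contrapT => /(chamber_separation ya)[r dr].
by rewrite ltNge h.
Qed.

(* [r] is the unique unit normal of the chamber at [b]: the point [b] of the
   boundary is reached by a ball inside the chamber, namely the largest one of the
   form [B(rho z + y, rho * d / 2)]. *)
Lemma smooth_point y : y \in a -> ~ C y -> exists b r,
  [/\ C b, dual_cone r, ip r r = 1, ip b r = 0 & ip y r < 0 /\
      forall s, dual_cone s -> ip b s = 0 -> s = nrm ip s *: r].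
Proof.
move=> ya nCy; pose e := d / 2; have e0 : 0 < e by rewrite divr_gt0.
have zr r : dual_cone r -> nrm ip r = 1 -> e <= ip z r - e.
  by move=> /dual_cone_center + r1; rewrite r1 /e; lra.
pose S r := dual_cone r /\ nrm ip r = 1.
(* For rho >= 0 the ball of radius rho e about rho z + y lies on the nonnegative side of the unit
   normal [r] exactly when rho >= [f r]. Taking e = d / 2 keeps the denominators at least [e]. *)
pose f r := - ip y r / (ip z r - e).
have [r1 dr1 yr1] := chamber_separation ya nCy.
have normS r : dual_cone r -> 0 < nrm ip r -> S ((nrm ip r)^-1 *: r).
  move=> dr r0; split; first by apply: dual_cone_scale => //; rewrite invr_ge0 ltW.
  by rewrite nrmZ// gtr0_norm ?invr_gt0// mulVf ?gt_eqF.
have r10 : 0 < nrm ip r1.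
  by rewrite nrm_gt0//; apply: contraTneq yr1 => ->; rewrite (ip0r hip) ltxx.
have [||r [[dr r_1] rmax]] := @ulim_attain R _ S f.
- by exists ((nrm ip r1)^-1 *: r1); exact: normS.
- move=> s_ hs; have [|l sl] := @vlim_bounded _ _ _ hip s_ 1; first by move=> k; have [_ ->] := hs k.
  have Sl : S l.
    split; first by apply: dual_cone_lim sl => k; have [] := hs k.
    apply: (ulim_unique (vlim_nrm hip sl)); apply: ulim_ext (ulim_cst 1) => k.
    by have [_ ->] := hs k.
  exists l; split => //; apply: ulimM.
    by apply: ulimN; apply: (vlim_ip hip) => //; apply: vlim_cst.
  apply: ulimV; first by have := zr l Sl.1 Sl.2 => h; rewrite gt_eqF//; lra.
  by apply: ulimB; [apply: (vlim_ip hip) => //; apply: vlim_cst|exact: ulim_cst].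
pose rho := f r.
have den s : S s -> 0 < ip z s - e by move=> [ds s1]; have := zr s ds s1; lra.
have rho0 : 0 < rho.
  have S1 := normS r1 dr1 r10; apply: lt_le_trans (rmax _ S1).
  rewrite divr_gt0 ?den// (ipZr hip) oppr_gt0 pmulr_rlt0 ?invr_gt0//.
have ineq s : dual_cone s -> rho * e * nrm ip s <= ip (rho *: z + y) s.
  move=> ds; have [s0|s0] := ltP 0 (nrm ip s); last first.
    have /eqP : nrm ip s = 0 by apply/le_anti; rewrite s0 nrm_ge0.
    by rewrite nrm_eq0// => /eqP ->; rewrite nrm0// mulr0 (ip0r hip).
  have St := normS s ds s0; set t := _ *: s in St.
  have -> : s = nrm ip s *: t by rewrite /t scalerA mulfV ?gt_eqF// scale1r.
  rewrite nrmZ// St.2 mulr1 gtr0_norm// (ipZr hip) [leLHS]mulrC ler_pM2l//.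
  have := rmax _ St; rewrite -/rho /f ler_pdivrMr ?den// !(ipE hip); lra.
have eqr : ip (rho *: z + y) r = rho * e.
  have Sr : S r by [].
  have : rho * (ip z r - e) = - ip y r by rewrite /rho /f divfK// gt_eqF// den.
  by rewrite !(ipE hip); lra.
have rr : ip r r = 1 by rewrite -nrm_sq// r_1 expr1n.
have br : ip (rho *: z + y - (rho * e) *: r) r = 0.
  by rewrite (ipBl hip) eqr (ipZl hip) rr mulr1 subrr.
have re : 0 < rho * e by rewrite mulr_gt0.
(* The point where the ball touches the hyperplane of [r]: any other normal at this point supports
   the ball there as well, hence is a multiple of [r]. *)
exists (rho *: z + y - (rho * e) *: r), r; split => //.
- apply: chamber_bipolar; first by rewrite rpredB ?rpredD ?rpredZ// ?chamber_center_mem//; case: dr.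
  move=> s ds; rewrite (ipBl hip) (ipZl hip).
  have := ineq s ds; have : rho * e * ip r s <= rho * e * nrm ip s.
    by rewrite ler_pM2l//; have := cauchy_schwarz hip r s; rewrite r_1 mul1r.
  lra.
- split; first by have := den r (conj dr r_1); rewrite -oppr_gt0; move: rho0; rewrite /rho /f pmulr_lgt0 ?invr_gt0 ?den//.
  move=> s ds; rewrite (ipBl hip) (ipZl hip) => h.
  have rs : ip r s = nrm ip s.
    apply/le_anti/andP; split; first by have := cauchy_schwarz hip r s; rewrite r_1 mul1r.
    by rewrite -(ler_pM2l re); have := ineq s ds; lra.
  apply/esym; apply: (cauchy_schwarz_eq hip); rewrite !(ipZl hip) ?(ipZr hip) ?rs ?rr -?(nrm_sq hip); ring.
Qed.

(* The isometry is a limit of elements bringing [b - e r] back to the chamber as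
   [e] tends to 0. The vector [tau] below is a velocity of the orbit of [b]; as
   the inverses give the opposite velocity, it is orthogonal to the chamber. *)
Lemma chamber_reflection b r : C b -> dual_cone r -> ip r r = 1 -> ip b r = 0 ->
  (forall s, dual_cone s -> ip b s = 0 -> s = nrm ip s *: r) ->
  exists2 g, G g & forall x, x \in a -> g x = x - (2 * ip x r) *: r.
Proof.
move=> Cb dr rr br smooth; have [ra hr] := dr.
pose e (k : nat) : R := k.+1%:R^-1; pose p k := b - e k *: r.
have e0 k : 0 < e k by rewrite invr_gt0.
have el : ulim e 0 by exact: ulim_harmonic.
have pl : vlim ip p b.
  rewrite -[X in vlim _ _ X]subr0 -(scale0r r); apply: vlimB => //.
    exact: vlim_cst.
  by apply: vlimZ => //; apply: vlim_cst.
have /choice[g_ hg_] k : exists g, G g /\ C (g (p k)).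
  by have [g Gg Cg] := orbit_meets_chamber (p k); exists g.
have Gg_ k : G (g_ k) by case: (hg_ k).
pose c k := g_ k (p k).
have Cc k : C (c k) by case: (hg_ k).
have [g Gg gl] := iso_ulim H Gg_.
have gb : g b = b.
  by apply: chamber_orbit_unique => //; apply: (chamber_lim (v := c)) => //; apply: (glim_app H).
have gVb : (g^-1)%VF b = b by rewrite -{1}gb (iso_invK H).
have GgV : G (g^-1)%VF by exact: (iso_inv H).
have pc k x : C x -> ip (p k) x <= ip (c k) x.
  move=> Cx; have := chamber_aligned (Cc k) Cx (iso_inv H (Gg_ k)).
  by rewrite /c (iso_invK H).
pose Q k := (e k)^-1 *: (c k - b).
have Qe k : e k *: Q k = c k - b by rewrite /Q scalerA mulfV ?scale1r// gt_eqF.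
(* |c k|^2 = |b|^2 + (e k)^2 and <c k, b> >= <p k, b> = |b|^2 together give |c k - b| <= e k. *)
have Q1 k : nrm ip (Q k) <= 1.
  have cb : nrm ip (c k - b) <= e k.
    apply: nrm_le => //; first exact: ltW.
    have cc : ip (c k) (c k) = ip b b + e k ^+ 2.
      rewrite (iso_ip H)// /p !(ipE hip) (ipC hip r) br rr; ring.
    rewrite (ipBl hip) !(ipBr hip) cc (ipC hip b (c k)).
    have := pc k b Cb; rewrite /p !(ipE hip) (ipC hip r) br; lra.
  rewrite nrmZ// gtr0_norm ?invr_gt0// mulrC ler_pdivrMr// mul1r//.
have [q ql] := vlim_bounded hip Q1.
pose tau_ k := r + (g_ k)^-1%VF (Q k).
have tau_e k : e k *: tau_ k = b - (g_ k)^-1%VF b.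
  rewrite /tau_ scalerDr -linearZ/= Qe linearB/= /c (iso_invK H)// /p.
  by rewrite addrA addrCA subrr addr0.
pose tau := r + (g^-1)%VF q.
have GVg_ k : G ((g_ k)^-1)%VF by apply: (iso_inv H).
have taul : vlim ip tau_ tau.
  apply: vlimD => //; first exact: vlim_cst.
  by apply: (glim_app H) => //; apply: (glimV H).
have tau_ge0 x : C x -> 0 <= ip tau x.
  move=> Cx; apply: (ulim_ge0 (vlim_ip hip taul (vlim_cst ip x))) => k.
  rewrite -(pmulr_rge0 _ (e0 k)) -(ipZl hip) tau_e (ipBl hip) subr_ge0.
  exact: chamber_aligned.
have tau_le0 x : C x -> ip tau x <= 0.
  move=> Cx; have hl : vlim ip (fun k => (g^-1)%VF (g_ k (tau_ k))) ((g^-1)%VF (g tau)).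
    apply: (glim_app (g_ := fun=> (g^-1)%VF) H) => //.
      by move=> y; apply: vlim_cst.
    exact: (glim_app H).
  have := ulim_lew (vlim_ip hip hl (vlim_cst ip x)) (ulim_cst 0).
  rewrite (iso_invK H)//; apply => k.
  rewrite -(pmulr_rle0 _ (e0 k)) -(ipZl hip) -!linearZ/= tau_e !linearB/= (iso_Kinv H)//.
  rewrite gVb (ipBl hip) subr_le0 -comp_lfunE; apply: chamber_aligned => //.
  by apply: (iso_comp H) => //; apply: (iso_inv H).
have tau_r : ip tau r = 0.
  apply: (chamber_spans (f := fun x => ip tau x)) => //.
    by move=> k x y; rewrite (ipDr hip) (ipZr hip).
  by move=> x Cx; apply/le_anti; rewrite tau_le0// tau_ge0.
have qq1 : ip q q <= 1.
  rewrite -nrm_sq// expr_le1 ?nrm_ge0//.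
  by apply: (ulim_lew (vlim_nrm hip ql) (ulim_cst 1)).
(* Since |q| <= 1 and <g^-1 q, r> = -1, this is an equality case of Cauchy-Schwarz. *)
have gVq : (g^-1)%VF q = - r.
  apply/eqP; rewrite -addr_eq0 -(ip_eq0 hip) eq_le (ip_ge0 hip) andbT.
  move: tau_r; rewrite /tau (ipDl hip) rr => E.
  rewrite (ipDl hip) !(ipDr hip) rr (ipC hip r) (iso_ip H)//; lra.
have qgr : q = - g r by rewrite -linearN/= -gVq (iso_Kinv H).
have qa : q \in a.
  by apply: (vlim_mem hip ql); apply: nearW => k; rewrite /= /Q rpredZ// rpredB// chamber_sub.
(* e k (Q k + r) = c k - p k, and passing from [p k] to the chamber point of its orbit can only
   raise products with chamber vectors. *)
have qdual : dual_cone (q + r).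
  split; first by rewrite rpredD.
  move=> x Cx; rewrite (ipC hip).
  have := vlim_ip hip (vlimD hip ql (vlim_cst ip r)) (vlim_cst ip x).
  move/ulim_ge0; apply => k; rewrite -(pmulr_rge0 _ (e0 k)) -(ipZl hip) scalerDr Qe.
  have := pc k x Cx; rewrite /p !(ipE hip); lra.
have bq : ip b (q + r) = 0.
  by rewrite (ipDr hip) br addr0 qgr (ipNr hip) -{1}gb (iso_ip H)// br oppr0.
have qr : 0 <= ip q r.
  have := vlim_ip hip ql (vlim_cst ip r) => /ulim_ge0; apply => k.
  rewrite -(pmulr_rge0 _ (e0 k)) -(ipZl hip) Qe (ipBl hip) br subr0; exact: hr.
(* Smoothness gives q + r = l r; |q| = 1 leaves l = 0 or l = 2, and <q, r> >= 0 excludes l = 0. *)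
have gr : g r = - r.
  have := smooth _ qdual bq; set l := nrm ip _ => E.
  have qE : q = (l - 1) *: r by rewrite scalerBl scale1r -E addrK.
  have qq : ip q q = 1 by rewrite qgr !(ipE hip) opprK (iso_ip H)// rr.
  move: qr; rewrite qE (ipZl hip) rr mulr1 => l1.
  have l2 : l = 2.
    move: qq; rewrite qE !(ipE hip) rr; nra.
  by rewrite -[g r]opprK -qgr qE l2 (_ : 2 - 1 = 1) ?scale1r//; ring.
exists g => //.
have gC x : C x -> g x = x - (2 * ip x r) *: r.
  (* The projection [u] of x - g x is a normal at [b], so x - u is the reflection of [x]. It is the
     projection of g x to [a] and has the same norm as g x, hence equals it. *)
  move=> Cx; have [u ua hu] := orth_proj hip a (x - g x).
  have gxr : ip (g x) r = - ip x r.
    by rewrite -[r in LHS]opprK -gr (ipNr hip) (iso_ip H).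
  have du : dual_cone u.
    split=> // y Cy; have := hu y (chamber_sub Cy); rewrite !(ipBl hip) (ipC hip u).
    have := chamber_aligned Cx Cy Gg; lra.
  have bu : ip b u = 0.
    have := hu b (chamber_sub Cb); rewrite !(ipBl hip) (ipC hip u) -[X in ip (g x) X]gb (iso_ip H)//; lra.
  have uE := smooth _ du bu.
  have n2 : nrm ip u = 2 * ip x r.
    by have := hu r ra; rewrite [X in ip (_ - X)]uE !(ipE hip) gxr rr; lra.
  rewrite n2 in uE; rewrite -uE.
  apply/eqP; rewrite -subr_eq0 -(ip_eq0 hip).
  have ux : ip u u = 2 * ip x u by rewrite uE !(ipE hip) rr; ring.
  have hu' := hu u ua; rewrite !(ipBl hip) in hu'.
  rewrite !(ipE hip) (iso_ip H)//.
  have := hu x (chamber_sub Cx); rewrite !(ipBl hip); move: hu' ux.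
  rewrite (ipC hip u x) (ipC hip x (g x)) (ipC hip u (g x)) => h1 h2 h3; apply/eqP; lra.
move=> x xa; apply: (ip_eq hip) => w.
apply/eqP; rewrite -subr_eq0 -(ipBl hip); apply/eqP.
apply: (chamber_spans (f := fun x => ip (g x - (x - 2 * ip x r *: r)) w)) => //; last first.
  by move=> t Ct; rewrite gC// subrr (ip0l hip).
move=> k s t; rewrite linearP/= !(ipE hip); ring.
Qed.

End Chamber.

(** * Velocities of curves at maxima of linear functions *)

Section Tangent.
Variables (R : realType) (V : vectType R) (ip : V -> V -> R).
Hypothesis hip : inner ip.
Local Notation rV := (passmx.rVof (vbasis (fullv : {vspace V}))).

Lemma curve_cvg (c : R -> V) w y : derivable (rV \o c) 0 1 -> 'D_1 (rV \o c) 0 = rV w ->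
  (fun h : R => h^-1 * (ip (c h) y - ip (c 0) y)) @ 0^' --> ip w y.
Proof.
move=> dc; rewrite /derive => E.
have cv : h^-1 *: (((rV \o c) \o shift 0) (h *: 1) - (rV \o c) 0) @[h --> 0^'] --> rV w.
  by rewrite -E; exact: dc.
pose e := vbasis (fullv : {vspace V}).
have fe : basis_of fullv e by exact: vbasisP.
have ipe v : ip v y = \sum_i rV v 0 i * ip e`_i y.
  rewrite -{1}(passmx.rVofK fe v) /passmx.vecof (ip_suml hip).
  by apply: eq_bigr => i _; rewrite (ipZl hip).
have -> : (fun h : R => h^-1 * (ip (c h) y - ip (c 0) y)) = fun h : R => \sum_i
   ((h^-1 *: (((rV \o c) \o shift 0) (h *: 1) - (rV \o c) 0)) 0 i * ip e`_i y).
  apply/funext => h; rewrite -(ipBl hip) -(ipZl hip) ipe; apply: eq_bigr => i _.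
  by rewrite /shift /= addr0 [_%:A]mulr1 !mxE linearZ linearB.
rewrite ipe; apply: (@cvg_sum R R^o) => i _; apply: cvgMr_tmp.
exact: (@continuous_cvg _ _ _ _ _ _ _ _ (@coord_continuous R _ _ 0 i (rV w)) cv).
Qed.

(** The quotients are nonpositive to the right of 0 and nonnegative to the left. *)
Lemma max_slope (f : R -> R) L : (forall t, f t <= f 0) ->
  (fun h : R => h^-1 * (f h - f 0)) @ 0^' --> L -> L = 0.
Proof.
move=> fm cv; apply/le_anti/andP; split.
  apply: (cvgr_to_le (cvg_dnbhs_at_right cv)).
  near=> h; rewrite pmulr_rle0 ?subr_le0// invr_gt0; near: h; exact: nbhs_right_gt.
apply: (cvgr_to_ge (cvg_dnbhs_at_left cv)).
near=> h; rewrite nmulr_rge0 ?subr_le0// invr_lt0; near: h; exact: nbhs_left_lt.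
Unshelve. all: by end_near. Qed.

Lemma tangent_max (X : set V) u w y : tangent_space X u w ->
  (forall x, X x -> ip x y <= ip u y) -> ip w y = 0.
Proof.
move=> [c [c0 Xc dc Dc]] umax.
apply: (@max_slope (fun t => ip (c t) y)); first by move=> t; rewrite c0; apply: umax.
by apply: curve_cvg.
Qed.

End Tangent.

(** * Elements preserving a subspace, and the Weyl group of the chamber *)

Section Stable.
Variables (R : realType) (V : vectType R) (ip : V -> V -> R) (G : set 'End(V)).
Hypothesis H : isometry_group ip G.
Variable a : {vspace V}.

Lemma stable_img g : G g -> (forall x, x \in a -> g x \in a) -> (g @: a)%VS = a.
Proof.
move=> Gg ga; have sub : (g @: a <= a)%VS.
  by apply/subvP => _ /memv_imgP[x xa ->]; exact: ga.
have [_ _ h] := iso_linear H; have [/eqP k0 _] := h g Gg.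
have dg : \dim (g @: a) = \dim a by apply: limg_dim_eq; rewrite k0 capv0.
by apply/eqP; rewrite eqEdim sub dg leqnn.
Qed.

Lemma img_stable (g : 'End(V)) x : (g @: a)%VS = a -> x \in a -> g x \in a.
Proof. by move=> ga xa; have := memv_img g xa; rewrite ga. Qed.

Lemma stable_inv g : G g -> (g @: a)%VS = a -> forall x, x \in a -> (g^-1)%VF x \in a.
Proof.
move=> Gg ga x; rewrite -{1}ga => /memv_imgP[y ya ->].
by rewrite (iso_invK H).
Qed.

Lemma stable_restrict g : G g -> (forall x, x \in a -> g x \in a) ->
  exists2 f, weyl_group G a f & forall x, vsval (f x) = g (vsval x).
Proof.
move=> Gg ga; pose f0 (x : subvs_of a) := vsproj a (g (vsval x)).
have fl : linear f0 by move=> c x y; rewrite /f0 !linearP.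
pose fL : {linear subvs_of a -> subvs_of a} :=
  HB.pack f0 (GRing.isLinear.Build _ _ _ _ f0 fl).
have fE x : vsval (linfun fL x) = g (vsval x).
  by rewrite lfunE/= vsprojK// ga// subvsP.
exists (linfun fL) => //; exists g => //; split => //; exact: stable_img.
Qed.

Lemma weyl_linear : linear_group (weyl_group G a).
Proof.
split.
- exists \1%VF; first exact: (iso_id H).
  by split => [|x]; rewrite ?lim1g// !id_lfunE.
- move=> f1 f2 [g1 Gg1 [s1 e1]] [g2 Gg2 [s2 e2]].
  exists (g1 \o g2)%VF; first exact: (iso_comp H).
  by split => [|x]; [rewrite limg_comp s2|rewrite !comp_lfunE e1 e2].
- move=> f [g Gg [s e]].
  have k0 : lker f == 0%VS.
    apply/lker0P => x y xy; apply: subvs_inj.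
    by rewrite -(iso_invK H (vsval x) Gg) -e xy e (iso_invK H).
  split => //.
  have ga := stable_inv Gg s; have GVg := iso_inv H Gg.
  exists (g^-1)%VF => //; split; first exact: stable_img.
  move=> x; have {2}-> : x = f ((f^-1)%VF x) by rewrite -comp_lfunE lker0_compfV// id_lfunE.
  by rewrite e (iso_invK H).
Qed.

End Stable.

Lemma uf_seq (T : eqType) (m : nat -> T) (s : seq T) :
  uf [set k | m k \in s] -> exists2 b, b \in s & uf [set k | m k = b].
Proof.
elim: s => [|x s IH] h.
  by have /filter_ex[k] := h.
have [hx|hx] := in_ultra_setVsetC [set k | m k = x] uf_ultra.
  by exists x => //; rewrite mem_head.
have [|b bs hb] := IH; last by exists b => //; rewrite inE bs orbT.
by apply: filterS (filterI h hx) => k /= []; rewrite inE => /orP[/eqP->|].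
Qed.

Lemma finite_max (R : realType) (T : eqType) (B : set T) (f : T -> R) :
  finite_set B -> B !=set0 -> exists2 b, B b & forall c, B c -> f c <= f b.
Proof.
move=> /finite_seqP[s Bs] [b0 Bb0].
have [||b [Bb bmax]] := @ulim_attain R T B f; first by exists b0.
  move=> m mB; have [|b bs hb] := @uf_seq T m s.
    by apply: nearW => k; have := mB k; rewrite Bs.
  exists b; split; first by rewrite Bs.
  by apply: ulim_eq (ulim_cst (f b)); apply: filterS hb => k /= ->.
by exists b.
Qed.

Section ChamberWeyl.
Variables (R : realType) (V : vectType R) (ip : V -> V -> R) (G : set 'End(V)).
Hypothesis H : isometry_group ip G.
Let hip := iso_inner H.
Variables (a : {vspace V}) (z : V) (d : R).
Hypothesis Ch : chamber ip G a z d.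
Local Notation aligned := (aligned ip G).
Local Notation C := (aligned z).

Let d0 : 0 < d. Proof. by case: Ch. Qed.

(** <s y, z> = <y, z> - 2 <y, r> <z, r>, where <y, r> < 0 by choice of [r] and <z, r> > 0 because
    [z] is interior. Maximising the product with [z] therefore leads into the chamber. *)
Lemma chamber_ascent y : y \in a -> ~ C y -> exists r s,
  [/\ G s, forall x, x \in a -> s x = x - (2 * ip x r) *: r, ip r r = 1, r \in a
    & ip y z < ip (s y) z].
Proof.
move=> ya nCy; have [b [r [Cb dr rr br [yr sm]]]] := smooth_point H Ch ya nCy.
have [s Gs hs] := chamber_reflection H Ch Cb dr rr br sm.
have [ra _] := dr; exists r, s; split => //.
rewrite hs// (ipBl hip) (ipZl hip).
have zr : 0 < ip z r.
  apply: lt_le_trans (dual_cone_center H Ch dr); rewrite mulr_gt0// nrm_gt0//.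
  by rewrite -(ip_eq0 hip) rr oner_eq0.
rewrite (ipC hip r); nra.
Qed.

Lemma chamber_stable u : u \in a -> exists g,
  [/\ G g, forall x, x \in a -> g x \in a & C (g u)].
Proof.
move=> ua; have [||g [Gg ga gmax]] :=
    @iso_max _ _ _ _ H (fun g => forall x, x \in a -> g x \in a) (fun g => ip (g u) z).
- by exists \1%VF => [|x]; [exact: (iso_id H)|rewrite id_lfunE].
- move=> g_ g Gg_ ga_ Gg gl; split; last exact: gl.
  move=> x xa; apply: (vlim_mem hip (gl x)); apply: nearW => k; exact: ga_.
exists g; split => //; apply: contrapT => nC.
have [r [s [Gs hs rr ra]]] := chamber_ascent (ga u ua) nC.
rewrite ltNge -comp_lfunE gmax//; first exact: (iso_comp H).
move=> x xa; rewrite comp_lfunE hs ?ga// rpredB ?ga// rpredZ//.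
Qed.

(** For (B), an element [n] preserving [a] takes [u] into the chamber. Alignment then says that [u]
    maximises the product with n^-1 y on its orbit for each chamber vector [y], and the chamber
    spans [a]. *)
Lemma chamber_cartan : cartan_subspace ip G a.
Proof.
split=> [v|u ua w tw x xa].
  have [g Gg Cg] := orbit_meets_chamber H z v; exists (g v); first by exists g.
  exact: (chamber_sub Ch).
have [n [Gn na Cn]] := chamber_stable ua.
rewrite -(iso_invK H x Gn).
apply: (chamber_spans H Ch (f := fun y => ip w ((n^-1)%VF y))); last exact: na.
  by move=> c s t; rewrite linearP/= (ipDr hip) (ipZr hip).
move=> y Cy; apply: (tangent_max hip tw) => _ [h Gh <-].
have GnV := iso_inv H Gn.
rewrite -!(iso_adj H)//; have := chamber_aligned Ch Cn Cy (iso_comp H (iso_comp H Gn Gh) GnV).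
by rewrite !comp_lfunE (iso_invK H).
Qed.

(** For |x| <= d / 2 the image of z + x is still within [d] of [z], so both are chamber points of
    one orbit and coincide. This rigidity makes the Weyl group discrete. *)
Lemma chamber_fix g : G g -> (forall x, x \in a -> g x \in a) ->
  nrm ip (g z - z) <= d / 2 -> forall x, x \in a -> g x = x.
Proof.
move=> Gg ga gz.
have small x : x \in a -> nrm ip x <= d / 2 -> g (z + x) = z + x.
  move=> xa xd; apply: (chamber_orbit_unique H Ch) => //; first by apply: (chamber_interior Ch) => //; have := d0; lra.
  rewrite (_ : g (z + x) = z + (g z - z + g x)); last first.
    by rewrite linearD/= [RHS]addrA [z + (_ - _)]addrC subrK.
  apply: (chamber_interior Ch); first by rewrite rpredD ?rpredB ?ga// (chamber_center_mem H Ch).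
  by apply: le_trans (nrmD hip _ _) _; rewrite (iso_nrm H)//; lra.
have gz0 : g z = z.
  have := small 0 (mem0v _); rewrite addr0; apply.
  by rewrite nrm0// divr_ge0// ltW.
move=> x xa; have n1 : 0 < 1 + nrm ip x by have := nrm_ge0 ip x; lra.
pose e := d / 2 / (1 + nrm ip x); have e0 : 0 < e by rewrite !divr_gt0.
have := small (e *: x); rewrite linearD/= gz0 linearZ/= => /(_ _ _)/addrI E.
apply: (scalerI (_ : e != 0)); first by rewrite gt_eqF.
apply: E; first by rewrite rpredZ.
rewrite nrmZ// gtr0_norm// /e mulrAC ler_pdivrMr// ler_pM2l ?divr_gt0//; lra.
Qed.

(** Infinitely many elements would have a limit [g]; by [chamber_fix], two of them would agree with
    [g] on all of [a]. *)
Lemma chamber_weyl_finite : finite_set (weyl_group G a).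
Proof.
pose T : pointedType := HB.pack 'End(subvs_of a) (isPointed.Build 'End(subvs_of a) 0).
apply: contrapT => /infiniteP/(@pcard_leP _ T)/injfunPex[/= f funf injf].
have hW k : exists g, [/\ G g, (g @: a)%VS = a & forall x, vsval (f k x) = g (vsval x)].
  have [g Gg [ga fg]] : weyl_group G a (f k) by apply: funf.
  by exists g.
have [g_ hg_] := choice hW.
have Gg_ k : G (g_ k) by case: (hg_ k).
have ga_ k x : x \in a -> g_ k x \in a.
  by case: (hg_ k) => _ e _; exact: img_stable.
have [g Gg gl] := iso_ulim H Gg_.
have ga : (g @: a)%VS = a.
  apply: (stable_img H) => // x xa.
  by apply: (vlim_mem hip (gl x)); apply: nearW => k; exact: ga_.
have GVg := iso_inv H Gg.
have hz : ulim (fun k => nrm ip ((g^-1)%VF (g_ k z) - z)) 0.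
  have : vlim ip (fun k => (g^-1)%VF (g_ k z) - z) ((g^-1)%VF (g z) - z).
    apply: (vlimB hip); last exact: vlim_cst.
    by apply: (glim_app (g_ := fun=> (g^-1)%VF) H) => // y; exact: vlim_cst.
  by move/(vlim_nrm hip); rewrite (iso_invK H)// subrr nrm0.
have d2 : 0 < d / 2 by rewrite divr_gt0.
have near_z := ulim_lt_near hz d2.
have [k _ hk] := uf_geq 0 near_z.
have [l kl hl] := uf_geq k.+1 near_z.
have eqg m : nrm ip ((g^-1)%VF (g_ m z) - z) < d / 2 -> forall x, x \in a -> g_ m x = g x.
  move=> hm x xa; have := @chamber_fix (g^-1 \o g_ m)%VF _ _ _ x xa.
  rewrite !comp_lfunE => h; rewrite -[LHS](iso_Kinv H _ Gg) h//; last exact: ltW.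
    exact: (iso_comp H).
  by move=> y ya; rewrite comp_lfunE (stable_inv H Gg ga)// ga_.
have : f k = f l.
  apply/lfunP => x; apply: subvs_inj.
  have [[_ _ ek] [_ _ el]] := (hg_ k, hg_ l).
  by rewrite ek el (eqg k hk _ (subvsP x)) (eqg l hl _ (subvsP x)).
move/injf; rewrite !inE => /(_ I I) E.
by move: kl; rewrite E ltnn.
Qed.

Lemma chamber_coxeter : coxeter_group (restrict_ip ip a) (weyl_group G a).
Proof.
have sE (x y : subvs_of a) : restrict_ip ip a x y = ip (vsval x) (vsval y) by [].
split; first exact: chamber_weyl_finite.
  by move=> f [g Gg [_ fg]] x y; rewrite !sE !fg (iso_ip H).
exists (weyl_group G a `&` reflection (restrict_ip ip a)); first by move=> f [].
apply/seteqP; split; last first.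
  by apply: smallest_sub => [|f []//]; exact: weyl_linear H a.
move=> f Wf A [hA SA].
have z_a : z \in a := chamber_center_mem H Ch.
pose z' := vsproj a z; have z'E : vsval z' = z by rewrite vsprojK.
pose W := weyl_group G a.
(* [A] may be larger than the finite group [W], hence the intersection. The best [m] brings the
   image of [z] under [f] into the chamber, since otherwise a reflection would improve it; then m f
   fixes [z] and is the identity. *)
have [||m [Am Wm] mmax] := @finite_max R _ (A `&` W)
    (fun m => ip (vsval (m (f z'))) z).
- exact: finite_setIr chamber_weyl_finite.
- by exists \1%VF; split; [case: hA|case: (weyl_linear H a)].
have [g Gg [ga fg]] := Wf; have [n Gn [na mn]] := Wm.
have yE : vsval (m (f z')) = n (g z) by rewrite mn fg z'E.
have Cy : C (n (g z)).
  apply: contrapT => /chamber_ascent[|r [s [Gs hs rr ra lt]]].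
    by rewrite !img_stable.
  have sa x : x \in a -> s x \in a by move=> xa; rewrite hs// rpredB// rpredZ.
  have [t Wt ts] := stable_restrict H Gs sa.
  have At : A t.
    apply: SA; split => //; exists (vsproj a r).
      apply/eqP => /(congr1 vsval); rewrite vsprojK// => r0.
      by move/eqP: rr; rewrite r0 (ip0l hip) eq_sym oner_eq0.
    move=> x; apply: subvs_inj.
    rewrite ts hs ?subvsP// !sE vsprojK// rr divr1.
    by rewrite linearB linearZ/= vsprojK// scalerN.
  have tm : (A `&` W) (t \o m)%VF.
    split; first by case: hA => _ h _; apply: h.
    by case: (weyl_linear H a) => _ h _; apply: h.
  by have := mmax _ tm; rewrite comp_lfunE ts yE leNgt lt.
have ng : G (n \o g)%VF by apply: (iso_comp H).
have ngz : (n \o g)%VF z = z.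
  by apply: (chamber_orbit_unique H Ch) => //; [exact: chamber_center|rewrite comp_lfunE].
have mf : (m \o f)%VF = \1%VF.
  apply/lfunP => x; apply: subvs_inj; rewrite comp_lfunE mn fg id_lfunE -comp_lfunE.
  apply: chamber_fix => //; last exact: subvsP.
    by move=> y ya; rewrite comp_lfunE !img_stable.
  by rewrite ngz subrr nrm0// divr_ge0// ltW.
have [_ _ hAV] := hA; have [km AmV] := hAV m Am.
have -> // : f = (m^-1)%VF.
by rewrite -[RHS]comp_lfun1r -mf comp_lfunA lker0_compVf// comp_lfun1l.
Qed.

End ChamberWeyl.

Lemma SP_polar_coxeter (R : realType) (V : vectType R) (ip : V -> V -> R)
    (G : set 'End(V)) : isometry_group ip G -> property_SP G ->
  exists a : {vspace V},
    cartan_subspace ip G a /\ coxeter_group (restrict_ip ip a) (weyl_group G a).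
Proof.
move=> H hSP; have [a [z [d Ch]]] := SP_chamber H hSP.
exists a; split; first exact: (chamber_cartan H Ch).
exact: (chamber_coxeter H Ch).
Qed.

Lemma uf_forall (T : eqType) (s : seq T) (A : T -> set nat) :
  (forall x, x \in s -> uf (A x)) -> uf [set k | forall x, x \in s -> A x k].
Proof.
elim: s => [|x s IH] h; first by apply: nearW.
have hs : uf [set k | forall y, y \in s -> A y k].
  by apply: IH => y ys; apply: h; rewrite inE ys orbT.
apply: filterS (filterI (h x (mem_head _ _)) hs) => k /= [Ax As] y.
by rewrite inE => /predU1P[->|/As].
Qed.

(** * Chambers of Coxeter groups *)

Section Coxeter.
Variables (R : realType) (V : vectType R) (ip : V -> V -> R) (W : set 'End(V)).
Hypotheses (hip : inner ip) (hW : coxeter_group ip W).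

(** A small multiple of [r] repairs <p, r> = 0 without spoiling the finitely many products already
    nonzero. *)
Lemma regular_vector (s : seq V) : exists p, forall r, r \in s -> r != 0 -> ip p r != 0.
Proof.
elim: s => [|r s [p hp]]; first by exists 0.
have [pr|pr] := eqVneq (ip p r) 0; last first.
  by exists p => t; rewrite inE => /predU1P[->|/hp].
have h t : t \in s -> uf [set k | t != 0 -> ip (p + k.+1%:R^-1 *: r) t != 0].
  move=> ts; have [->|t0] := eqVneq t 0; first by apply: nearW => k /=; rewrite ?eqxx.
  have pt : 0 < `|ip p t| by rewrite normr_gt0 hp.
  have : ulim (fun k => `|ip p t| - k.+1%:R^-1 * `|ip r t|) (`|ip p t| - 0 * `|ip r t|).
    apply: ulimB; first exact: ulim_cst.
    by apply: ulimM; [exact: ulim_harmonic|exact: ulim_cst].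
  rewrite mul0r subr0 => /ulim_gt_near/(_ pt); apply: filterS => k /= hk _.
  apply: contraTneq hk => /eqP; rewrite (ipDl hip) (ipZl hip) addr_eq0 => /eqP ->.
  by rewrite normrN normrM gtr0_norm ?invr_gt0// subrr ltxx.
have [k hk] := filter_ex (uf_forall h).
exists (p + k.+1%:R^-1 *: r) => t; rewrite inE => /predU1P[->|ts]; last exact: hk.
rewrite -(ip_eq0 hip) (ipDl hip) (ipZl hip) pr add0r => rr.
by rewrite mulf_neq0// invr_eq0 pnatr_eq0.
Qed.

Definition refl r x := x - (2 * ip x r) *: r.

Lemma refl_ip r x y : ip r r = 1 -> ip (refl r x) (refl r y) = ip x y.
Proof. by move=> rr; rewrite /refl !(ipE hip) rr (ipC hip r); ring. Qed.

Lemma reflK r x : ip r r = 1 -> refl r (refl r x) = x.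
Proof.
by move=> rr; apply: (ip_eq hip) => y; rewrite /refl !(ipE hip) rr; ring.
Qed.

Lemma refl_adj r x y : ip (refl r x) y = ip x (refl r y).
Proof. by rewrite /refl !(ipE hip) (ipC hip r); ring. Qed.

Lemma refl_self r : ip r r = 1 -> refl r r = - r.
Proof.
by move=> rr; apply: (ip_eq hip) => y; rewrite /refl !(ipE hip) rr; ring.
Qed.

Lemma reflN r x : refl (- r) x = refl r x.
Proof. by rewrite /refl (ipNr hip) scalerN mulrN scaleNr opprK. Qed.

Lemma refl_refl r s x : ip s s = 1 -> refl (refl s r) (refl s x) = refl s (refl r x).
Proof.
by move=> ss; rewrite {1}/refl refl_ip//; apply: (ip_eq hip) => y; rewrite /refl !(ipE hip); ring.
Qed.

Definition unit_root r := ip r r = 1 /\ exists2 w, W w & forall x, w x = refl r x.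

Let W_orth f x y : W f -> ip (f x) (f y) = ip x y.
Proof. by case: hW => _ h _ /h. Qed.

Lemma coxeter_linear_group : linear_group W.
Proof.
have [_ _ [S _ WE]] := hW; rewrite {1}WE; split.
- by move=> A [[]].
- move=> f g Wf Wg A hA; have [[_ h _] _] := hA; apply: h; [exact: Wf|exact: Wg].
- move=> f Wf; split.
    apply/lker0P => x y xy; apply/eqP; rewrite -subr_eq0 -(ip_eq0 hip).
    by rewrite -(W_orth (f := f)) ?WE// linearB/= xy subrr (ip0l hip).
  by move=> A hA; have [[_ _ h] _] := hA; case: (h f (Wf A hA)).
Qed.

Let W1 : W \1%VF. Proof. by case: coxeter_linear_group. Qed.
Let WM f g : W f -> W g -> W (f \o g)%VF.
Proof. by case: coxeter_linear_group => _ h _; apply: h. Qed.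
Let WV f : W f -> W (f^-1)%VF. Proof. by case: coxeter_linear_group => _ _ h /h[]. Qed.
Let WVK f x : W f -> f ((f^-1)%VF x) = x.
Proof. by case: coxeter_linear_group => _ _ h /h[k _]; rewrite -comp_lfunE lker0_compfV// id_lfunE. Qed.
Lemma unit_rootN r : unit_root r -> unit_root (- r).
Proof.
move=> [rr [w Ww wE]]; split; first by rewrite (ipNl hip) (ipNr hip) opprK.
by exists w => // x; rewrite reflN.
Qed.

Lemma unit_root_refl s r : unit_root s -> unit_root r -> unit_root (refl s r).
Proof.
move=> [ss [w Ww wE]] [rr [v Wv vE]]; split; first by rewrite refl_ip.
exists (w \o v \o w)%VF; first by do 2?apply: WM.
move=> x; rewrite !comp_lfunE /= !wE vE -{2}(reflK x ss) refl_refl//.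
Qed.

(** A reflection determines its unit root up to sign: it sends [r] to -r, which makes [r] a multiple
    of the chosen root [rho w]. *)
Lemma finite_unit_roots : finite_set unit_root.
Proof.
have [Wfin _ _] := hW.
pose P (w : 'End(V)) r := ip r r = 1 /\ forall x, w x = refl r x.
have h w : exists r, (exists t, P w t) -> P w r.
  by have [[t Pt]|nP] := pselect (exists t, P w t); [exists t|exists 0].
have [rho hrho] := choice h.
apply: (@sub_finite_set _ _ (rho @` W `|` (fun w => - rho w) @` W)); last first.
  by rewrite finite_setU; split; apply: finite_image.
move=> r [rr [w Ww wE]].
have [ss sE] := hrho w (ex_intro _ r (conj rr wE)).
set s := rho w in ss sE.
have : - r = refl s r by rewrite -sE wE refl_self.
rewrite /refl => E.
have rE : r = ip r s *: s.
  apply: (scalerI (_ : 2 != 0 :> R)); first by rewrite pnatr_eq0.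
  rewrite scalerA scaler_nat mulr2n; apply/eqP.
  by rewrite -subr_eq0 -addrA -E subrr.
have c1 : ip r s ^+ 2 = 1.
  by move: rr; rewrite {1 2}rE !(ipE hip) ss mulr1 -expr2.
move/eqP: c1; rewrite sqrf_eq1 => /orP[]/eqP c.
  by left; exists w => //; rewrite rE c scale1r.
by right; exists w => //; rewrite [RHS]rE c scaleN1r.
Qed.

Variable p : V.
Hypothesis preg : forall r, unit_root r -> ip p r != 0.

Definition positive_root r := unit_root r /\ 0 < ip p r.
Definition weyl_chamber x := forall r, positive_root r -> 0 <= ip x r.
(** Defined by the property that the exchange argument uses, rather than as members of a basis of
    the root system. *)
Definition simple_root b := positive_root b /\
  forall r, positive_root r -> r <> b -> positive_root (refl b r).

Lemma positive_rootVN r : unit_root r -> positive_root r \/ positive_root (- r).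
Proof.
move=> hr; have := preg hr; rewrite neq_lt => /orP[h|h]; [right|left; split=> //].
by split; [exact: unit_rootN|rewrite (ipNr hip) oppr_gt0].
Qed.

(* With [b' = b / ip p b], the root found is the one whose [b'] is longest among
   those minimising [ip q b']: it is then an extreme point of the hull of all the
   [b'], and so not a positive combination of two other positive roots. *)
Lemma exists_simple_root q b : positive_root b -> ip q b < 0 ->
  exists2 c, simple_root c & ip q c < 0.
Proof.
move=> pb qb; pose f r := - ip q r / ip p r.
have [||b1 p1 max1] := @finite_max R _ positive_root f.
- by apply: sub_finite_set finite_unit_roots => r [].
- by exists b.
have [||c [pc fc] max2] := @finite_max R _ [set r | positive_root r /\ f r = f b1] (fun r => - ip p r).
- by apply: sub_finite_set finite_unit_roots => r [[]].
- by exists b1.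
have lef r : positive_root r -> - ip q r <= f b1 * ip p r.
  by move=> pr; rewrite -ler_pdivrMr; [exact: max1|case: pr].
have eqf r : positive_root r -> - ip q r = f b1 * ip p r -> f r = f b1.
  by move=> [_ pr] e; rewrite /f e mulfK// gt_eqF.
have [rc pc0] := pc.
have ec : - ip q c = f b1 * ip p c by rewrite -fc /f divfK// gt_eqF.
have f0 : 0 < f b1.
  apply: lt_le_trans (max1 _ pb); rewrite divr_gt0 ?oppr_gt0//; by case: pb.
exists c; last by rewrite -oppr_gt0 ec mulr_gt0.
split => // r pr rc'; have [rr _] := pr.
have [//|nd] := positive_rootVN (unit_root_refl rc rr).
(* If the reflected root were negative, 2 <r, c> c = r + t with [r] and [t] positive. Extremality of
   [c] puts both on the face where [f] is maximal, and the choice of least <p, c> there gives <r, c>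
   >= 1, so r = c. *)
set t := - refl c r in nd.
have E : (2 * ip r c) *: c = r + t by rewrite /t /refl opprB addrC subrK.
have [rt pt] := nd; have pr0 := pr.2.
have E1 : 2 * ip r c * ip p c = ip p r + ip p t by rewrite -(ipZr hip) E (ipDr hip).
have E2 : 2 * ip r c * ip q c = ip q r + ip q t by rewrite -(ipZr hip) E (ipDr hip).
have lr := lef r pr; have lt := lef t nd.
have e3 : 2 * ip r c * ip q c = - (f b1 * (ip p r + ip p t)) by rewrite -E1 -[ip q c]opprK ec; ring.
have er : - ip q r = f b1 * ip p r by lra.
have et : - ip q t = f b1 * ip p t by lra.
have := max2 r (conj pr (eqf r pr er)); rewrite lerN2 => h1.
have := max2 t (conj nd (eqf t nd et)); rewrite lerN2 => h2.
have h3 : 1 <= ip r c.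
  have : ip p c * 2 <= ip p c * (2 * ip r c) by rewrite [leRHS]mulrC E1; lra.
  by rewrite ler_pM2l// => ?; lra.
have [rr1 _] := rr; have [cc1 _] := rc.
case: rc'; apply: (cauchy_schwarz_eq hip); first by rewrite rr1 cc1.
apply/le_anti; rewrite rr1 h3 andbT.
by have := cauchy_schwarz hip r c; rewrite /nrm rr1 cc1 sqrtr1 mulr1.
Qed.

Definition refl_word (l : seq V) x := foldr refl x l.

Definition all_simple (l : seq V) := forall r, r \in l -> simple_root r.

Lemma all_simple_cons r l : all_simple (r :: l) -> simple_root r /\ all_simple l.
Proof.
move=> h; split; first by apply: h; rewrite mem_head.
by move=> t tl; apply: h; rewrite inE tl orbT.
Qed.

Lemma all_simple_cat l m : all_simple l -> all_simple m -> all_simple (l ++ m).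
Proof. by move=> hl hm r; rewrite mem_cat => /orP[/hl|/hm]. Qed.

Lemma all_simple_rev l : all_simple l -> all_simple (rev l).
Proof. by move=> hl r; rewrite mem_rev; apply: hl. Qed.

Lemma simple_root_unit r : simple_root r -> ip r r = 1. Proof. by case=> [[[]]]. Qed.

Lemma refl_word_rev l x : all_simple l -> refl_word (rev l) (refl_word l x) = x.
Proof.
elim: l x => [//|r l IH] x /all_simple_cons[/simple_root_unit rr hl] /=.
rewrite rev_cons -cats1 /refl_word foldr_cat /= -/(refl_word _ _) reflK//; exact: IH.
Qed.

Lemma refl_word_adj l x y : ip (refl_word l x) y = ip x (refl_word (rev l) y).
Proof.
elim: l x y => [//|r l IH] x y /=.
by rewrite refl_adj IH rev_cons -cats1 /refl_word foldr_cat.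
Qed.

Lemma refl_word_refl l r x : all_simple l ->
  refl_word l (refl r x) = refl (refl_word l r) (refl_word l x).
Proof.
elim: l => [//|s l IH] /all_simple_cons[/simple_root_unit ss hl] /=.
by rewrite IH// refl_refl.
Qed.

(** Among the positive roots reached from [b] by simple reflections, the one of least height <p, c>
    is simple: otherwise a simple [s] with <c, s> > 0 would lower it. The reflection of [b] is then
    conjugate to a simple one along the word. *)
Lemma root_simple_word b : unit_root b ->
  exists2 l, all_simple l & forall x, refl b x = refl_word l x.
Proof.
wlog pb : b / positive_root b.
  move=> wl rb; have [/wl|/wl] := positive_rootVN rb; first exact.
  move=> /(_ (unit_rootN rb))[l hl E]; exists l => // x; by rewrite -reflN E.
move=> _.
pose B : set V := [set c | positive_root c /\ exists2 l, all_simple l & c = refl_word l b].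
have [||c [pc [l hl cE]] cmin] := @finite_max R _ B (fun c => - ip p c).
- by apply: sub_finite_set finite_unit_roots => r [[]].
- by exists b; split => //; exists [::].
have [[cc _] _] := pc.
have cneg : ip (- c) c < 0 by rewrite (ipNl hip) cc oppr_lt0.
have [s hs] := exists_simple_root pc cneg; rewrite (ipNl hip) oppr_lt0 => cs.
have cE' : c = s.
  apply: contrapT => cs'; have := hs.2 c pc cs' => ps.
  have : B (refl s c).
    split => //; exists (s :: l); last by rewrite cE.
    by move=> t; rewrite inE => /predU1P[->|/hl].
  move/cmin; rewrite lerN2 /refl (ipBr hip) (ipZr hip).
  have [_ ps0] := hs.1; nra.
exists (rev l ++ s :: l).
  apply: all_simple_cat; first exact: all_simple_rev.
  by move=> t; rewrite inE => /predU1P[->|/hl].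
move=> x; rewrite /refl_word foldr_cat /= -!/(refl_word _ _) -cE' refl_word_refl; last exact: all_simple_rev.
by rewrite cE !refl_word_rev.
Qed.

Lemma simple_word w : W w -> exists2 l, all_simple l & forall x, w x = refl_word l x.
Proof.
have [_ _ [S Srefl WE]] := hW.
have SW f : S f -> W f by move=> Sf; rewrite WE => A [_ SA]; exact: SA.
move=> Ww; have := Ww; rewrite {1}WE => /(_ [set f | W f /\
  exists2 l, all_simple l & forall x, f x = refl_word l x])[]//.
split; first split.
- by split => //; exists [::] => // x; rewrite id_lfunE.
- move=> f g [Wf [l hl fE]] [Wg [m hm gE]]; split; first exact: WM.
  exists (l ++ m); first exact: all_simple_cat.
  by move=> x; rewrite comp_lfunE fE gE /refl_word foldr_cat.
- move=> f [Wf [l hl fE]]; split; first by case: coxeter_linear_group => _ _ h; case: (h f Wf).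
  split; first exact: WV.
  exists (rev l); first exact: all_simple_rev.
  by move=> x; rewrite -[in RHS](WVK x Wf) fE refl_word_rev.
move=> f Sf; have Wf := SW f Sf; split => //.
have [r r0 fE] := Srefl f Sf.
pose s := (nrm ip r)^-1 *: r.
have n0 : nrm ip r != 0 by rewrite nrm_eq0.
have ss : ip s s = 1 by rewrite /s !(ipE hip) -nrm_sq//; move: (nrm ip r) n0 => t t0; field.
have fs x : f x = refl s x.
  rewrite fE /refl /s (ipZr hip) scalerA -nrm_sq//; congr (_ - _ *: _).
  by move: (nrm ip r) n0 => t t0; field.
have [|l hl sl] := @root_simple_word s; first by split => //; exists f.
by exists l => // x; rewrite fs sl.
Qed.

(** The reflection of [b] is moved past the letters by s_b s_c = s_c s_(s_c b) until the root has
    become the next letter, where both cancel. This must happen, as the letter [c] makes no positive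
    root other than [c] negative. *)
Lemma exchange_condition l b : all_simple l -> positive_root b ->
  ~ positive_root (refl_word (rev l) b) ->
  exists2 m, all_simple m & (size m < size l)%N /\ forall x, refl b (refl_word l x) = refl_word m x.
Proof.
elim: l b => [//|c l IH] b /all_simple_cons[hc hl] pb.
rewrite rev_cons -cats1 /refl_word foldr_cat /= => np.
have cc := simple_root_unit hc.
have [->|bc] := pselect (b = c).
  by exists l => //; split => // x; rewrite reflK.
have [m hm [sm mE]] := IH _ hl (hc.2 b pb bc) np.
exists (c :: m); first by move=> t; rewrite inE => /predU1P[->|/hm].
split; first by rewrite /= ltnS.
by move=> x; rewrite /= -/(refl_word l x) -/(refl_word m x) -mE -[RHS]refl_refl// reflK//.
Qed.

(** Write y for the image of [u] under the tail [l]: <s_b y, x> = <y, x> - 2 <y, b> <x, b>. If <y,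
    b> >= 0, the letter [b] cannot raise the product; otherwise l^-1 b is not positive, and the
    exchange condition shortens the word. *)
Lemma weyl_chamber_dominant l u x : all_simple l -> weyl_chamber u -> weyl_chamber x ->
  ip (refl_word l u) x <= ip u x.
Proof.
have [n] := ubnP (size l); elim: n l => // n IH [|b l] sz hl Cu Cx //=.
have [hb hl'] := all_simple_cons hl.
have [ub|ub] := leP 0 (ip (refl_word l u) b).
  rewrite /refl (ipBl hip) (ipZl hip); apply: le_trans (IH l sz hl' Cu Cx).
  by have := Cx b hb.1; rewrite (ipC hip x); nra.
have np : ~ positive_root (refl_word (rev l) b).
  by move/Cu; rewrite -refl_word_adj leNgt ub.
have [m hm [sm mE]] := exchange_condition hl' hb.1 np.
by rewrite mE; apply: IH => //; apply: ltn_trans sm _; rewrite -ltnS.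
Qed.

Lemma weyl_chamber_orbit x : exists2 w, W w & weyl_chamber (w x).
Proof.
have [Wfin _ _] := hW.
have [||w Ww wmax] := @finite_max R _ W (fun w => ip (w x) p) => //.
  by exists \1%VF.
exists w => // r [[rr [s Ws sE]] pr].
have := wmax _ (WM Ws Ww); rewrite comp_lfunE sE /refl (ipBl hip) (ipZl hip) (ipC hip r p); nra.
Qed.

End Coxeter.

Lemma coxeter_chamber (R : realType) (V : vectType R) (ip : V -> V -> R)
    (W : set 'End(V)) : inner ip -> coxeter_group ip W ->
  exists C : V -> Prop, [/\ forall x, exists2 w, W w & C (w x),
    forall x y, C x -> C y -> C (x + y) &
    forall u x w, W w -> C u -> C x -> ip (w u) x <= ip u x].
Proof.
move=> hip hW; have /finite_seqP[s rs] := finite_unit_roots hip hW.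
have [p hp] := regular_vector hip s.
have preg r : unit_root ip W r -> ip p r != 0.
  move=> hr; apply: hp; first by have : [set` s] r by rewrite -rs.
  by rewrite -(ip_eq0 hip); have [-> _] := hr; rewrite oner_eq0.
exists (weyl_chamber ip W p); split.
- exact: weyl_chamber_orbit.
- by move=> x y Cx Cy r pr; rewrite (ipDl hip) addr_ge0 ?Cx ?Cy.
- move=> u x w Ww Cu Cx; have [l hl wE] := simple_word hip hW preg Ww.
  by rewrite wE; apply: weyl_chamber_dominant hl Cu Cx.
Qed.

(** * Convex hulls of orbits *)

Section Caratheodory.
Variables (R : realType) (V : vectType R) (X : set V).

Definition combination n x := exists (l : 'I_n -> R) (p : 'I_n -> V),
  [/\ forall i, 0 <= l i, \sum_i l i = 1, forall i, X (p i) & x = \sum_i l i *: p i].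

Lemma hull_combination x : convex_hull X x -> exists n, combination n x.
Proof.
apply: (@hull_min _ _ X [set y | exists n, combination n y]) => [|y Xy].
  apply/convex_setP => u v t t0 t1 [n [l [p [l0 l1 Xp ->]]]] [m [k [q [k0 k1 Xq ->]]]].
  exists (n + m)%N.
  pose f (T : Type) (a : 'I_n -> T) (b : 'I_m -> T) (i : 'I_(n + m)) :=
    match fintype.split i with inl j => a j | inr j => b j end.
  have fl (T : Type) (a : 'I_n -> T) b i : f T a b (lshift m i) = a i.
    by rewrite /f (unsplitK (inl i)).
  have fr (T : Type) (a : 'I_n -> T) b i : f T a b (rshift n i) = b i.
    by rewrite /f (unsplitK (inr i)).
  exists (f _ (fun i => t * l i) (fun i => (1 - t) * k i)), (f _ p q); split.
  - move=> i; rewrite /f; case: fintype.split => j; rewrite mulr_ge0// subr_ge0//.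
  - rewrite big_split_ord/=; under eq_bigr do rewrite fl; under [X in _ + X]eq_bigr do rewrite fr.
    by rewrite -!mulr_sumr l1 k1 !mulr1 addrC subrK.
  - by move=> i; rewrite /f; case: fintype.split.
  - rewrite big_split_ord/=; under [in RHS]eq_bigr do rewrite !fl.
    under [X in _ = _ + X]eq_bigr do rewrite !fr.
    by rewrite !scaler_sumr; congr (_ + _); apply: eq_bigr => i _; rewrite scalerA.
exists 1%N, (fun=> 1), (fun=> y); split => //; first by rewrite big_ord1.
by rewrite big_ord1 scale1r.
Qed.

Lemma combination_hull n x : combination n x -> convex_hull X x.
Proof.
move=> [l [p [l0 l1 Xp ->]]].
elim: n l p l0 l1 Xp => [|n IH] l p l0 l1 Xp.
  by move: l1; rewrite big_ord0 => /esym/eqP; rewrite oner_eq0.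
rewrite big_ord_recl.
have [e|e] := eqVneq (l ord0) 1.
  have h : \sum_(i < n) l (lift ord0 i) = 0.
    by move: l1; rewrite big_ord_recl e => /eqP; rewrite -subr_eq0 addrAC subrr add0r => /eqP.
  rewrite big1 ?addr0 ?e ?scale1r; first by apply: sub_hull.
  move=> i _; have /psumr_eq0P h' : forall i, true -> 0 <= l (lift ord0 i) by [].
  by rewrite h' ?scale0r.
pose t := l ord0; have t1 : 0 < 1 - t.
  rewrite subr_gt0 lt_neqAle e/= -l1 big_ord_recl ler_wpDr// sumr_ge0//.
have tsum : \sum_(i < n) l (lift ord0 i) = 1 - t by rewrite -l1 big_ord_recl addrAC subrr add0r.
have -> : \sum_(i < n) l (lift ord0 i) *: p (lift ord0 i) =
    (1 - t) *: \sum_(i < n) (l (lift ord0 i) / (1 - t)) *: p (lift ord0 i).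
  rewrite scaler_sumr; apply: eq_bigr => i _; rewrite scalerA; congr (_ *: _).
  by rewrite mulrC divfK// gt_eqF.
apply: hull_convex; rewrite ?l0//; first by rewrite -subr_ge0 ltW.
  exact: sub_hull.
apply: IH => // [i|]; first by rewrite divr_ge0// ltW.
by rewrite -mulr_suml tsum mulfV// gt_eqF.
Qed.

Lemma combination_pad n x : combination n x -> combination n.+1 x.
Proof.
case: n => [|n] [l [p [l0 l1 Xp xE]]].
  by move: l1; rewrite big_ord0 => /esym/eqP; rewrite oner_eq0.
pose f (T : Type) (c : T) (a : 'I_n.+1 -> T) (i : 'I_n.+2) :=
  if unlift ord0 i is Some j then a j else c.
exists (f _ 0 l), (f _ (p ord0) p); split.
- by move=> i; rewrite /f; case: unliftP.
- by rewrite big_ord_recl /f unlift_none add0r; under eq_bigr do rewrite liftK.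
- by move=> i; rewrite /f; case: unliftP.
- rewrite big_ord_recl /f unlift_none scale0r add0r.
  by under eq_bigr do rewrite liftK.
Qed.

Lemma combination_reduce n x : (\dim {: (V * R^o)%type} < n.+1)%N ->
  combination n.+1 x -> combination n x.
Proof.
move=> dn [l [p [l0 l1 Xp xE]]].
(* The component 1 makes a linear relation among the pairs an affine one among the points: its
   coefficients sum to 0. *)
pose Y := [tuple ((p i, 1) : V * R^o) | i < n.+1].
have YE (i : 'I_n.+1) : Y`_i = (p i, 1) by rewrite -tnth_nth tnth_mktuple.
have nfree : ~~ free Y.
  apply/negP => /eqP fY; move: dn; rewrite ltnNge => /negP; apply.
  by have := dimvS (subvf <<Y>>%VS); rewrite fY size_tuple.
have [mu [mu1 muP [i1 mui1]]] : exists mu : 'I_n.+1 -> R,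
    [/\ \sum_i mu i = 0, \sum_i mu i *: p i = 0 & exists i, 0 < mu i].
  move/freeP: nfree => /existsNP[mu /not_implyP[muY /existsNP[i /eqP mui]]].
  have E1 : \sum_i mu i *: p i = 0.
    have h : \sum_i (mu i *: Y`_i).1 = 0 by have := congr1 fst muY; rewrite raddf_sum.
    by rewrite -[RHS]h; apply: eq_bigr => j _; rewrite YE.
  have E2 : \sum_i mu i = 0.
    have h : \sum_i (mu i *: Y`_i).2 = 0 by have := congr1 snd muY; rewrite raddf_sum.
    by rewrite -[RHS]h; apply: eq_bigr => j _; rewrite YE /= [RHS]mulr1.
  have [[j muj]|npos] := pselect (exists j, 0 < mu j).
    by exists mu; split => //; exists j.
  exists (fun j => - mu j); split; first by rewrite sumrN E2 oppr0.
    by under eq_bigr do rewrite scaleNr; rewrite sumrN E1 oppr0.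
  exists i; rewrite oppr_gt0 lt_neqAle mui/= leNgt; apply/negP => h.
  by apply: npos; exists i.
(* When a multiple of the relation is subtracted, the coefficient of [i0] is the first to vanish. *)
have : exists2 i0, 0 < mu i0 & forall i, 0 < mu i -> l i0 / mu i0 <= l i / mu i.
  have [i0 h0 hmin] := @arg_minP _ R _ i1 (fun i => 0 < mu i) (fun i => l i / mu i) mui1.
  by exists i0.
move=> [i0 h0 hmin]; pose t := l i0 / mu i0.
have t0 : 0 <= t by rewrite divr_ge0// ltW.
pose k i := l i - t * mu i.
have k_i0 : k i0 = 0 by rewrite /k /t divfK ?subrr// gt_eqF.
have k0 i : 0 <= k i.
  rewrite subr_ge0; have [h|h] := ltP 0 (mu i).
    by rewrite -ler_pdivlMr// hmin.
  by apply: le_trans (l0 i); rewrite mulr_ge0_le0.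
exists (fun i => k (lift i0 i)), (fun i => p (lift i0 i)); split => //.
- have : \sum_i k i = k i0 + \sum_i k (lift i0 i) by rewrite (bigD1_ord i0).
  rewrite k_i0 add0r => <-.
  by rewrite /k sumrB -mulr_sumr mu1 mulr0 subr0.
- have : \sum_i k i *: p i = k i0 *: p i0 + \sum_i k (lift i0 i) *: p (lift i0 i).
    by rewrite (bigD1_ord i0).
  rewrite k_i0 scale0r add0r => <-; rewrite xE.
  under [RHS]eq_bigr do rewrite scalerBl -scalerA.
  by rewrite sumrB -scaler_sumr muP scaler0 subr0.
Qed.

(** The number of terms is the same for all [x], so in [orbit_hull_closed] each weight and each
    group element can pass to the limit separately. *)
Lemma caratheodory x : convex_hull X x -> combination (\dim {: (V * R^o)%type}) x.
Proof.
move=> /hull_combination[n]; set N := \dim _.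
have [nN|Nn] := leqP n N.
  by rewrite -(subnKC nN); elim: (N - n)%N => [|m IH]; rewrite ?addn0// addnS => /IH/combination_pad.
rewrite -(subnKC (ltnW Nn)); elim: (n - N)%N => [|m IH]; rewrite ?addn0// addnS.
by move/combination_reduce => h; apply: IH; apply: h; rewrite ltnS leq_addr.
Qed.

End Caratheodory.

Section HullSupport.
Variables (R : realType) (V : vectType R) (ip : V -> V -> R) (G : set 'End(V)).
Hypothesis H : isometry_group ip G.
Let hip := iso_inner H.
Local Notation supp := (supp H).

Lemma orbit_hull_closed w v l : (forall k, convex_hull (orbit G w) (v k)) ->
  vlim ip v l -> convex_hull (orbit G w) l.
Proof.
move=> hv vl; set N := \dim {: (V * R^o)%type}.
have /choice[c hc] k : exists c : ('I_N -> R) * ('I_N -> 'End(V)),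
    [/\ forall i, 0 <= c.1 i, \sum_i c.1 i = 1, forall i, G (c.2 i)
      & v k = \sum_i c.1 i *: c.2 i w].
  have [c [p [c0 c1 /(_ _)/cid2 hp E]]] := caratheodory (hv k).
  exists (c, fun i => sval (hp i)); split => //=.
    by move=> i; case: (hp i).
  by rewrite E; apply: eq_bigr => i _; case: (hp i) => /= ? _ ->.
have /choice[m hm] i : exists m, ulim (fun k => (c k).1 i) m.
  apply: (@ulim_bounded _ _ 1) => k; have [c0 c1 _ _] := hc k.
  rewrite ger0_norm// -c1 (bigD1 i)//= ler_wpDr// sumr_ge0//.
have /choice[g hg] i : exists g, G g /\ glim ip (fun k => (c k).2 i) g.
  have [|g Gg gl] := @iso_ulim _ _ _ _ H (fun k => (c k).2 i); last by exists g.
  by move=> k; have [_ _ + _] := hc k; apply.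
have -> : l = \sum_i m i *: g i w.
  apply: (vlim_unique hip vl).
  apply: (@vlim_ext _ _ _ (fun k => \sum_i (c k).1 i *: (c k).2 i w)).
    by move=> k; have [_ _ _ ->] := hc k.
  apply: (vlim_sum hip) => i _; apply: (vlimZ hip) => //.
  by have [_] := hg i; apply.
apply: (@combination_hull _ _ _ N); exists m, (fun i => g i w); split => //.
- by move=> i; apply: (ulim_ge0 (hm i)) => k; have [+ _ _ _] := hc k; apply.
- have h : ulim (fun k => \sum_i (c k).1 i) (\sum_i m i).
    by apply: ulim_sum => i _; exact: hm.
  by apply: (ulim_unique h); apply: ulim_ext (ulim_cst 1) => k; have [_ -> _ _] := hc k.
- by move=> i; exists (g i) => //; case: (hg i).
Qed.

Lemma hull_supp w p : (forall x, ip p x <= supp w x) -> convex_hull (orbit G w) p.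
Proof.
move=> hp; have [|||q [Kq hq]] := @nearest_point _ _ _ hip (convex_hull (orbit G w)) p.
- by exists w; apply: sub_hull; exists \1%VF; [exact: (iso_id H)|rewrite id_lfunE].
- exact: orbit_hull_closed.
- by move=> u v t t0 t1 hu hv; apply: hull_convex.
have [g [Gg _ E]] := suppP H w (p - q).
have Kg : convex_hull (orbit G w) (g w) by apply: sub_hull; exists g.
have := hq _ Kg; have := hp (p - q); rewrite E.
rewrite (ipBr hip (g w)) (ipC hip _ (g w)) => h1 h2.
have : ip (p - q) (p - q) <= 0 by rewrite {1}(ipBl hip) (ipC hip q); lra.
move=> h; have /eqP : ip (p - q) (p - q) = 0 by apply/le_anti; rewrite h ip_ge0.
by rewrite (ip_eq0 hip) subr_eq0 => /eqP ->.
Qed.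

Lemma supp_minkowski u v : (forall x, supp u x + supp v x = supp (u + v) x) ->
  minkowski_sum (convex_hull (orbit G u)) (convex_hull (orbit G v)) =
  convex_hull (orbit G (u + v)).
Proof.
move=> hs; apply/seteqP; split.
  move=> _ [p hp [q hq <-]]; apply: hull_supp => x; rewrite (ipDl hip) -hs lerD//.
    by apply: (hull_le hip _ hp) => _ [g Gg <-]; apply: supp_ge.
  by apply: (hull_le hip _ hq) => _ [g Gg <-]; apply: supp_ge.
apply: hull_min => [|_ [g Gg <-]]; last first.
  rewrite linearD/=; exists (g u); first by apply: sub_hull; exists g.
  by exists (g v) => //; apply: sub_hull; exists g.
apply/convex_setP => _ _ t t0 t1 [p hp [q hq <-]] [p' hp' [q' hq' <-]].
exists (t *: p + (1 - t) *: p'); first exact: hull_convex.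
exists (t *: q + (1 - t) *: q'); first exact: hull_convex.
by rewrite !scalerDr addrACA.
Qed.

End HullSupport.

(** * One-parameter subgroups *)

Section Cartan.
Variables (R : realType) (V : vectType R) (ip : V -> V -> R) (G : set 'End(V)).
Hypothesis H : isometry_group ip G.
Let hip := iso_inner H.

Lemma nrm_sum (I : Type) (s : seq I) (P : pred I) (F : I -> V) :
  nrm ip (\sum_(i <- s | P i) F i) <= \sum_(i <- s | P i) nrm ip (F i).
Proof.
elim/big_rec2: _ => [|i y x _ h]; first by rewrite nrm0.
by apply: le_trans (nrmD hip _ _) _; rewrite lerD2l.
Qed.

Definition iterate (g : 'End(V)) n : 'End(V) := iter n (fun f => g \o f)%VF \1%VF.

Lemma iterateS g n x : iterate g n.+1 x = g (iterate g n x).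
Proof. by rewrite /iterate /= comp_lfunE. Qed.

Lemma iterate0 g x : iterate g 0 x = x. Proof. by rewrite /iterate /= id_lfunE. Qed.

Lemma iterateD g m n x : iterate g (m + n) x = iterate g m (iterate g n x).
Proof. by elim: m => [|m IH]; rewrite ?iterate0// addSn !iterateS IH. Qed.

Lemma iso_iterate g n : G g -> G (iterate g n).
Proof. by move=> Gg; elim: n => [|n IH]; [exact: (iso_id H)|apply: (iso_comp H)]. Qed.

Lemma iterate_sub_le g D n x : 0 <= D -> G g ->
  (forall y, nrm ip (g y - y) <= D * nrm ip y) ->
  nrm ip (iterate g n x - x) <= n%:R * D * nrm ip x.
Proof.
move=> D0 Gg hD; elim: n => [|n IH]; first by rewrite iterate0 subrr nrm0// !mul0r.
have -> : iterate g n.+1 x - x = g (iterate g n x - x) + (g x - x).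
  by rewrite iterateS linearB/= addrA subrK.
apply: le_trans (nrmD hip _ _) _; rewrite (iso_nrm H)// -natr1.
by have := hD x; lra.
Qed.

(** Each step adds (g - 1)(g^n x - x), of size at most n D^2 |x|; the total is quadratic in the
    elapsed time n D. *)
Lemma iterate_linear_error g D n x : 0 <= D -> G g ->
  (forall y, nrm ip (g y - y) <= D * nrm ip y) ->
  nrm ip (iterate g n x - x - n%:R *: (g x - x)) <= (n%:R * D) ^+ 2 * nrm ip x.
Proof.
move=> D0 Gg hD; elim: n => [|n IH].
  by rewrite iterate0 subrr scale0r subrr nrm0// mul0r expr0n/= mul0r.
set u := iterate g n x in IH.
have -> : iterate g n.+1 x - x - n.+1%:R *: (g x - x) =
    (g (u - x) - (u - x)) + (u - x - n%:R *: (g x - x)).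
  apply: (ip_eq hip) => y; rewrite iterateS -/u (linearB g) -natr1 !(ipE hip); ring.
apply: le_trans (nrmD hip _ _) _.
have := hD (u - x); have := iterate_sub_le n x D0 Gg hD; rewrite -/u.
have n0 : 0 <= n%:R :> R by [].
have x0 := nrm_ge0 ip x.
move: IH; move: (nrm ip (u - x - _)) (nrm ip (g (u - x) - _)) (nrm ip (u - x)) => A B C0 h1 h2 h3.
have : D * C0 <= D * (n%:R * D * nrm ip x) by rewrite ler_wpM2l.
rewrite -natr1 => h4.
have h5 : 0 <= n%:R * (D * D * nrm ip x) by rewrite mulr_ge0// mulr_ge0// mulr_ge0.
have h6 : 0 <= D * D * nrm ip x by rewrite mulr_ge0// mulr_ge0.
rewrite !expr2 in h1 *; lra.
Qed.

(* The Lie algebra of [G], as the infinitesimal generators of its one-parameter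
   subgroups. *)
Definition lie (X : 'End(V)) := exists phi : R -> 'End(V),
  [/\ forall t, G (phi t), forall s t x, phi (s + t) x = phi s (phi t x) &
   exists2 M, 0 <= M & forall h x, nrm ip (phi h x - x - h *: X x) <= M * h ^+ 2 * nrm ip x].

Section Direction.
Variables (g_ : nat -> 'End(V)) (e : nat -> R) (X : 'End(V)).
Hypotheses (Gg : forall k, G (g_ k)) (e0 : forall k, 0 < e k) (el : ulim e 0)
  (gX : forall x, vlim ip (fun k => (e k)^-1 *: (g_ k x - x)) (X x)).

Lemma direction_bound : exists2 M, 0 <= M &
  uf [set k | forall x, nrm ip (g_ k x - x) <= M * e k * nrm ip x].
Proof.
have [n [b [bo _ bx]]] := orthonormal_basis hip fullv.
exists (\sum_i (nrm ip (X (b i)) + 1)).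
  by apply: sumr_ge0 => i _; rewrite addr_ge0 ?nrm_ge0.
have h i : i \in enum 'I_n ->
    uf [set k | nrm ip ((e k)^-1 *: (g_ k (b i) - b i)) < nrm ip (X (b i)) + 1].
  by move=> _; have := vlim_nrm hip (@gX (b i)); move=> /ulim_lt_near; apply; rewrite ltrDl.
apply: filterS (uf_forall h) => k /= hk x.
rewrite {1 2}(bx x (memvf x)) linear_sum/= -sumrB.
apply: le_trans (nrm_sum _ _ _) _; rewrite !mulr_suml; apply: ler_sum => i _.
rewrite linearZ/= -scalerBr nrmZ// mulrC ler_pM//; first exact: nrm_ge0.
  have := hk i (mem_enum _ _); rewrite nrmZ// gtr0_norm ?invr_gt0// mulrC.
  by rewrite ltr_pdivrMr// => /ltW.
have E : nrm ip (b i) = 1 by rewrite /nrm bo eqxx sqrtr1.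
by have := cauchy_schwarz_abs hip x (b i); rewrite E mulr1.
Qed.

Let nk t k := Num.truncn (t / e k).

Let nk_le t k : 0 <= t -> (nk t k)%:R * e k <= t.
Proof.
move=> t0; have te : 0 <= t / e k by rewrite divr_ge0// ltW.
have /andP[h _] := truncn_itv te.
by rewrite -ler_pdivlMr.
Qed.

Let nk_gt t k : 0 <= t -> t < (nk t k).+1%:R * e k.
Proof.
move=> t0; have te : 0 <= t / e k by rewrite divr_ge0// ltW.
have /andP[_ h] := truncn_itv te.
by rewrite -ltr_pdivrMr.
Qed.

Let nk_lim t : 0 <= t -> ulim (fun k => (nk t k)%:R * e k) t.
Proof.
move=> t0; apply: (@ulim_squeeze _ (fun k => t - e k) _ (fun=> t)).
- apply: nearW => k /=; rewrite nk_le// andbT.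
  by have := nk_gt k t0; rewrite -natr1 mulrDl mul1r => /ltW; lra.
- by rewrite -[X in ulim _ X]subr0; apply: ulimB => //; exact: ulim_cst.
- exact: ulim_cst.
Qed.

(** Integer parts are additive up to one, and one extra factor [g_ k] disappears in the limit. *)
Let nkD s t k : 0 <= s -> 0 <= t ->
  exists b : bool, nk (s + t) k = (nk s k + nk t k + b)%N.
Proof.
move=> s0 t0; have st0 : 0 <= s + t by rewrite addr_ge0.
have := nk_le k s0; have := nk_le k t0; have := nk_le k st0.
have := nk_gt k s0; have := nk_gt k t0; have := nk_gt k st0.
move: (nk (s + t) k) (nk t k) (nk s k) => a b c h1 h2 h3 h4 h5 h6.
have le1 : (c + b <= a)%N.
  rewrite -ltnS -(ltr_nat R) -(ltr_pM2r (e0 k)) natrD mulrDl; lra.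
have le2 : (a < c + b + 2)%N.
  rewrite -(ltr_nat R) -(ltr_pM2r (e0 k)).
  apply: le_lt_trans h4 _; have := ltrD h3 h2; rewrite -mulrDl -natrD.
  by rewrite addSn addnS addn2.
have [E|NE] := eqVneq a (c + b)%N; first by exists false; rewrite addn0.
exists true; apply/eqP; rewrite addn2 in le2.
by rewrite eqn_leq addn1 -ltnS le2 ltn_neqAle eq_sym NE le1.
Qed.

(* The one-parameter group is [phi t = lim (g_ k) ^ (t / e k)]. *)
Lemma lie_of_direction : lie X.
Proof.
have [M M0 hM] := direction_bound.
have /choice[f hf] t : exists f, G f /\ glim ip (fun k => iterate (g_ k) (nk t k)) f.
  have [|f Gf fl] := @iso_ulim _ _ _ _ H (fun k => iterate (g_ k) (nk t k)).
    by move=> k; apply: iso_iterate.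
  by exists f.
have Gf t : G (f t) by case: (hf t).
have fl t := (hf t).2.
have fD s t x : 0 <= s -> 0 <= t -> f (s + t) x = f s (f t x).
  move=> s0 t0; apply/eqP; rewrite -subr_eq0; apply/eqP.
  have l1 : vlim ip (fun k => iterate (g_ k) (nk s k) (iterate (g_ k) (nk t k) x)) (f s (f t x)).
    apply: (glim_app (g_ := fun k => iterate (g_ k) (nk s k)) H).
    - by move=> k; apply: iso_iterate.
    - exact: Gf.
    - exact: fl.
    - exact: fl.
  apply: (vlim_unique hip (vlimB hip (@fl (s + t) x) l1)).
  apply: (@vlim_small_near _ _ _ hip _ (fun k => M * e k * nrm ip x)).
    rewrite -(mul0r (nrm ip x)) -(mulr0 M); apply: ulimM; last exact: ulim_cst.
    by apply: ulimM => //; exact: ulim_cst.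
  apply: filterS hM => k /= hk; have [b ->] := nkD k s0 t0.
  rewrite -addnA iterateD -linearB/= (iso_nrm H) ?iterateD; last exact: iso_iterate.
  rewrite -linearB/= (iso_nrm H); last exact: iso_iterate.
  case: b; rewrite ?iterateS ?iterate0; first exact: hk.
  by rewrite subrr nrm0// mulr_ge0 ?nrm_ge0// mulr_ge0// ltW.
have f1 t x : 0 <= t -> nrm ip (f t x - x) <= t * M * nrm ip x.
  move=> t0; apply: (ulim_le (vlim_nrm hip (vlimB hip (@fl t x) (vlim_cst ip x))) (ulim_cst _)).
  apply: filterS hM => k /= hk; have Me : 0 <= M * e k by rewrite mulr_ge0// ltW.
  apply: le_trans (iterate_sub_le _ _ Me (Gg k) hk) _; rewrite ler_wpM2r ?nrm_ge0//.
  by rewrite mulrCA mulrC ler_wpM2r// nk_le.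
have f2 t x : 0 <= t -> nrm ip (f t x - x - t *: X x) <= t ^+ 2 * M ^+ 2 * nrm ip x.
  move=> t0; have l1 : vlim ip (fun k => iterate (g_ k) (nk t k) x - x -
      ((nk t k)%:R * e k) *: ((e k)^-1 *: (g_ k x - x))) (f t x - x - t *: X x).
    apply: (vlimB hip); first by apply: (vlimB hip); [exact: fl|exact: vlim_cst].
    by apply: (vlimZ hip); [exact: nk_lim|exact: gX].
  apply: (ulim_le (vlim_nrm hip l1) (ulim_cst _)).
  apply: filterS hM => k /= hk; have Me : 0 <= M * e k by rewrite mulr_ge0// ltW.
  rewrite scalerA -mulrA mulfV ?mulr1 ?gt_eqF//.
  apply: le_trans (iterate_linear_error _ _ Me (Gg k) hk) _; rewrite ler_wpM2r ?nrm_ge0//.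
  rewrite -exprMn ler_pXn2r ?nnegrE ?mulr_ge0 ?(ltW (e0 k))//.
  by rewrite mulrCA mulrC ler_wpM2r// nk_le.
have X1 v : nrm ip (X v) <= M * nrm ip v.
  apply: (ulim_le (vlim_nrm hip (@gX v)) (ulim_cst _)).
  apply: filterS hM => k /= hk; rewrite nrmZ// gtr0_norm ?invr_gt0//.
  by rewrite ler_pdivrMl// mulrA [e k * _]mulrC.
have fC s t x : 0 <= s -> 0 <= t -> f s (f t x) = f t (f s x).
  by move=> s0 t0; rewrite -!fD// addrC.
pose phi t := if 0 <= t then f t else ((f (- t))^-1)%VF.
exists phi; split.
- by move=> t; rewrite /phi; case: ifP => _ //; apply: (iso_inv H).
- move=> s t x; rewrite /phi.
  have neg (u : R) : u < 0 -> 0 <= - u by move=> u0; rewrite lerNr oppr0 ltW.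
  case: (leP 0 s) => s0; case: (leP 0 t) => t0.
  + by rewrite addr_ge0// fD.
  + have [y ->] : exists y, x = f (- t) y by exists ((f (- t))^-1%VF x); rewrite (iso_Kinv H).
    have nt := neg t t0; rewrite (iso_invK H)//; case: leP => st.
      by rewrite -fD// addrK.
    have {1}-> : - t = - (s + t) + s by rewrite opprD addrAC addNr add0r.
    have nst := neg _ st; by rewrite fD// (iso_invK H).
  + have ns := neg s s0; case: leP => st.
      have -> : f t x = f (- s) (f (s + t) x) by rewrite -fD// addKr.
      by rewrite (iso_invK H).
    have nst := neg _ st.
    have [y ->] : exists y, x = f (- (s + t)) y.
      by exists ((f (- (s + t)))^-1%VF x); rewrite (iso_Kinv H).
    rewrite (iso_invK H)// -fD//.
    have -> : t + - (s + t) = - s by rewrite opprD addrCA subrr addr0.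
    by rewrite (iso_invK H).
  + have st : s + t < 0 by rewrite -(addr0 0) ltrD.
    have ns := neg s s0; have nt := neg t t0.
    rewrite leNgt st /= opprD.
    have [y ->] : exists y, x = f (- s - t) y.
      by exists ((f (- s - t))^-1%VF x); rewrite (iso_Kinv H).
    by rewrite (iso_invK H)// addrC fD// !(iso_invK H).
(* One M^2 is the error [f2] at positive times; at negative times, replacing f (- h) (X x) by X x
   costs a second one. *)
exists (2 * M ^+ 2); first by rewrite mulr_ge0// sqr_ge0.
move=> h x; rewrite /phi; have M2 : 0 <= M ^+ 2 by exact: sqr_ge0.
have n0 := nrm_ge0 ip x.
have h2 : 0 <= h ^+ 2 * M ^+ 2 * nrm ip x by apply: mulr_ge0 => //; apply: mulr_ge0 => //; exact: sqr_ge0.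
case: (leP 0 h) => h0.
  by apply: le_trans (f2 h x h0) _; lra.
have h0' : 0 <= - h by rewrite oppr_ge0 ltW.
rewrite -(iso_nrm H _ (Gf (- h))) !linearB/= (iso_Kinv H)// linearZ/=.
have -> : x - f (- h) x - h *: f (- h) (X x) =
   - (f (- h) x - x - (- h) *: X x) + (- h) *: (f (- h) (X x) - X x).
  by apply: (ip_eq hip) => y; rewrite !(ipE hip); ring.
apply: le_trans (nrmD hip _ _) _; rewrite nrmN// nrmZ// ger0_norm//.
have := f2 _ x h0'; rewrite sqrrN => a1; have a2 := f1 _ (X x) h0'.
have a3 : - h * nrm ip (f (- h) (X x) - X x) <= - h * (- h * M * (M * nrm ip x)).
  rewrite ler_wpM2l//; apply: le_trans a2 _; rewrite ler_wpM2l ?mulr_ge0//; exact: X1.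
have -> : 2 * M ^+ 2 * h ^+ 2 * nrm ip x =
   h ^+ 2 * M ^+ 2 * nrm ip x + - h * (- h * M * (M * nrm ip x)) by ring.
by rewrite lerD.
Qed.

End Direction.
End Cartan.

(** * Orbit curves and the Lie algebra of the group *)

Section Curve.
Variables (R : realType) (V : vectType R) (ip : V -> V -> R).
Hypothesis hip : inner ip.
Local Notation rV := (passmx.rVof (vbasis (fullv : {vspace V}))).

Lemma curve_derivable (c : R -> V) t w K : 0 <= K ->
  (forall h, nrm ip (c (h + t) - c t - h *: w) <= K * h ^+ 2) ->
  (fun h : R => h^-1 *: (((rV \o c) \o shift t) (h *: 1) - (rV \o c) t)) @ 0^' --> rV w.
Proof.
move=> K0 hc; pose e := vbasis (fullv : {vspace V}).
have rVE v : rV v = \sum_i coord e i v *: delta_mx 0 i.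
  rewrite {1}[rV v]row_sum_delta; apply: eq_bigr => i _; by rewrite mxE.
rewrite rVE.
have -> : (fun h : R => h^-1 *: (((rV \o c) \o shift t) (h *: 1) - (rV \o c) t)) =
    fun h => \sum_i (h^-1 * (coord e i (c (h + t)) - coord e i (c t))) *: delta_mx 0 i.
  apply/funext => h; rewrite /= /shift/= [_%:A]mulr1 !rVE -sumrB scaler_sumr.
  by apply: eq_bigr => i _; rewrite -scalerBl scalerA.
apply: cvg_sum => i _; apply: cvgZr_tmp.
have [|M M0 hM] := @functional_bounded _ _ _ hip (coord e i).
  by move=> a x y; rewrite linearP.
apply/cvgrPdist_lt => eps eps0.
have MK : 0 < M * K + 1 by rewrite ltr_wpDl// mulr_ge0.
near=> h.
have h0 : h != 0 by near: h; exact: nbhs_dnbhs_neq.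
have hs : `|h| < eps / (M * K + 1) by near: h; apply: dnbhs0_lt; rewrite divr_gt0.
have nh : 0 < `|h| by rewrite normr_gt0.
rewrite distrC.
have -> : h^-1 * (coord e i (c (h + t)) - coord e i (c t)) - coord e i w =
   h^-1 * coord e i (c (h + t) - c t - h *: w).
  by rewrite !linearB/= linearZ/=; field.
rewrite normrM normfV ltr_pdivrMl//.
apply: le_lt_trans (hM _) _.
have a1 : M * nrm ip (c (h + t) - c t - h *: w) <= M * (K * h ^+ 2) by rewrite ler_wpM2l.
apply: le_lt_trans a1 _; rewrite -real_normK ?num_real//.
rewrite ltr_pdivlMr// in hs.
have a2 : `|h| * (`|h| * (M * K + 1)) < `|h| * eps by rewrite ltr_pM2l.
have a3 : 0 <= `|h| * `|h| by rewrite mulr_ge0.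
apply: le_lt_trans a2; rewrite expr2; lra.
Unshelve. all: by end_near. Qed.

Lemma eq0_of_le_sqr (x K : R) : (forall h, 0 < h -> `|x| * h <= K * h ^+ 2) -> x = 0.
Proof.
move=> h; apply/eqP; rewrite -normr_eq0 eq_le normr_ge0 andbT.
have [K0|K0] := leP K 0.
  by have := h 1 ltr01; rewrite expr1n; lra.
rewrite leNgt; apply/negP => x0.
have t0 : 0 < `|x| / (2 * K) by rewrite divr_gt0// mulr_gt0.
have := h _ t0; rewrite expr2 [leRHS]mulrA ler_pM2r//.
have -> : K * (`|x| / (2 * K)) = `|x| / 2 by field; rewrite gt_eqF.
lra.
Qed.

End Curve.

Section LieAlgebra.
Variables (R : realType) (V : vectType R) (ip : V -> V -> R) (G : set 'End(V)).
Hypothesis H : isometry_group ip G.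
Let hip := iso_inner H.
Local Notation rV := (passmx.rVof (vbasis (fullv : {vspace V}))).
Local Notation lie := (lie ip G).

Definition one_parameter (phi : R -> 'End(V)) (X : 'End(V)) M :=
  [/\ forall t, G (phi t), forall s t x, phi (s + t) x = phi s (phi t x), 0 <= M
    & forall h x, nrm ip (phi h x - x - h *: X x) <= M * h ^+ 2 * nrm ip x].

Lemma lieP X : lie X <-> exists phi M, one_parameter phi X M.
Proof.
split=> [[phi [Gp hp [M M0 hM]]]|[phi [M [Gp hp M0 hM]]]].
  by exists phi, M; split.
by exists phi; split => //; exists M.
Qed.

Lemma one_parameter0 phi X M x : one_parameter phi X M -> phi 0 x = x.
Proof.
move=> [Gp hp _ _]; have := hp 0 0 x; rewrite addr0 => E.
by rewrite -[LHS](iso_invK H _ (Gp 0)) -E (iso_invK H).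
Qed.

(** The one-parameter group provides the curve to which (B) applies; isometry and the group law
    carry the estimate at time 0 to every time. *)
Lemma lie_tangent X u : lie X -> tangent_space (orbit G u) u (X u).
Proof.
move=> /lieP[phi [M op]]; have [Gp hp M0 hM] := op.
have cv t : (fun h : R => h^-1 *: (((rV \o (phi^~ u)) \o shift t) (h *: 1) -
    (rV \o (phi^~ u)) t)) @ 0^' --> rV (phi t (X u)).
  apply: (@curve_derivable _ _ _ hip _ _ _ (M * nrm ip u)) => [|h].
    by rewrite mulr_ge0 ?nrm_ge0.
  rewrite [h + t]addrC hp -linearZ/= -!linearB/= (iso_nrm H)//.
  by apply: le_trans (hM h u) _; rewrite mulrAC.
exists (fun t => phi t u); split.
- exact: (one_parameter0 _ op).
- by move=> t; exists (phi t).
- by move=> t; apply/cvg_ex; exists (rV (phi t (X u))); exact: cv.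
- by rewrite -(one_parameter0 (X u) op); apply: cvg_lim; [exact: norm_hausdorff|exact: cv].
Qed.

(** Cut into n steps, each moves [z] by at most M (t / n)^2 |z|, so the total is O(1 / n). *)
Lemma lie_fix phi X M z t : one_parameter phi X M -> X z = 0 -> phi t z = z.
Proof.
move=> op Xz; have [Gp hp M0 hM] := op.
have step s : nrm ip (phi s z - z) <= M * s ^+ 2 * nrm ip z.
  by have := hM s z; rewrite Xz scaler0 subr0.
have iter_ n s : nrm ip (phi (n%:R * s) z - z) <= n%:R * nrm ip (phi s z - z).
  elim: n => [|n IH]; first by rewrite !mul0r (one_parameter0 _ op) subrr nrm0.
  rewrite -natr1 !mulrDl !mul1r hp.
  have -> : phi (n%:R * s) (phi s z) - z = phi (n%:R * s) (phi s z - z) + (phi (n%:R * s) z - z).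
    by rewrite linearB/= addrA subrK.
  by apply: le_trans (nrmD hip _ _) _; rewrite (iso_nrm H)//; lra.
apply/eqP; rewrite -subr_eq0 -(nrm_eq0 hip) eq_le nrm_ge0 andbT.
have lim0 : ulim (fun k => k.+1%:R^-1 * (M * t ^+ 2 * nrm ip z)) 0.
  rewrite -(mul0r (M * t ^+ 2 * nrm ip z)); apply: ulimM; last exact: ulim_cst.
  exact: ulim_harmonic.
apply: (ulim_lew (ulim_cst _) lim0) => k.
have k0 : k.+1%:R != 0 :> R by rewrite pnatr_eq0.
have := iter_ k.+1 (t / k.+1%:R); rewrite mulrC divfK// => /le_trans; apply.
have := step (t / k.+1%:R) => h.
have : k.+1%:R * nrm ip (phi (t / k.+1%:R) z - z) <= k.+1%:R * (M * (t / k.+1%:R) ^+ 2 * nrm ip z).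
  by rewrite ler_wpM2l.
move=> /le_trans; apply; rewrite le_eqVlt; apply/orP; left; apply/eqP.
by field.
Qed.

Lemma lieZ c X : lie X -> lie (c *: X).
Proof.
move=> /lieP[phi [M [Gp hp M0 hM]]]; apply/lieP; exists (fun t => phi (c * t)), (M * c ^+ 2).
split.
- by move=> t; apply: Gp.
- by move=> s t x; rewrite mulrDr hp.
- by rewrite mulr_ge0// sqr_ge0.
- move=> h x; rewrite scale_lfunE scalerA [h * c]mulrC.
  by apply: le_trans (hM _ _) _; rewrite exprMn mulrA.
Qed.

Lemma lie_zero : lie 0.
Proof.
apply/lieP; exists (fun=> \1%VF), 0; split => //.
- by move=> t; exact: (iso_id H).
- by move=> s t x; rewrite !id_lfunE.
- by move=> h x; rewrite id_lfunE zero_lfunE scaler0 subr0 subrr nrm0// !mul0r.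
Qed.

Lemma lie_conj g X : G g -> lie X -> lie (g \o X \o g^-1)%VF.
Proof.
move=> Gg /lieP[phi [M [Gp hp M0 hM]]]; have GVg := iso_inv H Gg.
apply/lieP; exists (fun t => g \o phi t \o g^-1)%VF, M; split => //.
- by move=> t; apply: (iso_comp H) => //; apply: (iso_comp H).
- by move=> s t x; rewrite !comp_lfunE hp (iso_invK H).
- move=> h x; rewrite !comp_lfunE -{2}(iso_Kinv H x Gg) -linearZ/= -!linearB/= (iso_nrm H)//.
  by rewrite -(iso_nrm H x GVg); apply: hM.
Qed.

Lemma one_parameter_lim phi X M x : one_parameter phi X M ->
  vlim ip (fun k => k.+1%:R *: (phi k.+1%:R^-1 x - x)) (X x).
Proof.
move=> [Gp hp M0 hM].
have l0 : ulim (fun k => k.+1%:R^-1 * (M * nrm ip x)) 0.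
  rewrite -(mul0r (M * nrm ip x)); apply: ulimM; [exact: ulim_harmonic|exact: ulim_cst].
have := vlimD hip (vlim_small hip l0 _) (vlim_cst ip (X x)).
move=> /(_ (fun k => k.+1%:R *: (phi k.+1%:R^-1 x - x) - X x)).
rewrite add0r => h; apply: vlim_ext (h _); first by move=> k /=; rewrite subrK.
move=> k; have k0 : 0 < k.+1%:R :> R by [].
have -> : k.+1%:R *: (phi k.+1%:R^-1 x - x) - X x =
   k.+1%:R *: (phi k.+1%:R^-1 x - x - k.+1%:R^-1 *: X x).
  by rewrite [RHS]scalerBr scalerA mulfV ?scale1r// gt_eqF.
rewrite nrmZ// gtr0_norm//.
have h1 : k.+1%:R * nrm ip (phi k.+1%:R^-1 x - x - k.+1%:R^-1 *: X x) <=
   k.+1%:R * (M * k.+1%:R^-1 ^+ 2 * nrm ip x) by rewrite ler_wpM2l.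
apply: le_trans h1 _; rewrite le_eqVlt; apply/orP; left; apply/eqP; field.
by rewrite gt_eqF.
Qed.

(** The products of the two flows at time 1 / (k + 1) have difference quotients tending to X + Y,
    which [lie_of_direction] integrates. *)
Lemma lieD X Y : lie X -> lie Y -> lie (X + Y).
Proof.
move=> /lieP[phi [M opX]] /lieP[psi [K opY]].
have [GpX _ _ _] := opX; have [GpY _ _ _] := opY.
pose s (k : nat) : R := k.+1%:R^-1.
apply: (lie_of_direction (g_ := fun k => (phi (s k) \o psi (s k))%VF) (e := s) H).
- by move=> k; apply: (iso_comp H).
- by move=> k; rewrite /s invr_gt0.
- exact: ulim_harmonic.
move=> x; rewrite add_lfunE.
have id_lim : glim ip (fun k => phi k.+1%:R^-1) \1%VF.
  move=> y; rewrite id_lfunE.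
  have := vlimD hip (vlimZ hip ulim_harmonic (one_parameter_lim (x := y) opX)) (vlim_cst ip y).
  rewrite scale0r add0r; apply: vlim_ext => k /=.
  by rewrite scalerA mulVf ?scale1r ?subrK// pnatr_eq0.
have l2 := glim_app H (fun k => GpX k.+1%:R^-1) (iso_id H) id_lim (one_parameter_lim (x := x) opY).
rewrite id_lfunE in l2.
apply: vlim_ext (vlimD hip (one_parameter_lim (x := x) opX) l2) => k.
rewrite /s invrK comp_lfunE linearZ/= -scalerDr; congr (_ *: _).
by rewrite linearB/= addrC addrA subrK.
Qed.

Lemma lie_space : exists L : {vspace 'End(V)}, forall X, X \in L <-> lie X.
Proof.
apply: subspace_of; first exact: lie_zero.
by move=> c X Y hX hY; apply: lieD => //; apply: lieZ.
Qed.

(** The normal space of the orbit at [z], taken with respect to generators because these form a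
    vector space, carried along by conjugation in [G]. *)
Definition normal_space z w := forall X, lie X -> ip (X z) w = 0.

Lemma normal_spaceG g z w : G g -> normal_space z w -> normal_space (g z) (g w).
Proof.
move=> Gg Nw X lX; have := Nw _ (lie_conj (iso_inv H Gg) lX).
have GVg := iso_inv H Gg; rewrite !comp_lfunE (iso_adj H)//.
have gVV x : ((g^-1)^-1)%VF x = g x.
  by rewrite -{1}(iso_invK H x Gg) (iso_invK H (g x) (iso_inv H Gg)).
by rewrite !gVV.
Qed.

Lemma normal_vspace : exists N : V -> {vspace V}, forall z w, w \in N z <-> normal_space z w.
Proof.
have h z : exists N : {vspace V}, forall w, w \in N <-> normal_space z w.
  apply: subspace_of; first by move=> X _; rewrite (ip0r hip).
  by move=> c x y hx hy X lX; rewrite (ipDr hip) (ipZr hip) hx// hy// mulr0 addr0.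
by have [N hN] := choice h; exists N.
Qed.

End LieAlgebra.

(** * General position and minimal normal spaces *)

Section Perpendicular.
Variables (R : realType) (V : vectType R) (ip : V -> V -> R).
Hypothesis hip : inner ip.

(* In coordinates, a value [t k] violating the conclusion makes [- (t k)^-1] an
   eigenvalue of a fixed matrix. *)
Lemma generic_perp (I : finType) (p q : I -> V) (b : {vspace V}) (t : nat -> R) :
  injective t -> (forall k, t k != 0) ->
  (forall w, w \in b -> (forall i, ip (p i) w = 0) -> w = 0) ->
  forall K, exists2 k, (K <= k)%N &
    forall w, w \in b -> (forall i, ip (p i + t k *: q i) w = 0) -> w = 0.
Proof.
move=> tinj t0 hp K; have [d [f [fo fb fx]]] := orthonormal_basis hip b.
pose M (r : I -> V) : 'M[R]_(d, #|I|) := \matrix_(j, i) ip (r (enum_val i)) (f j).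
have cM (c : 'rV[R]_d) r i : (c *m M r) 0 (enum_rank i) = ip (r i) (\sum_j c 0 j *: f j).
  rewrite mxE (ip_sumr hip); apply: eq_bigr => j _.
  by rewrite mxE (ipZr hip) enum_rankK.
have fb' (c : 'rV[R]_d) : \sum_j c 0 j *: f j \in b.
  by apply: rpred_sum => j _; rewrite rpredZ.
have fc (c : 'rV[R]_d) j : ip (\sum_j c 0 j *: f j) (f j) = c 0 j.
  rewrite (ip_suml hip) (bigD1 j)//= (ipZl hip) fo eqxx mulr1 big1 ?addr0// => l lj.
  by rewrite (ipZl hip) fo (negbTE lj) mulr0.
have free0 : row_free (M p).
  apply: inj_row_free => c cM0; apply/rowP => j; rewrite mxE -fc.
  rewrite (hp _ (fb' c)) ?(ip0l hip)// => i.
  by rewrite -cM cM0 mxE.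
have [B MB] := row_freeP free0.
pose A := M q *m B.
apply: contrapT => bad.
have eig k : (K <= k)%N -> root (char_poly A) (- (t k)^-1).
  move=> Kk; rewrite -eigenvalue_root_char; apply/eigenvalueP.
  have [w [wb hw w0]] : exists w, [/\ w \in b,
      forall i, ip (p i + t k *: q i) w = 0 & w != 0].
    apply: contrapT => nw; apply: bad; exists k => // w wb hw.
    by apply/eqP/negPn/negP => w0; apply: nw; exists w.
  pose c : 'rV[R]_d := \row_j ip w (f j).
  have wE : \sum_j c 0 j *: f j = w.
    by rewrite [RHS](fx w wb); apply: eq_bigr => j _; rewrite mxE.
  exists c; last first.
    apply: contraNneq w0 => c0; rewrite -wE big1// => j _.
    by rewrite c0 mxE scale0r.
  have E : c *m M q = - (t k)^-1 *: (c *m M p).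
    apply/rowP => i; rewrite -(enum_valK i) [RHS]mxE !cM wE.
    have := hw (enum_val i); rewrite (ipDl hip) (ipZl hip) => /eqP.
    rewrite addr_eq0 => /eqP ->; rewrite mulrNN mulrA mulVf ?mul1r//.
  by rewrite /A mulmxA E -scalemxAl -mulmxA MB mulmx1.
pose ts := [seq - (t k)^-1 | k <- iota K d.+1].
have := @max_poly_roots _ (char_poly A) ts.
rewrite size_char_poly size_map size_iota ltnn => h; suff : false by [].
apply: h.
- by rewrite -size_poly_eq0 size_char_poly.
- by apply/allP => _ /mapP[k + ->]; rewrite mem_iota => /andP[+ _]; exact: eig.
- rewrite map_inj_uniq ?iota_uniq// => k l /oppr_inj/invr_inj; exact: tinj.
Qed.

Lemma perp_space (N : {vspace V}) : exists b : {vspace V},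
  [/\ forall x, x \in b <-> (forall w, w \in N -> ip x w = 0),
      (\dim N + \dim b = \dim {: V})%N & (N :&: b)%VS = 0%VS].
Proof.
have [b hb] : exists b : {vspace V}, forall x, x \in b <-> (forall w, w \in N -> ip x w = 0).
  apply: subspace_of; first by move=> w _; rewrite (ip0l hip).
  by move=> c x y hx hy w wN; rewrite (ipDl hip) (ipZl hip) hx// hy// mulr0 addr0.
have Nb : (N :&: b)%VS = 0%VS.
  apply/eqP; rewrite -subv0; apply/subvP => x; rewrite memv_cap => /andP[xN /hb/(_ x xN)/eqP].
  by rewrite (ip_eq0 hip) memv0.
exists b; split => //; rewrite -dimv_disjoint_sum//; congr (\dim _).
apply/eqP; rewrite eqEsubv subvf/=; apply/subvP => x _.
have [u uN hu] := orth_proj hip N x.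
rewrite -(subrK u x) addrC; apply: memv_add => //; exact/hb.
Qed.

(** A polynomial in 1 / (k + 1) tends to its constant term, which is therefore 0; divide by the
    variable and repeat. *)
Lemma ulim_powers_zero n (c : 'I_n -> R) :
  uf [set k | \sum_i c i * (k.+1%:R^-1) ^+ i = 0] -> forall i, c i = 0.
Proof.
elim: n c => [|n IH] c hc; first by case.
have c0 : c ord0 = 0.
  have h : ulim (fun k => \sum_i c i * (k.+1%:R^-1) ^+ i) (\sum_i c i * 0 ^+ i).
    by apply: ulim_sum => i _; apply: ulimM; [exact: ulim_cst|exact: ulimX ulim_harmonic].
  have := ulim_unique h (ulim_eq _ (ulim_cst 0)) => E.
  rewrite -[LHS]mulr1 -(expr0 0); apply: etrans (E _).
    rewrite big_ord_recl/= big1 ?addr0// => i _.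
    by rewrite exprS mul0r mulr0.
  by apply: filterS hc => k /= ->.
move=> i; case: (unliftP ord0 i) => [j ->|->//].
apply: (IH (fun j => c (lift ord0 j))); apply: filterS hc => k /=.
rewrite big_ord_recl c0 mul0r add0r => E.
have k0 : k.+1%:R^-1 != 0 :> R by rewrite invr_eq0 pnatr_eq0.
apply: (mulfI k0); rewrite mulr0 -[RHS]E mulr_sumr; apply: eq_bigr => l _.
by rewrite mulrCA -exprS.
Qed.

Lemma endo_vlim_bounded (X_ : nat -> 'End(V)) :
  (forall x, exists M, forall k, nrm ip (X_ k x) <= M) ->
  exists X : 'End(V), forall x, vlim ip (fun k => X_ k x) (X x).
Proof.
move=> h; have {}h x : exists l, vlim ip (fun k => X_ k x) l.
  by have [M hM] := h x; apply: (vlim_bounded hip hM).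
have [f hf] := choice h.
have fl : linear f.
  move=> c x y; apply: (vlim_unique hip (hf _)).
  apply: vlim_ext (vlimD hip (vlimZ hip (ulim_cst c) (hf x)) (hf y)) => k.
  by rewrite linearP.
pose fL : {linear V -> V} := HB.pack f (GRing.isLinear.Build _ _ _ _ f fl).
by exists (linfun fL) => x; rewrite lfunE.
Qed.

End Perpendicular.

Section NormalSpaces.
Variables (R : realType) (V : vectType R) (ip : V -> V -> R) (G : set 'End(V)).
Hypothesis H : isometry_group ip G.
Let hip := iso_inner H.
Local Notation lie := (lie ip G).
Variable N : V -> {vspace V}.
Hypothesis hN : forall z w, w \in N z <-> normal_space ip G z w.

Lemma normal_vspaceG g z w : G g -> w \in N z -> g w \in N (g z).
Proof. by move=> Gg /hN h; apply/hN; apply: (normal_spaceG H). Qed.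

Lemma dim_normal_vspace g z : G g -> \dim (N (g z)) = \dim (N z).
Proof.
move=> Gg; have -> : N (g z) = (g @: N z)%VS.
  apply/eqP; rewrite eqEsubv; apply/andP; split; apply/subvP.
    move=> w wN; apply/memv_imgP; exists ((g^-1)%VF w); last by rewrite (iso_Kinv H).
    by have := normal_vspaceG (iso_inv H Gg) wN; rewrite (iso_invK H).
  by move=> _ /memv_imgP[w wN ->]; apply: normal_vspaceG.
apply: limg_dim_eq; have [_ _ h] := iso_linear H; have [/eqP -> _] := h g Gg.
by rewrite capv0.
Qed.

Lemma lie_basis : exists (n : nat) (Y : 'I_n -> 'End(V)), (forall i, lie (Y i)) /\
  forall z w, (forall i, ip (Y i z) w = 0) -> w \in N z.
Proof.
have [L hL] := lie_space H.
exists (\dim L), (fun i => (vbasis L)`_i); split.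
  move=> i; apply/hL; apply: vbasis_mem; apply: mem_nth; by rewrite size_tuple.
move=> z w h; apply/hN => X /hL XL.
rewrite (coord_vbasis XL) sum_lfunE (ip_suml hip) big1// => i _.
by rewrite scale_lfunE (ipZl hip) h mulr0.
Qed.

(* If [e = X y] were nonzero, then, as [X (z + t y) = t e], the normal space at
   [z + t y] would for suitable [t] be smaller than that at [z]. *)
Lemma minimal_normal_fixed z X y : (forall v, (\dim (N z) <= \dim (N v))%N) ->
  lie X -> X z = 0 -> y \in N z -> X y = 0.
Proof.
move=> zmin lX Xz yN; pose e := X y.
have [phi [M op]] := (lieP ip G X).1 lX; have [Gp hp M0 hM] := op.
(* The flow of [X] fixes [z], so it preserves [N z]; hence the velocity of [y] lies in [N z]. *)
have eN : e \in N z.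
  apply/hN => Y lY; rewrite (ipC hip).
  apply: (@eq0_of_le_sqr _ _ (M * nrm ip y * nrm ip (Y z))) => h h0.
  have pyN : phi h y \in N z.
    by have := normal_vspaceG (Gp h) yN; rewrite (lie_fix H h op Xz).
  have := cauchy_schwarz_abs hip (phi h y - y - h *: X y) (Y z).
  rewrite !(ipBl hip) (ipC hip (phi h y)) ((hN _ _).1 pyN)// (ipC hip y) ((hN _ _).1 yN)//.
  rewrite subrr sub0r normrN (ipZl hip) normrM (gtr0_norm h0) [h * _]mulrC => /le_trans; apply.
  rewrite -/e; have := hM h y => a1.
  have := nrm_ge0 ip (Y z) => a2.
  apply: le_trans (ler_wpM2r a2 a1) _.
  by rewrite le_eqVlt; apply/orP; left; apply/eqP; ring.
apply/eqP/negPn/negP; rewrite -/e => e0.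
have [b [hb dimb Nb]] := perp_space hip (N z).
have [n [Y [lY hY]]] := lie_basis.
(* The index [None] records that normals at z + t y are orthogonal to [e], a condition that does not
   vary with t. *)
pose p (i : option 'I_n) := if i is Some j then Y j z else e.
pose q (i : option 'I_n) := if i is Some j then Y j y else 0.
have be : (b :&: <[e]>)%VS = 0%VS.
  apply/eqP; rewrite -subv0 -Nb capvC; apply: capvS => //; by rewrite -memvE.
have inj : injective (fun k => k.+1%:R : R) by move=> k l /eqP; rewrite eqr_nat => /eqP[].
have nz k : k.+1%:R != 0 :> R by rewrite pnatr_eq0.
have good0 w : w \in (b + <[e]>)%VS -> (forall i, ip (p i) w = 0) -> w = 0.
  move=> /memv_addP[u ub [_ /vlineP[c ->] ->]] hw.
  have wN : u + c *: e \in N z by apply: hY => i; exact: (hw (Some i)).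
  have uN : u \in N z by rewrite -(addrK (c *: e) u) rpredB ?rpredZ.
  have u0 : u = 0 by apply/eqP; rewrite -memv0 -Nb memv_cap uN ub.
  have := hw None; rewrite /= u0 add0r (ipZr hip) => /eqP.
  by rewrite mulf_eq0 (ip_eq0 hip) (negbTE e0) orbF => /eqP ->; rewrite scale0r.
have [k _ hk] := generic_perp hip q inj nz good0 0.
pose v := z + k.+1%:R *: y.
have Nv : (N v :&: (b + <[e]>))%VS = 0%VS.
  apply/eqP; rewrite -subv0; apply/subvP => w; rewrite memv_cap => /andP[/hN wN wb].
  rewrite memv0; apply/eqP; apply: hk wb _ => -[j|].
    by have := wN _ (lY j); rewrite /v linearD/= linearZ.
  have := wN _ lX; rewrite /v linearD/= linearZ/= Xz add0r (ipZl hip) => /eqP.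
  by rewrite mulf_eq0 (negbTE (nz k))/= scaler0 addr0 => /eqP.
(* [N v] meets a space of dimension dim b + 1 only in 0, so it is smaller than [N z]. *)
have := dimvS (subvf (N v + (b + <[e]>))%VS).
rewrite dimv_disjoint_sum// dimv_disjoint_sum// -dimb dim_vline e0 addnA addn1.
by rewrite ltnNge leq_add2r zmin.
Qed.

End NormalSpaces.

(** * Regular points of a Cartan subspace *)

Section RegularPoints.
Variables (R : realType) (V : vectType R) (ip : V -> V -> R) (G : set 'End(V)).
Hypothesis H : isometry_group ip G.
Let hip := iso_inner H.
Local Notation lie := (lie ip G).
Variable N : V -> {vspace V}.
Hypothesis hN : forall z w, w \in N z <-> normal_space ip G z w.
Variable a : {vspace V}.
Hypothesis hA : cartan_subspace ip G a.

Lemma cartan_normal z w : z \in a -> w \in a -> w \in N z.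
Proof.
move=> za wa; apply/hN => X lX.
by have [_ h] := hA; apply: (h z za _ (lie_tangent H z lX)).
Qed.

Section Defect.
Variables (n : nat) (e : 'I_n -> V).
Hypotheses (eo : orthonormal_family ip e)
  (ex : forall x, x \in (fullv : {vspace V}) -> x = \sum_i ip x (e i) *: e i).

Let e1 i : nrm ip (e i) = 1.
Proof. by rewrite /nrm eo eqxx sqrtr1. Qed.

Lemma endo_nrm_le (A : 'End(V)) y : nrm ip (A y) <= (\sum_i nrm ip (A (e i))) * nrm ip y.
Proof.
rewrite {1}(ex (memvf y)) linear_sum/=; apply: le_trans (nrm_sum H _ _ _) _.
rewrite mulr_suml; apply: ler_sum => i _; rewrite linearZ/= nrmZ// mulrC.
rewrite ler_wpM2l ?nrm_ge0//.
by have := cauchy_schwarz_abs hip y (e i); rewrite e1 mulr1.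
Qed.

(** The squared Hilbert-Schmidt distance from the identity. *)
Definition defect (f : 'End(V)) := \sum_i ip (f (e i) - e i) (f (e i) - e i).

Lemma defect_ge0 f : 0 <= defect f.
Proof. by apply: sumr_ge0 => i _; apply: (ip_ge0 hip). Qed.

Lemma defect_bound (f : 'End(V)) x : nrm ip (f x - x) <= n%:R * Num.sqrt (defect f) * nrm ip x.
Proof.
have := endo_nrm_le (f - \1%VF) x; rewrite add_lfunE opp_lfunE id_lfunE => /le_trans; apply.
rewrite ler_wpM2r ?nrm_ge0//.
apply: le_trans (_ : \sum_(i < n) Num.sqrt (defect f) <= _); last first.
  by rewrite sumr_const card_ord mulr_natl.
apply: ler_sum => i _; rewrite add_lfunE opp_lfunE id_lfunE /nrm ler_sqrt ?defect_ge0//.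
rewrite /defect (bigD1 i)//= lerDl; apply: sumr_ge0 => j _; exact: (ip_ge0 hip).
Qed.

Lemma defect_le (f : 'End(V)) r : 0 <= r ->
  (forall x, nrm ip (f x - x) <= r * nrm ip x) ->
  defect f <= n%:R * r ^+ 2.
Proof.
move=> r0 h; apply: le_trans (_ : \sum_(i < n) r ^+ 2 <= _); last first.
  by rewrite sumr_const card_ord mulr_natl.
apply: ler_sum => i _; rewrite -nrm_sq// ler_pXn2r ?nnegrE ?nrm_ge0//.
by have := h (e i); rewrite e1 mulr1.
Qed.

Lemma defect_lim g_ g : glim ip g_ g -> ulim (fun k => defect (g_ k)) (defect g).
Proof.
move=> gl; apply: ulim_sum => i _.
by apply: (vlim_ip hip); apply: (vlimB hip); try exact: vlim_cst; exact: gl.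
Qed.

End Defect.

(* The isometries [m k] bringing [u k] into [a] are chosen closest to the identity
   modulo the pointwise stabiliser of the normal space at [z]. If they are not
   eventually trivial, their direction [X] of convergence kills this normal space,
   and composing [m k] with the one-parameter group of [X] brings them closer. *)
Lemma regular_exists : exists2 z, z \in a & (N z <= a)%VS.
Proof.
have [n [e [eo _ ex]]] := orthonormal_basis hip fullv.
pose D := defect e.
have [z0 z0min] : exists z0, forall v, (\dim (N z0) <= \dim (N v))%N.
  pose Q m := `[< exists z, \dim (N z) = m >].
  have Q0 : exists m, Q m by exists (\dim (N 0)); apply/asboolP; exists 0.
  case: (ex_minnP Q0) => m /asboolP[z <-] hm.
  by exists z => v; apply: hm; apply/asboolP; exists v.
pose s (k : nat) : R := k.+1%:R^-1.
have s0 k : s k != 0 by rewrite /s invr_eq0 pnatr_eq0.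
have sl : ulim s 0 := ulim_harmonic.
pose d := \dim (N z0); pose f (i : 'I_d) := (vbasis (N z0))`_i.
have fN i : f i \in N z0 by apply: vbasis_mem; apply: mem_nth; rewrite size_tuple.
(* A linear form vanishing on these offsets for almost all [k] vanishes on every [f i], by
   [ulim_powers_zero]. The outer factor makes [v] tend to [z0], as the sum starts with a constant
   term. *)
pose v k := z0 + s k *: \sum_(i < d) s k ^+ i *: f i.
have vl : vlim ip v z0.
  have h : vlim ip (fun k => \sum_(i < d) s k ^+ i *: f i) (\sum_(i < d) 0 ^+ i *: f i).
    by apply: (vlim_sum hip) => i _; apply: (vlimZ hip); [exact: ulimX sl|exact: vlim_cst].
  have := vlimD hip (vlim_cst ip z0) (vlimZ hip sl h).
  by rewrite scale0r addr0.
have /choice[g_ hg_] k : exists g, G g /\ g (v k) \in a.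
  by have [h _] := hA; have [_ [g Gg <-] ga] := h (v k); exists g.
have Gg_ k : G (g_ k) by case: (hg_ k).
have [g Gg gl] := iso_ulim H Gg_.
pose z := g z0.
have za : z \in a.
  apply: (vlim_mem hip (glim_app H Gg_ Gg gl vl)).
  by apply: nearW => k; case: (hg_ k).
have zmin w : (\dim (N z) <= \dim (N w))%N by rewrite (dim_normal_vspace H hN).
pose u k := g (v k).
have uE k : u k = z + s k *: \sum_(i < d) s k ^+ i *: g (f i).
  rewrite /u /v linearD/= linearZ/= linear_sum/=; congr (_ + _ *: _).
  by apply: eq_bigr => i _; rewrite linearZ.
have uN k : u k \in N z.
  rewrite uE rpredD ?(cartan_normal za za)// rpredZ// rpred_sum// => i _.
  by rewrite rpredZ// (normal_vspaceG H hN).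
have glimc (h : 'End(V)) : glim ip (fun=> h) h by move=> y; apply: vlim_cst.
have ul : vlim ip u z by apply: (glim_app (g_ := fun=> g) H).
have GVg := iso_inv H Gg.
pose h k := (g_ k \o g^-1)%VF.
have Gh k : G (h k) by apply: (iso_comp H).
have hu k : h k (u k) \in a by rewrite comp_lfunE (iso_invK H)//; case: (hg_ k).
have hl : glim ip h \1%VF.
  move=> y; rewrite id_lfunE -{2}(iso_Kinv H y Gg).
  by apply: vlim_ext (gl _) => k; rewrite comp_lfunE.
pose P (c : 'End(V)) := forall y, y \in N z -> c y = y.
have P1 : P \1%VF by move=> y _; rewrite id_lfunE.
have /choice[c hc] k : exists c, [/\ G c, P c & forall c', G c' -> P c' ->
    D (h k \o c)%VF <= D (h k \o c')%VF].
  have [||c [Gc Pc cmin]] := @iso_max _ _ _ _ H P (fun c => - D (h k \o c)%VF).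
  - by exists \1%VF; [exact: (iso_id H)|exact: P1].
  - move=> c_ c Gc_ Pc_ Gc cl; split.
      move=> y yN; apply: (vlim_unique hip (cl y)).
      by apply: vlim_ext (vlim_cst ip y) => j; rewrite Pc_.
    apply: ulimN; apply: defect_lim => y; rewrite comp_lfunE.
    have := glim_app (g_ := fun=> h k) H (fun=> Gh k) (Gh k) (glimc _) (cl y).
    by apply: vlim_ext => j; rewrite comp_lfunE.
  by exists c; split => // c' Gc' Pc'; rewrite -lerN2; apply: cmin.
pose m k := (h k \o c k)%VF.
have Gm k : G (m k) by apply: (iso_comp H) => //; case: (hc k).
have mu k : m k (u k) \in a.
  by rewrite comp_lfunE; case: (hc k) => _ -> // _; exact: hu.
have Dl : ulim (fun k => D (m k)) 0.
  apply: (@ulim_norm0 _ _ (fun k => D (h k))).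
    apply: nearW => k /=; rewrite ger0_norm ?defect_ge0//.
    case: (hc k) => _ _ /(_ _ (iso_id H) P1) /le_trans; apply.
    by rewrite comp_lfun1r.
  rewrite -(_ : D \1%VF = 0); first exact: defect_lim.
  by rewrite /D /defect big1// => i _; rewrite id_lfunE subrr (ip0l hip).
have D0id k x : D (m k) = 0 -> m k x = x.
  move=> D0; have := defect_bound eo ex (m k) x; rewrite -/D D0 sqrtr0 mulr0 mul0r => h0.
  by apply/eqP; rewrite -subr_eq0 -(nrm_eq0 hip) eq_le h0 nrm_ge0.
exists z => //.
(* If almost all [m k] are the identity, the points [u k] themselves lie in [a], and so do the
   vectors spanning [N z]. *)
have [case1|case2] := in_ultra_setVsetC [set k | D (m k) = 0] uf_ultra.
  apply/subvP => w wN; apply: (mem_orthP hip) => y hy.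
  have wN0 : (g^-1)%VF w \in N z0 by have := normal_vspaceG H hN GVg wN; rewrite (iso_invK H).
  rewrite -(iso_Kinv H w Gg) (coord_vbasis wN0) linear_sum/= (ip_suml hip) big1// => i _.
  rewrite linearZ/= (ipZl hip) -/(f i).
  suff -> : ip (g (f i)) y = 0 by rewrite mulr0.
  move: i; apply: (@ulim_powers_zero R).
  apply: filterS case1 => k /= D0.
  have := mu k; rewrite D0id// => /hy; rewrite (ipC hip) uE (ipDl hip) (ipC hip z) hy// add0r.
  rewrite (ipZl hip) => /eqP; rewrite mulf_eq0 (negbTE (s0 k))/= (ip_suml hip) => /eqP E.
  by rewrite -[RHS]E; apply: eq_bigr => i _; rewrite (ipZl hip) mulrC.
exfalso.
(* The scale is the distance of [m k] from the identity; [s k] is a positive placeholder on a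
   negligible set of indices. *)
pose E k := if D (m k) == 0 then s k else Num.sqrt (D (m k)).
have E0 k : 0 < E k.
  rewrite /E; case: eqP => [_|/eqP Dk]; first by rewrite invr_gt0.
  by rewrite sqrtr_gt0 lt_neqAle eq_sym Dk defect_ge0.
have El : ulim E 0.
  have := ulim_sqrt Dl; rewrite sqrtr0; apply: ulim_eq.
  by apply: filterS case2 => k /= /eqP; rewrite /E => /negbTE ->.
pose X_ k : 'End(V) := (E k)^-1 *: (m k - \1%VF).
have X_E k x : X_ k x = (E k)^-1 *: (m k x - x).
  by rewrite scale_lfunE add_lfunE opp_lfunE id_lfunE.
have X_bound k x : nrm ip (X_ k x) <= n%:R * nrm ip x.
  rewrite X_E nrmZ// gtr0_norm ?invr_gt0// ler_pdivrMl//.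
  have [D0|D0] := eqVneq (D (m k)) 0.
    rewrite D0id// subrr nrm0//; apply: mulr_ge0; first exact: ltW.
    by rewrite mulr_ge0// nrm_ge0.
  apply: le_trans (defect_bound eo ex (m k) x) _.
  by rewrite /E (negbTE D0) mulrA [E in E <= _]mulrC [n%:R * _]mulrC mulrC.
have [X Xl] : exists X : 'End(V), forall x, vlim ip (fun k => X_ k x) (X x).
  by apply: (endo_vlim_bounded hip) => x; exists (n%:R * nrm ip x) => k; exact: X_bound.
have lX : lie X.
  by apply: (lie_of_direction (g_ := m) (e := E) H) => // x; apply: vlim_ext (Xl x) => k.
(* Both [u k] and its image under [m k] are normal at [z], hence orthogonal to X z, while [X_ k]
   applied to [u k] tends to X z. *)
have Xz : X z = 0.
  apply/eqP; rewrite -(ip_eq0 hip); apply/eqP.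
  have Xu0 k : ip (X_ k (u k)) (X z) = 0.
    rewrite X_E (ipZl hip) (ipBl hip) (ipC hip (m k _)) (ipC hip (u k)).
    rewrite ((hN _ _).1 (uN k))// ((hN _ _).1 (cartan_normal za (mu k)))// subrr mulr0 //.
  have Xuz : vlim ip (fun k => X_ k (u k) - X_ k z) 0.
    apply: (@vlim_small _ _ _ hip _ (fun k => n%:R * nrm ip (u k - z))).
      rewrite -(mulr0 n%:R); apply: ulimM; first exact: ulim_cst.
      rewrite -(nrm0 hip) -(subrr z); apply: (vlim_nrm hip).
      by apply: (vlimB hip) => //; exact: vlim_cst.
    by move=> k; rewrite -linearB/=; exact: X_bound.
  have := vlimD hip Xuz (Xl z); rewrite add0r => h1.
  apply: (ulim_unique (vlim_ip hip h1 (vlim_cst ip (X z)))).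
  by apply: ulim_ext (ulim_cst 0) => k /=; rewrite subrK Xu0.
have Xkill y : y \in N z -> X y = 0 by apply: (minimal_normal_fixed H hN zmin lX Xz).
have [phi [M op]] := (lieP ip G X).1 lX; have [Gp hp M0 hM] := op.
pose delta k := \sum_i nrm ip ((X_ k - X) (e i)).
have dl : ulim delta 0.
  have E1 : \sum_(i < n) nrm ip (X (e i) - X (e i)) = 0.
    by rewrite big1// => i _; rewrite subrr nrm0.
  rewrite -E1; apply: ulim_sum => i _; apply: (vlim_nrm hip).
  have := vlimB hip (Xl (e i)) (vlim_cst ip (X (e i))).
  by apply: vlim_ext => k; rewrite add_lfunE opp_lfunE.
have delta0 k : 0 <= delta k by apply: sumr_ge0 => i _; exact: nrm_ge0.
(* The flow of [X] fixes [N z] pointwise, so [c k] composed with its inverse at time [E k] is a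
   competitor. As [m k] agrees with the flow to first order, the competitor leaves a distance o(E
   k), against the distance [E k] itself. *)
have better k : D (m k) <= n%:R * (E k * (delta k + M * E k)) ^+ 2.
  pose c' := (c k \o (phi (E k))^-1)%VF.
  have [Gc Pc cmin] := hc k; have Gpk := Gp (E k).
  have Gc' : G c' by apply: (iso_comp H) => //; apply: (iso_inv H).
  have Pc' : P c'.
    move=> y yN; rewrite comp_lfunE -{1}(lie_fix H (E k) op (Xkill y yN)) (iso_invK H)//.
    exact: Pc.
  apply: le_trans (cmin c' Gc' Pc') _.
  have Ek := E0 k; apply: (defect_le eo).
    by rewrite mulr_ge0 ?(ltW Ek)// addr_ge0// mulr_ge0// ltW.
  move=> x; pose y := ((phi (E k))^-1)%VF x.
  have xE : x = phi (E k) y by rewrite (iso_Kinv H).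
  have -> : (h k \o c')%VF x = m k y by rewrite !comp_lfunE.
  have -> : nrm ip x = nrm ip y by rewrite xE (iso_nrm H).
  have -> : m k y - x = E k *: ((X_ k - X) y) - (phi (E k) y - y - E k *: X y).
    rewrite -xE add_lfunE opp_lfunE X_E scalerBr scalerA mulfV ?gt_eqF// scale1r.
    by apply: (ip_eq hip) => w; rewrite !(ipE hip); ring.
  apply: le_trans (nrmB hip _ _) _; rewrite nrmZ// gtr0_norm//.
  have h1 := endo_nrm_le eo ex (X_ k - X) y; have h2 := hM (E k) y.
  have h3 : E k * nrm ip ((X_ k - X) y) <= E k * (delta k * nrm ip y).
    by rewrite ler_pM2l.
  have -> : E k * (delta k + M * E k) * nrm ip y =
     E k * (delta k * nrm ip y) + M * E k ^+ 2 * nrm ip y by ring.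
  by rewrite lerD.
have : (1 : R) <= n%:R * (0 + M * 0) ^+ 2.
  apply: (@ulim_le _ (fun=> 1) (fun k => n%:R * (delta k + M * E k) ^+ 2)).
  - exact: ulim_cst.
  - rewrite expr2; apply: (@ulim_ext _ (fun k => n%:R * ((delta k + M * E k) * (delta k + M * E k)))).
      by move=> k; rewrite expr2.
    have h1 : ulim (fun k => delta k + M * E k) (0 + M * 0).
      by apply: ulimD => //; apply: ulimM => //; exact: ulim_cst.
    by apply: ulimM; [exact: ulim_cst|exact: ulimM].
  - apply: filterS case2 => k /= /eqP D0; have := better k.
    have EE : E k ^+ 2 = D (m k) by rewrite /E (negbTE D0) sqr_sqrtr ?defect_ge0.
    rewrite exprMn mulrCA -EE -[X in X <= _]mulr1 ler_pM2l// exprn_gt0//.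
by rewrite mulr0 addr0 expr0n/= mulr0 ler10.
Qed.

Lemma regular_dense x : x \in a -> exists x_ : nat -> V,
  [/\ vlim ip x_ x, forall k, x_ k \in a & forall k, (N (x_ k) <= a)%VS].
Proof.
move=> xa; have [z za zreg] := regular_exists.
have [b [hb dimb Nb]] := perp_space hip a.
have [n [Y [lY hY]]] := lie_basis H hN.
have inj : injective (fun k => k.+1%:R : R) by move=> k l /eqP; rewrite eqr_nat => /eqP[].
have nz k : k.+1%:R != 0 :> R by rewrite pnatr_eq0.
have good0 w : w \in b -> (forall i, ip (Y i z) w = 0) -> w = 0.
  move=> wb /hY wN; apply/eqP; rewrite -memv0 -Nb memv_cap wb andbT.
  exact: (subvP zreg).
have /choice[l hl] K : exists l, (K <= l)%N /\
    forall w, w \in b -> (forall i, ip (Y i z + l.+1%:R *: Y i x) w = 0) -> w = 0.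
  by have [l Kl hl] := generic_perp hip (fun i => Y i x) inj nz good0 K; exists l.
(* General position was obtained for z + (l k + 1) x; dividing by l k + 1 gives a small perturbation
   of [x]. *)
pose t k : R := (l k).+1%:R^-1.
have xa' k : x + t k *: z \in a by rewrite rpredD ?rpredZ.
exists (fun k => x + t k *: z); split => //.
  have tl : ulim t 0.
    apply: (@ulim_norm0 _ _ (fun k => k.+1%:R^-1)); last exact: ulim_harmonic.
    apply: nearW => k /=; rewrite gtr0_norm ?invr_gt0// lef_pV2 ?posrE//.
    by rewrite ler_nat ltnS; case: (hl k).
  have := vlimD hip (vlim_cst ip x) (vlimZ hip tl (vlim_cst ip z)).
  by rewrite scale0r addr0.
move=> k; apply/subvP => w wN.
have [p pa hp] := orth_proj hip a w.
suff -> : w = p by [].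
apply/eqP; rewrite -subr_eq0; apply/eqP.
have [_ hk] := hl k; apply: hk; first exact/hb.
have wpN : w - p \in N (x + t k *: z) by rewrite rpredB// cartan_normal.
move=> i; have := (hN _ _).1 wpN _ (lY i).
have -> : Y i (x + t k *: z) = t k *: (Y i z + (l k).+1%:R *: Y i x).
  by rewrite linearD/= linearZ/= scalerDr scalerA mulVf// scale1r addrC.
by rewrite (ipZl hip) => /eqP; rewrite mulf_eq0 invr_eq0 (negbTE (nz _)) => /eqP.
Qed.

(** By (B) [a] is normal at g u, so g^-1 carries it into the normal space at [u], which lies in [a];
    dimensions agree. *)
Lemma regular_stable u g : u \in a -> (N u <= a)%VS -> G g -> g u \in a ->
  forall x, x \in a -> g x \in a.
Proof.
move=> ua ureg Gg gua; have GVg := iso_inv H Gg.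
have sV x : x \in a -> (g^-1)%VF x \in a.
  move=> xa; apply: (subvP ureg); have := normal_vspaceG H hN GVg (cartan_normal gua xa).
  by rewrite (iso_invK H).
have := stable_img H GVg sV => ga x xa.
by have := stable_inv H GVg ga xa; rewrite -{1}(iso_invK H x Gg) (iso_invK H _ GVg).
Qed.

(** Where <g u, x> is maximal, g u is normal at [x]. For regular [x] this puts g u into [a], and for
    regular [u] it makes [g] preserve [a]; density and compactness give the general case. *)
Lemma cartan_aligned u x : u \in a -> x \in a -> exists n,
  [/\ G n, forall w, w \in a -> n w \in a & aligned ip G (n u) x].
Proof.
move=> ua xa; have [u_ [ul ua_ ureg]] := regular_dense ua.
have [x_ [xl xa_ xreg]] := regular_dense xa.
have /choice[n_ hn] k : exists n, [/\ G n, forall w, w \in a -> n w \in a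
    & aligned ip G (n (u_ k)) (x_ k)].
  have [g Gg al] := orbit_max H (u_ k) (x_ k); exists g; split => //.
  apply: (regular_stable (ua_ k)) => //; apply: (subvP (xreg k)); apply/hN => X lX.
  apply: (tangent_max hip (lie_tangent H (x_ k) lX)) => _ [h Gh <-].
  exact: (alignedC H al).
have Gn k : G (n_ k) by case: (hn k).
have [n Gn' nl] := iso_ulim H Gn; exists n; split => //.
  move=> w wa; apply: (vlim_mem hip (nl w)); apply: nearW => k; case: (hn k) => _ h _; exact: h.
apply: (aligned_lim H (glim_app H Gn Gn' nl ul) xl) => k; by case: (hn k).
Qed.

End RegularPoints.

Lemma polar_coxeter_SP (R : realType) (V : vectType R) (ip : V -> V -> R)
    (G : set 'End(V)) (a : {vspace V}) : isometry_group ip G ->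
  cartan_subspace ip G a -> coxeter_group (restrict_ip ip a) (weyl_group G a) ->
  property_SP G.
Proof.
move=> H hA hW; have hip := iso_inner H.
have [N hN] := normal_vspace H.
have hipa : inner (restrict_ip ip a).
  split; rewrite /restrict_ip.
  - by move=> c x y z; rewrite linearP/= (ipDl hip) (ipZl hip).
  - by move=> x y; exact: ipC.
  - move=> x x0; apply: (ip_gt0 hip); apply: contraNneq x0 => e.
    by apply/eqP; apply: subvs_inj; rewrite e linear0.
have [C [Corb Cadd Cdom]] := coxeter_chamber hipa hW.
have toC v : exists g (x : subvs_of a), [/\ G g, C x & g v = vsval x].
  have [+ _] := hA; move=> /(_ v)[_ [h Gh <-] ha].
  have [w [g Gg [ga wg]] Cw] := Corb (vsproj a (h v)).
  exists (g \o h)%VF, (w (vsproj a (h v))); split => //; first exact: (iso_comp H).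
  by rewrite wg vsprojK// comp_lfunE.
(* The maximum over [G] is attained at an element restricting to the Weyl group, where the Coxeter
   chamber bounds it by <x, y>. *)
have Cal (x y : subvs_of a) : C x -> C y -> aligned ip G (vsval x) (vsval y).
  move=> Cx Cy; have [n [Gn na al]] := cartan_aligned H hN hA (subvsP x) (subvsP y).
  have [f Wf fn] := stable_restrict H Gn na.
  have := Cdom x y f Wf Cx Cy; rewrite /restrict_ip fn => le1 g Gg.
  apply: le_trans le1; have := al _ (iso_comp H Gg (iso_inv H Gn)).
  by rewrite comp_lfunE (iso_invK H).
move=> u v; have [g [x [Gg Cx gu]]] := toC u; have [h [y [Gh Cy hv]]] := toC v.
have orbE k w : G k -> orbit G (k w) = orbit G w.
  move=> Gk; apply/seteqP; split => _ [l Gl <-].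
    by exists (l \o k)%VF; [exact: (iso_comp H)|rewrite comp_lfunE].
  exists (l \o k^-1)%VF; first by apply: (iso_comp H) => //; apply: (iso_inv H).
  by rewrite comp_lfunE (iso_invK H).
exists (vsval x + vsval y).
rewrite -(orbE g u Gg) -(orbE h v Gh) gu hv; apply: (supp_minkowski (H := H)) => p.
(* Support functions are [G]-invariant, so it is enough to compare them at chamber points, where
   alignment makes them linear. *)
have [k [q [Gk Cq kp]]] := toC p.
have cv w : supp H w p = supp H w (vsval q) by rewrite -kp suppGr.
rewrite !cv !supp_aligned ?(ipDl hip)//; try exact: Cal.
rewrite -linearD; apply: Cal => //; exact: Cadd.
Qed.

Lemma dot_inner (R : realType) (V : vectType R) (ip : {dot V for idfun}) : inner ip.
Proof.
split.
- by move=> a x y z; rewrite linearPl.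
- by move=> x y; rewrite hermC expr0 mul1r.
- exact: neq0_dnorm_gt0.
Qed.

Theorem theorem1 (R : realType) (V : vectType R) (ip : {dot V for idfun})
    (G : set 'End(V)) (hG : linear_group G) (hc : compact_endos G)
    (hO : orthogonal_endos ip G) :
  property_SP G <->
  exists a : {vspace V},
    cartan_subspace ip G a /\
    coxeter_group (restrict_ip ip a) (weyl_group G a).
Proof.
have H : isometry_group ip G by split => //; exact: dot_inner.
split=> [|[a [hA hW]]]; first exact: (SP_polar_coxeter H).
exact: (polar_coxeter_SP H hA hW).
Qed.
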